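(* Let $X=(x_0,x_1)$ with $x_0<x_1$, and let $\zeta:X\to\mathbb{R}_+$ be bounded, positive and piecewise absolutely continuous on $X$, with $1/\zeta$ bounded and with jump points confined to $\{y_1,\ldots,y_n\}$, where $$x_0=y_0<y_1<\cdots<y_n<y_{n+1}=x_1.$$ Let $\sigma\in\mathbb{R}\setminus\{0\}$, and let $x\in X$ satisfy $y_j<x<y_{j+1}$ for some $0\le j\le n$. Then the unique solution $u$ of $$(\zeta u')'+\sigma^2\zeta u=0\quad\text{on }X$$ with prescribed data at $x_0+$ is given, in terms of the vector $A(x,\sigma)=\frac{\sqrt{\zeta(x)}}{2}\begin{pmatrix}1&-\frac1{i\sigma}\\ 1&\frac1{i\sigma}\end{pmatrix}\binom{u(x,\sigma)}{u'(x,\sigma)}$, by $$A(x,\sigma)=G(y_j,x,\sigma)\,J(y_j)\,G(y_{j-1},y_j,\sigma)\cdots J(y_1)\,G(x_0,y_1,\sigma)\,A(x_0+,\sigma)$$ (for $j=0$ the right-hand side is $G(x_0,x,\sigma)A(x_0+,\sigma)$).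
   Context: Piecewise absolutely continuous with jump points confined to $\{y_1,\dots,y_n\}$ means that $\zeta$ is absolutely continuous on each interval $(y_k,y_{k+1})$, $0\le k\le n$ (so one-sided limits exist at the $y_k$). A solution of $(\zeta u')'+\sigma^2\zeta u=0$ is a function $u(\cdot,\sigma)\in W^{1,2}(X)$ satisfying the equation in the sense of distributions; in particular $u$ and $\zeta u'$ are continuous in $x$. Prescribing $u(x_0+,\sigma)$ and $u'(x_0+,\sigma)$ is equivalent to prescribing $A(x_0+,\sigma)\in\mathbb{C}^2$. Jump matrix. For $x\in X$, $\gamma(x)=\zeta(x-)/\zeta(x+)$ and $$J(x)=\frac{1}{2\sqrt{\gamma(x)}}\begin{pmatrix}1+\gamma(x)&1-\gamma(x)\\ 1-\gamma(x)&1+\gamma(x)\end{pmatrix}.$$ Harmonic exponential operator. For an interval $(p,r)$ and a real-valued $\alpha$ integrable on $(p,r)$, define for $\sigma\in\mathbb{C}$ $$E^{(p,r)}_\alpha(\sigma)=1+\sum_{j=1}^\infty\ \int_{p<s_1<\cdots<s_j<r}e^{2i\sigma\kappa(s_1,\ldots,s_j)}\prod_{\nu=1}^j\alpha(s_\nu)\,ds_1\cdots ds_j,$$ where $\kappa(s_1,\ldots,s_j)=(s_j-s_{j-1})+(s_{j-2}-s_{j-3})+\cdots+(s_2-s_1)$ if $j$ is even, and $\kappa(s_1,\ldots,s_j)=(s_j-s_{j-1})+(s_{j-2}-s_{j-3})+\cdots+(s_3-s_2)+(s_1-p)$ if $j$ is odd (so $\kappa(s_1)=s_1-p$ for $j=1$).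 Further, $\mathrm{Cosh}^{(p,r)}_\alpha=\frac12\left(E^{(p,r)}_\alpha+E^{(p,r)}_{-\alpha}\right)$ and $\mathrm{Sinh}^{(p,r)}_\alpha=\frac12\left(E^{(p,r)}_\alpha-E^{(p,r)}_{-\alpha}\right)$. Propagation matrix. On each interval $(y_k,y_{k+1})$ put $\alpha=-\frac12(\log\zeta)'$. For $y_k<r\le y_{k+1}$, $$G(y_k,r,\sigma)=\begin{pmatrix}z&-w\\ -\bar w&\bar z\end{pmatrix},\quad z=e^{-i(r-y_k)\sigma}\,\mathrm{Cosh}^{(y_k,r)}_\alpha(\sigma),\quad w=e^{-i(r-y_k)\sigma}\,\mathrm{Sinh}^{(y_k,r)}_\alpha(\sigma).$$ *)

(* Defs.v *)
(* Complex numbers are R[i] for R : realType. *)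
From HB Require Import structures.
From mathcomp Require Import all_boot all_order all_algebra.
From mathcomp Require Import all_classical all_reals all_analysis.
From mathcomp Require Import complex.

Set Implicit Arguments.
Unset Strict Implicit.
Unset Printing Implicit Defensive.

Import Order.TTheory GRing.Theory Num.Theory.
Import numFieldNormedType.Exports.

Local Open Scope classical_set_scope.
Local Open Scope complex_scope.
Local Open Scope ring_scope.

Local Notation Re := complex.Re.
Local Notation Im := complex.Im.

(* Complex analysis of functions of a real variable, done componentwise. As in
   the library, [lim], [Rintegral] and [derive1] are total: they take default
   values where the limit, integral or derivative does not exist. *)

Definition cexp (R : realType) (z : R[i]) : R[i] :=
  (expR (Re z) * cos (Im z)) +i* (expR (Re z) * sin (Im z)).

Definition cintegral (R : realType) (D : set R) (f : R -> R[i]) : R[i] :=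
  (\int[@lebesgue_measure R]_(x in D) Re (f x))
    +i* (\int[@lebesgue_measure R]_(x in D) Im (f x)).

Definition cderive1 (R : realType) (f : R -> R[i]) (x : R) : R[i] :=
  (derive1 (fun t => Re (f t)) x) +i* (derive1 (fun t => Im (f t)) x).

Definition cseries_sum (R : realType) (f : nat -> R[i]) : R[i] :=
  (limn (series (fun k => Re (f k)))) +i* (limn (series (fun k => Im (f k)))).

Definition ccontinuous_at (R : realType) (f : R -> R[i]) (x : R) : Prop :=
  {for x, continuous (fun t => Re (f t))} /\
  {for x, continuous (fun t => Im (f t))}.

Definition cvg_right (R : realType) (f : R -> R[i]) (x : R) (l : R[i]) : Prop :=
  Re (f t) @[t --> x^'+] --> Re l /\ Im (f t) @[t --> x^'+] --> Im l.

Definition clim_right (R : realType) (f : R -> R[i]) (x : R) : R[i] :=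
  (lim (Re (f t) @[t --> x^'+])) +i* (lim (Im (f t) @[t --> x^'+])).

Definition left_lim (R : realType) (f : R -> R) (x : R) : R :=
  lim (f t @[t --> x^'-]).
Definition right_lim (R : realType) (f : R -> R) (x : R) : R :=
  lim (f t @[t --> x^'+]).

Definition absolutely_continuous (R : realType) (D : set R) (f : R -> R) : Prop :=
  forall e : R, 0 < e -> exists2 d : R, 0 < d &
    forall (m : nat) (s t : 'I_m -> R),
      (forall i, s i <= t i /\ `[s i, t i] `<=` D) ->
      trivIset [set: 'I_m] (fun i => [set` `]s i, t i[]) ->
      \sum_(i < m) (t i - s i) < d ->
      \sum_(i < m) `|f (t i) - f (s i)| < e.

(* The space C_c^oo(]a, b[). Real-valued test functions suffice, since the
   pairing with a complex-valued distribution is complex-linear. *)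
Definition test_function (R : realType) (a b : R) (phi : R -> R) : Prop :=
  (forall (k : nat) (x : R), derivable (derive1n k phi) x 1) /\
  exists c d : R, [/\ a < c, d < b & forall x, x \notin `[c, d] -> phi x = 0].

Definition square_integrable (R : realType) (D : set R) (f : R -> R[i]) : Prop :=
  [/\ measurable_fun D (fun x => Re (f x)),
      measurable_fun D (fun x => Im (f x)) &
      (\int[@lebesgue_measure R]_(x in D)
         (Re (f x) ^+ 2 + Im (f x) ^+ 2)%:E < +oo)%E].

Definition is_weak_derivative (R : realType) (a b : R) (u v : R -> R[i]) : Prop :=
  forall phi : R -> R, test_function a b phi ->
    cintegral `]a, b[ (fun x => u x * (derive1 phi x)%:C) =
    - cintegral `]a, b[ (fun x => v x * (phi x)%:C).

(* Distributional solutions in W^{1,2}(]a, b[) of (zeta u')' + sigma^2 zeta u = 0.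
   The first clause selects the continuous representative of the Sobolev class;
   [v] is (a representative of) its weak derivative. For [phi] a test function,
   the distribution (zeta v)' sends [phi] to minus the integral of
   zeta v phi'. The equation makes zeta v have a continuous representative, so
   that u is C^1 wherever zeta is continuous, and u'(x) there is the classical
   derivative [cderive1 u x]. *)
Definition is_solution (R : realType) (a b : R) (zeta : R -> R) (sigma : R)
    (u : R -> R[i]) : Prop :=
  (forall x, x \in `]a, b[ -> ccontinuous_at u x) /\
  exists v : R -> R[i],
    [/\ square_integrable `]a, b[ u,
        square_integrable `]a, b[ v,
        is_weak_derivative a b u v &
        forall phi : R -> R, test_function a b phi ->
          - cintegral `]a, b[
              (fun x => (zeta x)%:C * v x * (derive1 phi x)%:C)
          + (sigma ^+ 2)%:C * cintegral `]a, b[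
              (fun x => (zeta x)%:C * u x * (phi x)%:C) = 0].

Definition mx22 (T : Type) (a b c d : T) : 'M[T]_2 :=
  \matrix_(i, j) if i == ord0 then (if j == ord0 then a else b)
                 else (if j == ord0 then c else d).

Definition cv2 (T : Type) (a b : T) : 'cV[T]_2 :=
  \col_i if i == ord0 then a else b.

Definition jump_ratio (R : realType) (zeta : R -> R) (x : R) : R :=
  left_lim zeta x / right_lim zeta x.

Definition jump_matrix (R : realType) (zeta : R -> R) (x : R) : 'M[R[i]]_2 :=
  let g := jump_ratio zeta x in
  map_mx (real_complex R)
    ((2 * Num.sqrt g)^-1 *: mx22 (1 + g) (1 - g) (1 - g) (1 + g)).

(* [simplex_integral j p r F] is the integral of F over p < s_1 < ... < s_j < r,
   as the iterated integral with s_j outermost in ]p, r[, then s_(j-1) in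
   ]p, s_j[, down to s_1. The argument passed to F is the decreasing list
   [:: s_j; ...; s_1]; [kappa] below takes its list in this order as well. *)
Fixpoint simplex_integral (R : realType) (j : nat) (p r : R)
    (F : seq R -> R[i]) : R[i] :=
  if j is j'.+1 then
    cintegral `]p, r[ (fun s => simplex_integral j' p s (fun l => F (s :: l)))
  else F [::].

Fixpoint kappa (R : realType) (p : R) (l : seq R) : R :=
  match l with
  | [::] => 0
  | [:: s1] => s1 - p
  | s :: s' :: l' => (s - s') + kappa p l'
  end.

Definition harmonic_term (R : realType) (alpha : R -> R) (p r : R) (sigma : R[i])
    (j : nat) : R[i] :=
  simplex_integral j p r
    (fun l => cexp (2 * 'i%C * sigma * (kappa p l)%:C)
              * (\prod_(s <- l) alpha s)%:C).

Definition harmonic_exp (R : realType) (alpha : R -> R) (p r : R)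
    (sigma : R[i]) : R[i] :=
  1 + cseries_sum (fun j => harmonic_term alpha p r sigma j.+1).

Definition harmonic_cosh (R : realType) (alpha : R -> R) (p r : R)
    (sigma : R[i]) : R[i] :=
  2^-1 * (harmonic_exp alpha p r sigma
          + harmonic_exp (fun s => - alpha s) p r sigma).

Definition harmonic_sinh (R : realType) (alpha : R -> R) (p r : R)
    (sigma : R[i]) : R[i] :=
  2^-1 * (harmonic_exp alpha p r sigma
          - harmonic_exp (fun s => - alpha s) p r sigma).

(* alpha = - (log zeta)' / 2, defined almost everywhere. *)
Definition reflectivity (R : realType) (zeta : R -> R) (x : R) : R :=
  - 2^-1 * derive1 (fun t => ln (zeta t)) x.

Definition propagation_matrix (R : realType) (zeta : R -> R) (p r : R)
    (sigma : R[i]) : 'M[R[i]]_2 :=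
  let alpha := reflectivity zeta in
  let phase := cexp (- 'i%C * (r - p)%:C * sigma) in
  let z := phase * harmonic_cosh alpha p r sigma in
  let w := phase * harmonic_sinh alpha p r sigma in
  mx22 z (- w) (- w^*%C) z^*%C.

(* J(y_j) G(y_(j-1), y_j) ... J(y_1) G(y_0, y_1) *)
Fixpoint transfer_matrix (R : realType) (zeta : R -> R) (y : nat -> R)
    (sigma : R[i]) (j : nat) : 'M[R[i]]_2 :=
  if j is j'.+1 then
    jump_matrix zeta (y j)
      *m propagation_matrix zeta (y j') (y j) sigma
      *m transfer_matrix zeta y sigma j'
  else 1%:M.

(* A(x, sigma); meaningful at points where zeta is continuous and u is C^1. *)
Definition amplitude (R : realType) (zeta : R -> R) (sigma : R)
    (u : R -> R[i]) (x : R) : 'cV[R[i]]_2 :=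
  (Num.sqrt (zeta x) / 2)%:C
    *: (mx22 1 (- ('i%C * sigma%:C)^-1) 1 ('i%C * sigma%:C)^-1
        *m cv2 (u x) (cderive1 u x)).

Definition amplitude_right (R : realType) (zeta : R -> R) (sigma : R)
    (u : R -> R[i]) (x : R) : 'cV[R[i]]_2 :=
  \col_i clim_right (fun t => amplitude zeta sigma u t i ord0) x.

(* Main.v *)
Require Import Defs.
From HB Require Import structures.
From mathcomp Require Import all_boot all_order all_algebra.
From mathcomp Require Import all_classical all_reals all_analysis.
From mathcomp Require Import complex.
From mathcomp Require Import measurable_realfun ring lra.

Set Implicit Arguments.
Unset Strict Implicit.
Unset Printing Implicit Defensive.

Import Order.TTheory GRing.Theory Num.Theory.
Import numFieldNormedType.Exports.
Import HBNNSimple.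

Local Open Scope classical_set_scope.
Local Open Scope complex_scope.
Local Open Scope ring_scope.

(* With L = log zeta and V = zeta u', the equation is the system u' = V e^(-L),
   V' = - sigma^2 e^L u with real integrable coefficients, so the real and
   imaginary parts of u can be treated separately. Picard iteration solves it,
   and the constancy of the Wronskian of trace-free systems gives uniqueness.
   Since absolutely continuous functions are integrals of their derivatives
   (Radon-Nikodym), the lemma of du Bois-Reymond, proved at Lebesgue points,
   shows that a distributional solution is a solution of the system.

   Where zeta is absolutely continuous, undoing the free rotation of the
   amplitude turns the system into e' = - alpha e^(2 i sigma (x - p)) conj(e),
   and the Picard series of e' = alpha e^(2 i sigma (x - p)) conj(e) is the
   series that defines the harmonic exponential: this yields the propagation
   matrix. At a jump of zeta, u and V are continuous, and changing zeta from
   its left to its right limit in the amplitude is the jump matrix. *)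

Local Notation leb := (@lebesgue_measure _).
Local Notation Re := complex.Re.
Local Notation Im := complex.Im.

(** * Absolute continuity and the fundamental theorem of calculus *)

(** Two obstacles shape the proof. Conjugation is only real-linear, so the equation behind the
    harmonic exponential is no complex linear system. It is a trace-free real 2 x 2 system for the
    real and imaginary parts, and a basis of its solutions takes two harmonic exponentials: that of
    - alpha, and i times that of alpha, since multiplication by i anticommutes with conjugation.
    Cosh and Sinh appear as their half sum and half difference once the real and imaginary parts of
    u are put together again. The other obstacle is that [derive1] is total: [reflectivity] is
    controlled only almost everywhere and takes default values elsewhere. Hence an integrable
    representative replaces it, systems are solved by absolutely continuous functions with the
    equation holding almost everywhere, and integrals are compared for integrands that agree almost
    everywhere without being known to be measurable. Extending absolutely continuous functions to
    closed intervals turns one-sided limits at the points y_k into endpoint values. *)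

Definition nonoverlapping (R : realType) (I J : R * R) : bool :=
  (I.2 <= J.1) || (J.2 <= I.1).

(* Absolute continuity on the closed interval [p, q]. The families are lists
   because these are easier to split, concatenate and refine than the
   ordinal-indexed families of [absolutely_continuous]. *)
Definition ac_on (R : realType) (p q : R) (f : R -> R) : Prop :=
  forall e : R, 0 < e -> exists2 d : R, 0 < d &
    forall l : seq (R * R),
      all (fun I => [&& p <= I.1, I.1 <= I.2 & I.2 <= q]) l ->
      pairwise (@nonoverlapping R) l ->
      \sum_(I <- l) (I.2 - I.1) < d ->
      \sum_(I <- l) `|f I.2 - f I.1| < e.

Lemma absolutely_continuous_seq (R : realType) (p q : R) (f : R -> R) :
  absolutely_continuous `]p, q[ f ->
  forall e : R, 0 < e -> exists2 d : R, 0 < d &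
    forall l : seq (R * R),
      all (fun I => [&& p < I.1, I.1 <= I.2 & I.2 < q]) l ->
      pairwise (@nonoverlapping R) l ->
      \sum_(I <- l) (I.2 - I.1) < d ->
      \sum_(I <- l) `|f I.2 - f I.1| < e.
Proof.
move=> acf e e0; have [d d0 H] := acf e e0; exists d => // l al pl.
set s := fun i : 'I_(size l) => (nth (0, 0) l i).1.
set t := fun i : 'I_(size l) => (nth (0, 0) l i).2.
rewrite !(big_nth (0, 0)) !big_mkord => ld.
apply: (H (size l) s t) => //.
- move=> i; have /allP/(_ _ (mem_nth (0, 0) (ltn_ord i))) := al.
  move=> /and3P[? st ?]; split => // x /=; rewrite !in_itv /= => /andP[? ?].
  by apply/andP; split; lra.
- have sep (i j : 'I_(size l)) : (i < j)%N ->
      nonoverlapping (nth (0, 0) l i) (nth (0, 0) l j).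
    by move=> ij; move/(pairwiseP (0, 0)) : pl => /(_ i j); apply; rewrite ?inE.
  have disj (i j : 'I_(size l)) x : nonoverlapping (nth (0, 0) l i) (nth (0, 0) l j) ->
      x \in `]s i, t i[ -> x \in `]s j, t j[ -> False.
    rewrite /= !in_itv /= /nonoverlapping => sij /andP[a b] /andP[c d'].
    case/orP: sij => h.
      by have := lt_le_trans b (le_trans h (ltW c)); rewrite ltxx.
    by have := lt_le_trans d' (le_trans h (ltW a)); rewrite ltxx.
  move=> i j _ _ [x [xi xj]]; case: (ltngtP i j) => ij.
  + by exfalso; exact: (disj i j x (sep _ _ ij)).
  + by exfalso; exact: (disj j i x (sep _ _ ij)).
  + exact/val_inj.
Qed.

(** A single criterion from which sums, products and compositions with Lipschitz functions
    follow. *)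
Lemma ac_on_dominated (R : realType) (p q : R) (f g F : R -> R) (C : R) :
  ac_on p q f -> ac_on p q g ->
  (forall s t, p <= s -> s <= t -> t <= q ->
    `|F t - F s| <= C * (`|f t - f s| + `|g t - g s|)) ->
  ac_on p q F.
Proof.
move=> acf acg HF e e0.
have C1 : 0 < `|C| + 1 by rewrite ltr_wpDl.
have e2 : 0 < e / (`|C| + 1) / 2 by rewrite !divr_gt0.
have [d1 d10 H1] := acf _ e2.
have [d2 d20 H2] := acg _ e2.
exists (Num.min d1 d2); first by rewrite lt_min d10 d20.
move=> l al pl; rewrite lt_min => /andP[l1 l2].
apply: (@le_lt_trans _ _ ((`|C| + 1) *
   (\sum_(I <- l) `|f I.2 - f I.1| + \sum_(I <- l) `|g I.2 - g I.1|))).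
  rewrite -big_split /= mulr_sumr !big_seq; apply: ler_sum => I Il.
  have /and3P[? ? ?] := allP al _ Il.
  apply: le_trans (HF _ _ _ _ _) _ => //.
  apply: ler_wpM2r; first by rewrite addr_ge0.
  by rewrite (le_trans (ler_norm _)) // lerDl.
rewrite mulrC -ltr_pdivlMr // [ltRHS]splitr.
by apply: ltrD; [exact: H1|exact: H2].
Qed.

(** Points are pushed into the open interval by the clamps [clip n]. A clamp increases no length and
    keeps intervals nonoverlapping, so one modulus for f serves all compositions of f with clamps
    and passes to their limit F. The limit exists because the clamped images of x under [clip n] and
    [clip m] are at distance at most |h n - h m|. *)
Lemma ac_on_extend (R : realType) (p q : R) (f : R -> R) : p < q ->
  absolutely_continuous `]p, q[ f ->
  exists2 F : R -> R, ac_on p q F & forall x, p < x < q -> F x = f x.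
Proof.
move=> pq /absolutely_continuous_seq acf.
(* The denominator [n.+3] keeps [h n] below half the length, so that p + h n < q - h n. *)
pose h n : R := (q - p) / (n.+3)%:R.
have h0 n : 0 < h n by rewrite divr_gt0 ?subr_gt0.
have h_half n : h n < (q - p) / 2.
  by rewrite ltr_pM2l ?subr_gt0 // ltf_pV2 ?posrE // ltr_nat.
pose clip (n : nat) (x : R) : R := Num.max (p + h n) (Num.min x (q - h n)).
have clip_in n (x : R) : (p < clip n x) && (clip n x < q).
  have := h_half n; have := h0 n; rewrite /clip => A B.
  by rewrite lt_max gt_max gt_min; apply/andP; split; lra.
have clip_le n (x z : R) : x <= z -> clip n x <= clip n z.
  by move=> xz; rewrite /clip ge_max !le_max !le_min !ge_min lexx /=; lra.
have clip_sub n (x z : R) : x <= z -> clip n z - clip n x <= z - x.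
  have := h_half n; have := h0 n => A B.
  by rewrite /clip => xz; rewrite /Order.max /Order.min; do ! case: ifPn; lra.
have clip_dist n m x : p <= x -> x <= q -> `|clip n x - clip m x| <= `|h n - h m|.
  move=> px xq; have := h_half n; have := h_half m; have := h0 n; have := h0 m.
  have := ler_norm (h n - h m); have := ler_norm (h m - h n).
  rewrite [ `|h m - _|]distrC ler_norml => N1 N2 A B A' B'.
  by rewrite /clip /Order.max /Order.min; do ! case: ifPn; lra.
have hcvg : h n @[n --> \oo] --> 0.
  rewrite -[X in _ --> X](mulr0 (q - p)); apply: cvgMr.
  have := @cvg_harmonic R; rewrite -(cvg_shiftn 2).
  by under eq_fun do rewrite addn2.
have hcau (d : R) : 0 < d -> \forall n \near \oo, `|h n| < d.
  by move=> d0; exact: (cvgr0_norm_lt _ hcvg).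
have fdist (e d : R) n m (x : R) : p <= x -> x <= q ->
    (forall l : seq (R * R),
      all (fun I => [&& p < I.1, I.1 <= I.2 & I.2 < q]) l ->
      pairwise (@nonoverlapping R) l ->
      \sum_(I <- l) (I.2 - I.1) < d -> \sum_(I <- l) `|f I.2 - f I.1| < e) ->
    `|h n - h m| < d -> `|f (clip n x) - f (clip m x)| < e.
  move=> px xq H; wlog le : n m / clip n x <= clip m x => [hw|nm].
    have [|/ltW] := leP (clip n x) (clip m x); first exact: hw.
    by rewrite [ `|h n - _|]distrC [ `|f _ - _|]distrC; apply: hw.
  have := H [:: (clip n x, clip m x)]; rewrite !big_seq1 /= andbT distrC; apply => //.
    by have /andP[-> _] := clip_in n x; have /andP[_ ->] := clip_in m x; rewrite le.
  apply: le_lt_trans nm; rewrite [leRHS]distrC; apply: le_trans (clip_dist _ _ _ px xq).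
  exact: ler_norm.
have fcvg x : p <= x -> x <= q -> cvg (f (clip n x) @[n --> \oo]).
  move=> px xq; apply/cauchy_cvgP/cauchy_ballP => e e0.
  have [d d0 H] := acf e e0.
  near_simpl; near=> n m.
  have nm : `|h n - h m| < d.
    rewrite (le_lt_trans (ler_normB _ _)) // [ltRHS]splitr ltrD //.
      by near: n; apply: hcau; rewrite divr_gt0.
    by near: m; apply: hcau; rewrite divr_gt0.
  exact: fdist H nm.
exists (fun x => limn (fun n => f (clip n x))).
  (* Only a weak inequality survives the limit, hence e / 2. *)
  move=> e e0; have e2 : 0 < e / 2 by rewrite divr_gt0.
  have [d d0 H] := acf _ e2; exists d => // l al pl ld.
  apply: (@le_lt_trans _ _ (e / 2)); last by rewrite ltr_pdivrMr // ltr_pMr // ltr1n.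
  have cl : (fun n => \sum_(I <- l) `|f (clip n I.2) - f (clip n I.1)|) @ \oo -->
     \sum_(I <- l) `|limn (fun n => f (clip n I.2)) - limn (fun n => f (clip n I.1))|.
    rewrite big_seq; under eq_fun do rewrite big_seq.
    apply: cvg_big => [|I Il]; first exact: add_continuous.
    have /and3P[? ? ?] := allP al _ Il.
    by apply: cvg_norm; apply: cvgB; apply: fcvg => //; lra.
  apply: (cvgr_to_le cl); apply: nearW => n; apply/ltW.
  have := H (map (fun I => (clip n I.1, clip n I.2)) l); rewrite !big_map; apply.
  - apply/allP => _ /mapP[I Il ->] /=; have /and3P[? ? ?] := allP al _ Il.
    have /andP[-> _] := clip_in n I.1; have /andP[_ ->] := clip_in n I.2.
    by rewrite clip_le.
  - rewrite pairwise_map; apply: sub_pairwise pl => I J /=.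
    by rewrite /nonoverlapping /= => /orP[] k; rewrite (clip_le _ _ _ k) ?orbT.
  - apply: le_lt_trans ld; rewrite !big_seq; apply: ler_sum => I Il.
    have /and3P[? ? ?] := allP al _ Il.
    exact: clip_sub.
move=> x /andP[px xq].
apply: cvg_lim => //; apply: cvg_near_cst.
have m0 : 0 < Num.min (x - p) (q - x) by rewrite lt_min !subr_gt0 px.
near=> n; have : `|h n| < Num.min (x - p) (q - x) by near: n; exact: hcau.
rewrite gtr0_norm // lt_min => /andP[A B].
by congr f; rewrite /clip min_l ?max_r //; lra.
Unshelve. all: by end_near. Qed.

Lemma ac_on_dist (R : realType) (p q : R) (f : R -> R) : ac_on p q f ->
  forall e : R, 0 < e -> exists2 d : R, 0 < d &
   forall x y, p <= x <= q -> p <= y <= q -> `|x - y| < d -> `|f x - f y| < e.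
Proof.
move=> acf e e0; have [d d0 H] := acf e e0; exists d => // x y.
wlog xy : x y / y <= x => [hw|/andP[px xq] /andP[py yq]].
  have [|/ltW] := leP y x; first exact: hw.
  by move=> xy ix iy; rewrite distrC [ `|f _ - _|]distrC; exact: hw.
have := H [:: (y, x)]; rewrite !big_seq1 /= py xy xq /=.
by rewrite [ `|x - y|]ger0_norm ?subr_ge0 //; exact.
Qed.

Lemma ac_on_continuous (R : realType) (p q : R) (f : R -> R) : ac_on p q f ->
  {within `[p, q], continuous f}.
Proof.
move=> /ac_on_dist acf; apply/subspace_continuousP => x; rewrite /= in_itv /= => xpq.
apply/cvgrPdist_lt => e /acf[d d0 H]; rewrite near_withinE; near=> y.
rewrite /= in_itv /= => ypq; apply: H => //.
Unshelve. all: by end_near. Qed.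

Lemma ac_on_bounded (R : realType) (p q : R) (f : R -> R) : p <= q ->
  ac_on p q f -> exists2 M : R, 0 < M & forall x, p <= x <= q -> `|f x| <= M.
Proof.
move=> pq /ac_on_continuous cf.
have [c _ Hc] := EVT_max pq cf; have [c' _ Hc'] := EVT_min pq cf.
exists (Num.max 1 (Num.max (f c) (- f c'))); first by rewrite lt_max ltr01.
move=> x xpq; rewrite ler_norml lerNl !le_max Hc ?lerN2 ?Hc' ?orbT //.
Qed.

Lemma ac_on_lipschitz (R : realType) (p q C : R) (f F : R -> R) : ac_on p q f ->
  (forall s t, p <= s <= q -> p <= t <= q -> `|F t - F s| <= C * `|f t - f s|) ->
  ac_on p q F.
Proof.
move=> acf H; apply: (ac_on_dominated (C := `|C|) acf acf) => s t ps st tq.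
apply: le_trans (H _ _ _ _) _; try (apply/andP; split; lra).
rewrite mulrDr ler_wpDr ?mulr_ge0 // ler_wpM2r //; exact: ler_norm.
Qed.

Lemma ac_on_id (R : realType) (p q : R) : ac_on p q id.
Proof.
move=> e e0; exists e => // l al _; rewrite !big_seq => H.
rewrite (eq_bigr (fun I => I.2 - I.1)) // => I Il.
by have /and3P[? ? ?] := allP al _ Il; rewrite ger0_norm // subr_ge0.
Qed.

Lemma ac_on_cst (R : realType) (p q c : R) : ac_on p q (fun=> c).
Proof.
apply: (ac_on_lipschitz (C := 0) (@ac_on_id R p q)) => s t _ _.
by rewrite subrr normr0 mul0r.
Qed.

Lemma ac_onD (R : realType) (p q : R) (f g : R -> R) :
  ac_on p q f -> ac_on p q g -> ac_on p q (fun x => f x + g x).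
Proof.
move=> acf acg; apply: (ac_on_dominated (C := 1) acf acg) => s t _ _ _.
by rewrite mul1r opprD addrACA ler_normD.
Qed.

Lemma ac_onM (R : realType) (p q : R) (f g : R -> R) :
  ac_on p q f -> ac_on p q g -> ac_on p q (fun x => f x * g x).
Proof.
have [pq|qp] := leP p q; last first.
  move=> _ _ e e0; exists 1 => // -[|I l] /=; first by rewrite !big_nil.
  by move=> /andP[/and3P[? ? ?] _]; lra.
move=> acf acg; have [M M0 HM] := ac_on_bounded pq acf.
have [N N0 HN] := ac_on_bounded pq acg.
apply: (ac_on_dominated (C := M + N) acf acg) => s t ps st tq.
have -> : f t * g t - f s * g s = f t * (g t - g s) + (f t - f s) * g s by ring.
apply: le_trans (ler_normD _ _) _; rewrite !normrM.
have /HM Mt : p <= t <= q by rewrite tq andbT (le_trans ps).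
have /HN Ns : p <= s <= q by rewrite ps (le_trans st).
have := normr_ge0 (f t - f s); have := normr_ge0 (g t - g s); nra.
Qed.

Lemma ac_onN (R : realType) (p q : R) (f : R -> R) :
  ac_on p q f -> ac_on p q (fun x => - f x).
Proof.
move=> acf; apply: (ac_on_lipschitz (C := 1) acf) => s t _ _.
by rewrite mul1r opprK addrC distrC.
Qed.

Lemma ac_onB (R : realType) (p q : R) (f g : R -> R) :
  ac_on p q f -> ac_on p q g -> ac_on p q (fun x => f x - g x).
Proof. by move=> acf acg; apply: ac_onD => //; exact: ac_onN. Qed.

Lemma ac_on_sub (R : realType) (p q p' q' : R) (f : R -> R) :
  p <= p' -> q' <= q -> ac_on p q f -> ac_on p' q' f.
Proof.
move=> pp qq acf e /acf[d d0 H]; exists d => // l al; apply: H.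
by apply: sub_all al => I /and3P[? -> ?]; apply/and3P; split => //; lra.
Qed.

(** * Total variation and the Jordan decomposition *)

Fixpoint steps (R : realType) (a : R) (s : seq R) : seq (R * R) :=
  if s is x :: s' then (a, x) :: steps x s' else [::].

Lemma variation_steps (R : realType) (a b : R) (f : R -> R) (s : seq R) :
  itv_partition a b s ->
  variation a b f s = \sum_(I <- steps a s) `|f I.2 - f I.1|.
Proof.
move=> /variation_zip ->; elim: s a => [|x s IH] a; first by rewrite !big_nil.
by rewrite [steps _ _]/= !big_cons -IH.
Qed.

Lemma steps_itv (R : realType) (a b : R) (s : seq R) : itv_partition a b s ->
  [/\ all (fun I => [&& a <= I.1, I.1 <= I.2 & I.2 <= b]) (steps a s),
      pairwise (@nonoverlapping R) (steps a s) &
      \sum_(I <- steps a s) (I.2 - I.1) = b - a].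
Proof.
elim: s a => [|x s IH] a.
  by move=> /itv_partition_nil ->; rewrite /= big_nil subrr.
move=> H; have [A B C] := IH _ (itv_partition_cons H).
have ax : a <= x by case: H => /= /andP[/ltW].
have xb : x <= b by case: (itv_partition_le (itv_partition_cons H)).
split.
- rewrite /= lexx ax xb /=; apply: sub_all A => I /and3P[? -> ->].
  by rewrite !andbT (le_trans ax).
- rewrite /= B andbT; apply: sub_all A => I /and3P[xI _ _].
  by rewrite /nonoverlapping /= xI.
- by rewrite /= big_cons C /=; ring.
Qed.

(* l1 holds the intervals on which the increment has already been replaced by
   the supremum over all subdivisions; they are treated one at a time. *)
Lemma ac_on_total_variation_sum (R : realType) (p q e d : R) (f : R -> R) :
  (forall l : seq (R * R),
      all (fun I => [&& p <= I.1, I.1 <= I.2 & I.2 <= q]) l ->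
      pairwise (@nonoverlapping R) l ->
      \sum_(I <- l) (I.2 - I.1) < d ->
      \sum_(I <- l) `|f I.2 - f I.1| < e) ->
  forall l1 l2 : seq (R * R),
    all (fun I => [&& p <= I.1, I.1 <= I.2 & I.2 <= q]) (l1 ++ l2) ->
    pairwise (@nonoverlapping R) (l1 ++ l2) ->
    \sum_(I <- l1 ++ l2) (I.2 - I.1) < d ->
    (\sum_(I <- l1) total_variation I.1 I.2 f +
     (\sum_(I <- l2) `|f I.2 - f I.1|)%:E <= e%:E)%E.
Proof.
move=> H; elim=> [|I l1 IH] l2.
  by rewrite big_nil add0e lee_fin => ? ? ?; apply/ltW/H.
rewrite [_ ++ _]/= [all _ _]/= [pairwise _ _]/=.
move=> /andP[/and3P[pI II Iq] al] /andP[sep pl].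
rewrite !big_cons => ld.
have len l : all (fun I => [&& p <= I.1, I.1 <= I.2 & I.2 <= q]) l ->
    0 <= \sum_(I <- l) (I.2 - I.1).
  move=> /allP al'; rewrite big_seq; apply: sumr_ge0 => J /al' /and3P[_ ? _].
  by rewrite subr_ge0.
have X1 : (\sum_(J <- l1) total_variation J.1 J.2 f +
     (\sum_(J <- l2) `|f J.2 - f J.1|)%:E <= e%:E)%E.
  by apply: IH => //; lra.
have X0 : (0 <= \sum_(J <- l1) total_variation J.1 J.2 f)%E.
  rewrite big_seq; apply: sume_ge0 => J Jl; apply: total_variation_ge0.
  by have := allP al J; rewrite mem_cat Jl => /(_ isT) /and3P[].
set X := (\sum_(J <- l1) total_variation J.1 J.2 f)%E in X1 X0 *.
have Xf : X \is a fin_num.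
  rewrite ge0_fin_numE //; apply: le_lt_trans (ltry e); apply: le_trans X1.
  by rewrite leeDl // lee_fin; apply: sumr_ge0.
set Y := \sum_(J <- l2) _ in X1 *.
(* X is finite, so it can be moved to the right. The steps of any subdivision of I may then join
   [l2]: they have the same total length as I and overlap nothing else, so the induction hypothesis
   bounds every element of the supremum. *)
suff : (total_variation I.1 I.2 f <= e%:E - (X + Y%:E))%E.
  by rewrite leeBrDr ?fin_numD ?Xf // addeA.
apply: ge_ereal_sup => _ /= [_ [s sI <-] <-].
rewrite leeBrDr ?fin_numD ?Xf // (variation_steps _ sI) addeCA -EFinD.
have [sA sB sC] := steps_itv sI.
rewrite /Y -big_cat; apply: IH.
- rewrite !all_cat; move: al; rewrite all_cat => /andP[-> ->]; rewrite andbT /=.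
  by apply: sub_all sA => J /and3P[? -> ?]; apply/and3P; split => //; lra.
- move: pl sep; rewrite !pairwise_cat all_cat => /and3P[A12 A1 A2] /andP[S1 S2].
  rewrite A1 sB A2 /= !andbT; apply/andP; split.
    rewrite allrel_catr A12 andbT; apply/allrelP => J K Jl Ks.
    have := allP S1 _ Jl; have /and3P[? ? ?] := allP sA _ Ks.
    by rewrite /nonoverlapping => /orP[] ?; apply/orP; [right|left]; lra.
  apply/allrelP => K J Ks Jl.
  have := allP S2 _ Jl; have /and3P[? ? ?] := allP sA _ Ks.
  by rewrite /nonoverlapping => /orP[] ?; apply/orP; [left|right]; lra.
- by move: ld; rewrite !big_cat /= sC; lra.
Qed.

(** With d the modulus for the bound 1, an interval of length at most d / 2 has variation at most 1,
    and finitely many of these cover [x, y]. *)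
Lemma ac_on_tv_fin (R : realType) (p q : R) (f : R -> R) : ac_on p q f ->
  forall x y, p <= x -> x <= y -> y <= q -> total_variation x y f \is a fin_num.
Proof.
move=> acf x y px xy yq; rewrite ge0_fin_numE ?total_variation_ge0 //.
have [d d0 /ac_on_total_variation_sum H] := acf 1 ltr01.
suff K (n : nat) z : x <= z <= y -> z - x <= n%:R * (d / 2) ->
    (total_variation x z f <= n%:R%:E)%E.
  apply: le_lt_trans (ltry (Num.bound ((y - x) / (d / 2)))%:R).
  apply: K; first by rewrite xy lexx.
  rewrite -ler_pdivrMr ?divr_gt0 //; apply/ltW; apply: le_lt_trans (archi_boundP _).
    exact: lexx.
  by rewrite !divr_ge0 ?subr_ge0 // ltW.
elim: n z => [|n IH] z /andP[xz zy].
  rewrite mul0r subr_le0 => zx; have -> : z = x by apply/eqP; rewrite eq_le xz zx.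
  by rewrite total_variationxx.
rewrite -natr1 mulrDl mul1r => zn.
pose w := Num.max x (z - d / 2).
have xw : x <= w by rewrite /w le_max lexx.
have wz : w <= z by rewrite /w ge_max xz; lra.
rewrite (total_variationD _ xw wz) EFinD; apply: leeD.
  apply: IH; first by rewrite xw; lra.
  rewrite /w lerBlDr ge_max; have : 0 <= n%:R * (d / 2) by rewrite mulr_ge0 // ltW // divr_gt0.
  lra.
have := H [:: (w, z)] [::]; rewrite big_nil adde0 !big_seq1 /=; apply => //.
  by rewrite wz andbT; apply/andP; split; lra.
have : z - d / 2 <= w by rewrite /w le_max lexx orbT.
by lra.
Qed.

(** The bound on increments makes V - f nondecreasing. Thus f = V - (V - f) is a difference of
    nondecreasing absolutely continuous functions, and each of these has a Stieltjes measure. *)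
Lemma ac_on_total_variation (R : realType) (p q : R) (f : R -> R) : ac_on p q f ->
  let V x := fine (total_variation p x f) in
  ac_on p q V /\
  forall x y, p <= x -> x <= y -> y <= q -> `|f y - f x| <= V y - V x.
Proof.
move=> acf V.
have VE x y : p <= x -> x <= y -> y <= q ->
    (V y - V x)%:E = total_variation x y f.
  move=> px xy yq; have F := ac_on_tv_fin acf.
  have Fpx : total_variation p x f \is a fin_num by apply: F => //; lra.
  have Fxy : total_variation x y f \is a fin_num by apply: F.
  by rewrite /V (total_variationD _ px xy) fineD // addrAC subrr add0r fineK.
split => [e e0|x y px xy yq]; last by rewrite -lee_fin VE // total_variation_ge.
have e2 : 0 < e / 2 by rewrite divr_gt0.
have [d d0 /ac_on_total_variation_sum H] := acf _ e2; exists d => // l al pl ld.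
apply: (@le_lt_trans _ _ (e / 2)); last by lra.
have := H l [::]; rewrite cats0 big_nil adde0 => /(_ al pl ld).
rewrite -lee_fin -sumEFin; apply: le_trans.
rewrite big_seq [leRHS]big_seq; apply: lee_sum => I Il.
have /and3P[? ? ?] := allP al _ Il.
rewrite -VE // lee_fin ger0_norm // -lee_fin VE //; exact: total_variation_ge0.
Qed.

(** * Stieltjes measures and their densities *)

Lemma open_interval_bounded (R : realType) (X : set R) (c d : R) :
  open X -> is_interval X -> X `<=` `]c, d[ ->
  exists a b : R, a <= b /\ X = `]a, b[%classic.
Proof.
move=> oX iX Xcd.
have lX : has_lbound X by exists c => x /Xcd; rewrite /= in_itv /= => /andP[/ltW].
have uX : has_ubound X by exists d => x /Xcd; rewrite /= in_itv /= => /andP[_ /ltW].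
have openN y : X y -> exists2 e : R, 0 < e & X (y - e) /\ X (y + e).
  move=> Xy; have : nbhs y X by exact: open_nbhs_nbhs.
  move=> /nbhs_ballP[e /= e0 He]; exists (e / 2); first by rewrite divr_gt0.
  split; apply: He; rewrite /ball /= ?subKr ?opprD ?addNKr ?normrN ?gtr0_norm; lra.
have XE := (is_intervalP X).1 iX.
rewrite /Rhull (asboolT lX) (asboolT uX) in XE.
have iN : ~ X (inf X).
  by move=> /openN[e e0 [/(ge_inf lX)]]; lra.
have sN : ~ X (sup X).
  by move=> /openN[e e0 [_ /(ub_le_sup uX)]]; lra.
rewrite !asboolF // in XE.
have [[x0 Xx0]|X0] := pselect (X !=set0); last first.
  exists 0, 0; split => //; rewrite set_itvoo0.
  by apply/eqP; apply/negPn/negP => /set0P.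
exists (inf X), (sup X); split; last by [].
by rewrite (le_trans (ge_inf lX Xx0)) // ub_le_sup.
Qed.

Lemma separated_disjoint (R : realType) (a b c d : R) : a <= b -> c <= d ->
  `]a, b[%classic `&` `]c, d[ = set0 ->
  a = b \/ c = d \/ nonoverlapping (a, b) (c, d).
Proof.
move=> ab cd; move: ab; rewrite le_eqVlt => /orP[/eqP ->|ab]; first by left.
move: cd; rewrite le_eqVlt => /orP[/eqP ->|cd]; first by right; left.
move=> E; right; right; rewrite /nonoverlapping /=.
apply/negPn/negP; rewrite negb_or -!ltNge => /andP[cb ad].
suff : (`]a, b[%classic `&` `]c, d[) ((Num.max a c + Num.min b d) / 2).
  by rewrite E.
by split; rewrite /= in_itv /= /Order.max /Order.min; do 2 case: ifPn; lra.
Qed.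

Lemma lebesgue_stieltjes_itv (R : realType) (G : cumulative R R) (a b : R) :
  a <= b -> lebesgue_stieltjes_measure G `]a, b]%classic = (G b - G a)%:E.
Proof.
move=> ab; rewrite /lebesgue_stieltjes_measure /measure_extension /=.
rewrite measurable_mu_extE /=; last exact: is_ocitv.
by rewrite wlength_itv_bnd.
Qed.

(** A null set lies in an open set of measure below the modulus. Its part in ]c, d[ is a countable
    disjoint union of bounded open intervals. Any finitely many of them have total Stieltjes measure
    below e, and the bound passes to the sum of the series. *)
Lemma lebesgue_stieltjes_dominated (R : realType) (G : cumulative R R) (c d : R) :
  (forall e : R, 0 < e -> exists2 d : R, 0 < d &
    forall l : seq (R * R),
      all (fun I => I.1 <= I.2) l ->
      pairwise (@nonoverlapping R) l ->
      \sum_(I <- l) (I.2 - I.1) < d ->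
      \sum_(I <- l) (G I.2 - G I.1) < e) ->
  forall A : set R, measurable A -> A `<=` `]c, d[ -> lebesgue_measure A = 0%E ->
    lebesgue_stieltjes_measure G A = 0%E.
Proof.
move=> acG A mA Acd A0.
pose mG : {measure set (measurableTypeR R) -> \bar R} := lebesgue_stieltjes_measure G.
rewrite -[LHS]/(mG A); apply/eqP; rewrite eq_le measure_ge0 andbT.
apply/lee_addgt0Pr => e e0; rewrite add0e.
have [dl dl0 H] := acG e e0.
have Ay : (lebesgue_measure A < +oo)%E by rewrite A0 ltry.
have [U [oU AU UA]] := lebesgue_regularity_outer mA Ay dl0.
set W := U `&` `]c, d[.
have oW : open W by apply: openI => //; exact: interval_open.
have AW : A `<=` W by move=> x Ax; split; [exact: AU|exact: Acd].
have mU : measurable U by exact: open_measurable.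
have mW : measurable W by exact: open_measurable.
have LW : (lebesgue_measure W < dl%:E)%E.
  apply: le_lt_trans UA.
  apply: (@le_trans _ _ (lebesgue_measure U)).
    by apply: le_measure; rewrite ?inE //; exact: subIsetl.
  have := measureU2 leb mA (measurableD mU mA).
  by rewrite setDUK //= A0 add0e.
have [I [oI tI WI]] := OpenSetDisjointItvs.open_disjoint_itv oW.
have Iab k : exists ab : R * R, ab.1 <= ab.2 /\ I k = `]ab.1, ab.2[%classic.
  have [|a [b [ab Iab]]] := @open_interval_bounded _ (I k) c d (oI k).1 (oI k).2.
    by move=> x Ix; have [] : W x by rewrite WI; exists k.
  by exists (a, b).
have {Iab} [ab Iab] := choice Iab.
have mI k : measurable (I k) by rewrite (Iab k).2; exact: measurable_itv.
have LI k : lebesgue_measure (I k) = ((ab k).2 - (ab k).1)%:E.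
  rewrite (Iab k).2 lebesgue_measure_itv /= lte_fin; case: ltP => // ba.
  by rewrite (_ : (ab k).2 = (ab k).1) ?subrr //; apply/eqP; rewrite eq_le ba (Iab k).1.
have GI k : (mG (I k) <= (G (ab k).2 - G (ab k).1)%:E)%E.
  rewrite -(lebesgue_stieltjes_itv G (Iab k).1).
  have moc : measurable `](ab k).1, (ab k).2]%classic by exact: measurable_itv.
  apply: (le_measure mG); [by rewrite inE; exact: mI|by rewrite inE; exact: moc|].
  by rewrite (Iab k).2 => x /=; rewrite !in_itv /= => /andP[-> /ltW].
apply: (@le_trans _ _ (mG W)).
  by apply: (le_measure mG) => //; rewrite inE; [exact: mA|exact: mW].
rewrite WI measure_bigcup //=; last by move=> k _; exact: mI.
rewrite (eq_eseriesl _ (Q := xpredT)); last by move=> k; rewrite in_setT.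
apply: lime_le; first by apply: is_cvg_nneseries => n _ _; exact: measure_ge0.
apply: nearW => n.
apply: (@le_trans _ _ (\sum_(0 <= k < n) (G (ab k).2 - G (ab k).1)%:E)%E).
  by apply: lee_sum => k _; exact: GI.
have Wn : (\sum_(0 <= k < n) ((ab k).2 - (ab k).1)%:E < dl%:E)%E.
  apply: le_lt_trans LW; rewrite WI measure_bigcup //=; last by move=> k _; exact: mI.
  rewrite (eq_eseriesl _ (Q := xpredT)); last by move=> k; rewrite in_setT.
  rewrite (eq_bigr (fun k => lebesgue_measure (I k))) => [|k _]; last by rewrite LI.
  by apply: nneseries_lim_ge => k _ _; exact: measure_ge0.
rewrite sumEFin lee_fin; rewrite sumEFin lte_fin in Wn.
(* An empty component has equal endpoints, which may lie anywhere, even inside another component. It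
   contributes nothing and is dropped to keep the list nonoverlapping. *)
have drop (F : R -> R) : \sum_(0 <= k < n) (F (ab k).2 - F (ab k).1) =
    \sum_(J <- map ab [seq k <- index_iota 0 n | (ab k).1 < (ab k).2])
      (F J.2 - F J.1).
  rewrite big_map big_filter [LHS](bigID (fun k => (ab k).1 < (ab k).2)) /=.
  rewrite [X in _ + X]big1 ?addr0 // => k; rewrite -leNgt => ba.
  by rewrite (_ : (ab k).2 = (ab k).1) ?subrr //; apply/eqP; rewrite eq_le ba (Iab k).1.
rewrite drop; apply/ltW/H.
- by apply/allP => J /mapP[k _ ->]; exact: (Iab k).1.
- rewrite pairwise_map.
  apply: (@sub_in_pairwise _ (fun k => (ab k).1 < (ab k).2) (fun i j : nat => i != j)).
  + move=> i j /= iab jab ij.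
    have [||| |[]//] := @separated_disjoint _ (ab i).1 (ab i).2 (ab j).1 (ab j).2.
    * exact: (Iab i).1.
    * exact: (Iab j).1.
    * rewrite -(Iab i).2 -(Iab j).2; apply/eqP/negPn/negP => /set0P ne.
      by move: ij; rewrite (tI i j Logic.I Logic.I ne) ?eqxx.
    * by move=> ii; move: iab; rewrite /in_mem /= ii ltxx.
    * by move=> jj; move: jab; rewrite /in_mem /= jj ltxx.
  + exact: filter_all.
  + by rewrite -uniq_pairwise filter_uniq // iota_uniq.
- by rewrite -(drop id).
Qed.

(* h is the Radon-Nikodym density of the Stieltjes measure of g, extended by
   constants outside [p, q]. *)
Lemma ac_on_nondecreasing_integral (R : realType) (p q : R) (g : R -> R) :
  p < q -> ac_on p q g -> (forall x y, p <= x -> x <= y -> y <= q -> g x <= g y) ->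
  exists2 h : R -> R, leb.-integrable setT (EFin \o h) &
    forall x, p <= x <= q -> g x - g p = \int[leb]_(t in `]p, x]) h t.
Proof.
move=> pq acg ndg.
pose clip (x : R) : R := Num.max p (Num.min x q).
have clip_in x : p <= clip x <= q.
  by rewrite /clip le_max lexx ge_max ge_min lexx orbT (ltW pq).
have clip_le x y : x <= y -> clip x <= clip y.
  by move=> xy; rewrite /clip ge_max !le_max !le_min !ge_min lexx xy /= ?orbT; lra.
have clip_sub x y : x <= y -> clip y - clip x <= y - x.
  by move=> xy; rewrite /clip /Order.max /Order.min; do ! case: ifPn; lra.
have clip_id x : p <= x <= q -> clip x = x.
  by move=> /andP[px xq]; rewrite /clip min_l // max_r.
pose G x := g (clip x).
have ndG : nondecreasing G.
  move=> x y xy; apply: ndg; [by case/andP: (clip_in x)|exact: clip_le|].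
  by case/andP: (clip_in y).
have acG (e : R) : 0 < e -> exists2 d : R, 0 < d &
    forall l : seq (R * R),
      all (fun I => I.1 <= I.2) l ->
      pairwise (@nonoverlapping R) l ->
      \sum_(I <- l) (I.2 - I.1) < d ->
      \sum_(I <- l) (G I.2 - G I.1) < e.
  move=> /acg[d d0 H]; exists d => // l al pl ld.
  apply: (@le_lt_trans _ _ (\sum_(I <- map (fun I => (clip I.1, clip I.2)) l)
      `|g I.2 - g I.1|)).
    by rewrite big_map; apply: ler_sum => I _; exact: ler_norm.
  apply: H.
  - apply/allP => _ /mapP[J Jl ->] /=; rewrite clip_le ?(allP al _ Jl) //.
    by have /andP[-> _] := clip_in J.1; have /andP[_ ->] := clip_in J.2.
  - rewrite pairwise_map; apply: sub_pairwise pl => J K.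
    by rewrite /nonoverlapping /= => /orP[] k; rewrite (clip_le _ _ k) ?orbT.
  - apply: le_lt_trans ld; rewrite big_map !big_seq; apply: ler_sum => J Jl.
    by apply: clip_sub; exact: (allP al).
have rcG : right_continuous G.
  move=> x; apply/cvgrPdist_lt => e e0.
  have [d d0 H] := acG _ e0; near=> y.
  have xy : x <= y by apply/ltW; near: y; exact: nbhs_right_gt.
  have yx : y < x + d by near: y; apply: nbhs_right_lt; rewrite ltrDl.
  have := H [:: (x, y)]; rewrite !big_seq1 /= xy.
  by rewrite distrC (ger0_norm (_ : 0 <= G y - G x)) ?subr_ge0 ?ndG //; apply => //; lra.
pose cG : cumulative R R := HB.pack G (isCumulative.Build _ _ _ G ndG rcG).
pose mG : {measure set (measurableTypeR R) -> \bar R} := lebesgue_stieltjes_measure cG.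
have mGE a b : a <= b -> mG `]a, b]%classic = (G b - G a)%:E.
  by move=> ab; exact: (lebesgue_stieltjes_itv cG ab).
have mD : measurable (`]p, q]%classic : set (measurableTypeR R)) by exact: measurable_itv.
have mGD : (mG `]p, q]%classic < +oo)%E by rewrite mGE ?ltry // ltW.
pose nu : {finite_measure set (measurableTypeR R) -> \bar R} := mfrestr mD mGD.
have nuE A : nu A = mG (A `&` `]p, q]%classic) by [].
have numu : nu `<< leb.
  apply/null_content_dominatesP => A mA A0; rewrite nuE.
  (* The set may contain q, while the lemma takes subsets of an open interval; any bound beyond q
     would do. *)
  apply: (@lebesgue_stieltjes_dominated R cG p (q + 1)) => //.
  - exact: measurableI.
  - by move=> x [_] /=; rewrite !in_itv /= => /andP[-> xq] /=; lra.
  - apply/eqP; rewrite eq_le measure_ge0 andbT -A0.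
    by apply: le_measure; [rewrite inE; exact: measurableI|rewrite inE|exact: subIsetl].
have [h [h0 hf hi hE]] := radon_nikodym_sigma_finite numu.
exists (fine \o h).
  by apply: eq_integrable hi => // x _ /=; rewrite fineK.
move=> x /andP[px xq]; rewrite /Rintegral.
under eq_integral => t _ do rewrite /= fineK //.
rewrite -hE; last exact: measurable_itv.
rewrite nuE setIidl; last by apply: subset_itvl; rewrite bnd_simp.
by rewrite mGE //= /G !clip_id // ?lexx ?px ?xq ?ltW.
Unshelve. all: by end_near. Qed.

(** * Derivatives and integrals almost everywhere *)

Lemma ae_imply (R : realType) (P Q : R -> Prop) :
  {ae leb, forall x, P x} -> (forall x, P x -> Q x) ->
  {ae leb, forall x, Q x}.
Proof.
move=> H PQ; apply: filterS H; first exact: (ae_filter_ringOfSetsType leb).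
exact: PQ.
Qed.

Lemma ae_imply2 (R : realType) (P Q S : R -> Prop) :
  {ae leb, forall x, P x} -> {ae leb, forall x, Q x} ->
  (forall x, P x -> Q x -> S x) -> {ae leb, forall x, S x}.
Proof.
move=> H1 H2 PQ; apply: filterS2 H1 H2; first exact: (ae_filter_ringOfSetsType leb).
exact: PQ.
Qed.

(** Meant for integrands such as [reflectivity], whose values on a null set are arbitrary. The
    argument therefore stays with the integral as a supremum over simple functions: multiplying one
    of these by the indicator of the complement of N leaves its integral unchanged. *)
Lemma ge0_integral_setD_null d (T : measurableType d) (R : realType)
    (mu : {measure set T -> \bar R}) (D N : set T) (f : T -> \bar R) :
  (forall x, (0 <= f x)%E) -> measurable N -> mu N = 0%E ->
  (\int[mu]_(x in D) f x = \int[mu]_(x in D `\` N) f x)%E.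
Proof.
move=> f0 mN N0; rewrite !ge0_integralE //.
apply/eqP; rewrite eq_le; apply/andP; split; apply: ge_ereal_sup => _ /= [h hf <-].
  have mNc : measurable (~` N) by exact: measurableC.
  pose h' := proj_nnsfun h mNc.
  have h'E x : h' x = h x * (x \in ~` N)%:R by rewrite /h' /proj_nnsfun /= mindicE.
  apply: ereal_sup_ubound; exists h'.
    move=> x /=; rewrite [X in X%:E]h'E in_setC; have := hf x.
    rewrite !patchE in_setD; have [xN|xN] := boolP (x \in N).
      by rewrite mulr0 /= andbF.
    by rewrite /= mulr1 andbT.
  rewrite -!integralT_nnsfun.
  apply: ae_eq_integral => //; [exact/measurable_EFinP|exact/measurable_EFinP|].
  exists N; split => // x /=; apply: contra_notP => xN _.
  by rewrite [X in X%:E = _]h'E in_setC (memNset xN) mulr1.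
apply: ereal_sup_ubound; exists h => //= x; apply: le_trans (hf x) _.
rewrite !patchE in_setD; case: (x \in D) => //=; case: ifP => //.
Qed.

Lemma ae_eq_Rintegral (R : realType) (D : set R) (f g : R -> R) :
  {ae leb, forall x, D x -> f x = g x} ->
  \int[leb]_(x in D) f x = \int[leb]_(x in D) g x.
Proof.
move=> [N [mN N0 NE]]; rewrite /Rintegral; congr fine.
have E x : x \in D `\` N -> f x = g x.
  rewrite inE => -[Dx Nx]; apply: contrapT => ne; apply: Nx; apply: NE => /= H.
  exact: (ne (H Dx)).
have key (h : R -> \bar R) : (forall x, 0 <= h x)%E ->
    (\int[leb]_(x in D) h x =
     \int[leb]_(x in D `\` N) h x)%E.
  by move=> h0; exact: ge0_integral_setD_null.
rewrite integralE [RHS]integralE; congr (_ - _)%E.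
  rewrite key // [RHS]key //; apply: eq_integral => x xDN.
  by rewrite !funeposE /= E.
rewrite key // [RHS]key //; apply: eq_integral => x xDN.
by rewrite !funenegE /= E.
Qed.

Lemma ac_on_integral (R : realType) (p q : R) (f : R -> R) : p < q -> ac_on p q f ->
  exists2 h : R -> R, leb.-integrable setT (EFin \o h) &
    forall x, p <= x <= q -> f x - f p = \int[leb]_(t in `]p, x]) h t.
Proof.
move=> pq acf; have [acV Vf] := ac_on_total_variation acf.
set V := fun x => _ in acV Vf.
have [|h1 i1 H1] := ac_on_nondecreasing_integral pq acV.
  move=> x y px xy yq; rewrite -subr_ge0 (le_trans _ (Vf _ _ px xy yq)) //.
have [|h2 i2 H2] := ac_on_nondecreasing_integral pq (ac_onB acV acf).
  by move=> x y px xy yq; have := Vf _ _ px xy yq; have := ler_norm (f y - f x); rewrite /V; lra.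
exists (fun x => h1 x - h2 x); first by exact: (integrableB _ i1 i2).
move=> x xpq; rewrite RintegralB //; last 2 first.
  exact: integrableS i1.
  exact: integrableS i2.
by rewrite -H1 // -H2 //; ring.
Qed.

Lemma integral_ae_derive (R : realType) (p q c : R) (f h : R -> R) :
  leb.-integrable setT (EFin \o h) ->
  (forall x, p <= x <= q -> f x = c + \int[leb]_(t in `]p, x]) h t) ->
  {ae leb, forall x, p < x < q -> is_derive x 1 f (h x)}.
Proof.
move=> ih fE.
have loc : locally_integrable setT h by apply: open_integrable_locally => //; exact: openT.
have ihy y : leb.-integrable `]p, y] (EFin \o h).
  exact: integrableS ih.
apply: ae_imply (@FTC1 R h (BRight p) ihy loc) _ => x H /andP[px xq].
have [D E] := H px.
apply: (@near_eq_is_derive _ _ _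
   (fun y => c + \int[leb]_(t in `]p, y]) h t)).
  near=> y; rewrite fE //; apply/andP; split; apply/ltW; near: y.
    exact: lt_nbhsr.
  exact: lt_nbhsl.
apply: is_derive_eq; last exact: add0r.
apply: is_deriveD.
by rewrite -E derive1E; exact: derivableP.
Unshelve. all: by end_near. Qed.

(** The absolute continuity of the integral speaks of one set of small measure. Here a finite family
    of intervals is merged into such a set; half-open intervals make neighbours disjoint. *)
Lemma Rintegral_separated (R : realType) (h : R -> R) (l : seq (R * R)) :
  leb.-integrable setT (EFin \o h) ->
  all (fun I => I.1 <= I.2) l -> pairwise (@nonoverlapping R) l ->
  exists A : set R, [/\ measurable A,
     A `<=` [set x | exists2 I : R * R, I \in l & I.1 < x <= I.2],
     lebesgue_measure A = (\sum_(I <- l) (I.2 - I.1))%:E &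
     \int[leb]_(t in A) h t =
       \sum_(I <- l) \int[leb]_(t in `]I.1, I.2]) h t].
Proof.
move=> ih; elim: l => [_ _|I l IH /= /andP[II al] /andP[sl pl]].
  by exists set0; rewrite !big_nil measure0 Rintegral_set0; split => // x [].
have [A [mA lA muA intA]] := IH al pl.
have mI : measurable `]I.1, I.2]%classic by exact: measurable_itv.
have dIA : [disjoint `]I.1, I.2]%classic & A].
  apply/disj_setPRL => x Ax /=; rewrite in_itv /= => /andP[a b].
  have [J Jl /andP[c d]] := lA _ Ax.
  by have := allP sl _ Jl; rewrite /nonoverlapping => /orP[]; lra.
exists (`]I.1, I.2] `|` A); split.
- exact: measurableU.
- move=> x [|/lA[J Jl Jx]]; last by exists J => //; rewrite inE Jl orbT.
  by rewrite /= in_itv /= => xI; exists I => //; rewrite inE eqxx.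
- rewrite measureU //; last exact/disj_set2P.
  rewrite big_cons EFinD; congr (_ + _)%E; last exact: muA.
  rewrite [LHS](lebesgue_measure_itv `]I.1, I.2]) /= lte_fin.
  case: ltP => // ba.
  by rewrite (_ : I.2 = I.1) ?subrr //; apply/eqP; rewrite eq_le ba II.
- rewrite Rintegral_setU //; first by rewrite big_cons intA.
  by apply: integrableS ih => //; exact: measurableU.
Qed.

Lemma integral_ac_on (R : realType) (p q c : R) (f h : R -> R) :
  leb.-integrable setT (EFin \o h) ->
  (forall x, p <= x <= q -> f x = c + \int[leb]_(t in `]p, x]) h t) ->
  ac_on p q f.
Proof.
move=> ih fE e e0.
have [d [d0 H]] := integral_normr_continuous ih e0.
have ihn : leb.-integrable setT (EFin \o (fun x => `|h x|)).
  exact: integrable_norm.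
exists d => // l al pl ld.
have al' : all (fun I => I.1 <= I.2) l by apply: sub_all al => I /and3P[].
have [A [mA _ muA intA]] := Rintegral_separated ihn al' pl.
apply: (@le_lt_trans _ _ (\int[leb]_(t in A) `|h t|)); last first.
  by apply: H => //; rewrite [X in (X < _)%E]muA lte_fin.
rewrite intA big_seq [leRHS]big_seq; apply: ler_sum => I Il.
have /and3P[pI II Iq] := allP al _ Il.
rewrite !fE; [|by apply/andP; split; lra..].
rewrite opprD addrACA subrr add0r Rintegral_itvB //; last first.
  exact: integrableS ih.
by apply: le_normr_Rintegral => //; exact: integrableS ih.
Qed.

Lemma ac_on_ae_derive (R : realType) (p q : R) (f : R -> R) : p < q -> ac_on p q f ->
  exists2 h : R -> R, leb.-integrable setT (EFin \o h) &
    {ae leb, forall x, p < x < q -> is_derive x 1 f (h x)}.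
Proof.
move=> pq acf; have [h ih fh] := ac_on_integral pq acf.
exists h => //; apply: (integral_ae_derive (c := f p) ih) => x xpq.
by rewrite -fh // addrCA subrr addr0.
Qed.

(** The density h of f and the function k are both the derivative of f at almost every point, hence
    agree almost everywhere and have the same integrals. *)
Lemma ac_on_ftc (R : realType) (p q : R) (f k : R -> R) : ac_on p q f ->
  {ae leb, forall x, p < x < q -> is_derive x 1 f (k x)} ->
  forall x, p <= x <= q -> f x - f p = \int[leb]_(t in `]p, x[) k t.
Proof.
move=> acf fk x /andP[px xq]; move: px; rewrite le_eqVlt => /orP[/eqP <-|px].
  by rewrite subrr set_itvoo0 Rintegral_set0.
have pq : p < q by lra.
have [h ih fh] := ac_on_integral pq acf.
rewrite fh ?(ltW px) // -Rintegral_itv_bndo_bndc; last exact: integrableS ih.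
apply: ae_eq_Rintegral; have hd : {ae leb, forall x, p < x < q -> is_derive x 1 f (h x)}.
  apply: (integral_ae_derive (c := f p) ih) => y ypq.
  by rewrite -fh // addrCA subrr addr0.
apply: (ae_imply2 fk hd) => y ky hy; rewrite /= in_itv /= => /andP[py yx].
have ypq : p < y < q by rewrite py (lt_le_trans yx).
by case: (ky ypq) => _ <-; case: (hy ypq) => _ <-.
Qed.

Lemma ac_on_derive0 (R : realType) (p q : R) (f : R -> R) : ac_on p q f ->
  {ae leb, forall x, p < x < q -> is_derive x 1 f 0} ->
  forall x, p <= x <= q -> f x = f p.
Proof.
move=> acf f0 x xpq; apply/eqP; rewrite -subr_eq0 (ac_on_ftc acf f0 xpq).
by rewrite Rintegral_cst //= mul0r.
Qed.

(** * Linear systems with integrable coefficients *)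

Lemma integrableM_bounded (R : realType) (D : set R) (m g : R -> R) (K : R) :
  measurable D -> leb.-integrable D (EFin \o m) -> measurable_fun D g ->
  (forall x, D x -> `|g x| <= K) -> leb.-integrable D (EFin \o (fun x => m x * g x)).
Proof.
move=> mD im mg gK.
apply: (@integrableMl _ _ R leb D mD (EFin \o m) g im mg); exists K; split; first exact: num_real.
by move=> M KM x Dx; apply: (le_trans (gK _ Dx)); exact: ltW.
Qed.

Lemma continuous_integral (R : realType) (p : R) (h : R -> R) :
  leb.-integrable setT (EFin \o h) ->
  continuous (fun x => \int[leb]_(t in `]p, x[) h t).
Proof.
move=> ih y.
(* The point y may lie to the left of p, where the integral is over the empty set. Cutting h off at
   p makes integrals from p', which is below both points, agree with those from p. *)
pose p' := Num.min p y - 1.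
pose h' := h \_ `]p, +oo[.
have p'p : p' < p by rewrite /p' ltrBlDr gt_min ltrDl ltr01.
have p'y : p' < y by rewrite /p' ltrBlDr gt_min [X in _ || X]ltrDl ltr01 orbT.
have ih' : leb.-integrable setT (EFin \o h').
  rewrite /h' -restrict_EFin -integrable_mkcond //; exact: integrableS ih.
suff ac : ac_on p' (y + 1) (fun x => \int[leb]_(t in `]p, x[) h t).
  apply: (@within_continuous_continuous _ _ _ p' (y + 1)); first lra.
  - exact: ac_on_continuous ac.
  - by rewrite in_itv /= p'y ltrDl ltr01.
apply: (@integral_ac_on _ _ _ 0 _ h') => // x /andP[px xy].
rewrite add0r Rintegral_itv_bndo_bndc; last exact: integrableS ih.
rewrite /h' -Rintegral_mkcondr; congr (\int[leb]_(t in _) _).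
apply/seteqP; split => t /=; rewrite !in_itv /= andbT.
  by move=> /andP[pt tx]; split => //; lra.
by move=> [/andP[_ ->] ->].
Qed.

Lemma measurable_integral (R : realType) (p : R) (h : R -> R) :
  leb.-integrable setT (EFin \o h) ->
  measurable_fun setT (fun x => \int[leb]_(t in `]p, x[) h t).
Proof. by move=> ih; apply: continuous_measurable_fun; exact: continuous_integral. Qed.

Lemma ac_onX (R : realType) (p q : R) (f : R -> R) n :
  ac_on p q f -> ac_on p q (fun x => f x ^+ n).
Proof.
move=> acf; elim: n => [|n IH]; first exact: ac_on_cst.
have -> : (fun x => f x ^+ n.+1) = (fun x => f x * f x ^+ n).
  by apply/funext => x; rewrite exprS.
exact: ac_onM.
Qed.

(** A is absolutely continuous with derivative M almost everywhere, so A^(n+1) / (n+1)! is a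
    primitive of the integrand. This is the source of the factorials in the Picard bound. *)
Lemma integral_pow (R : realType) (p : R) (M : R -> R) n x :
  leb.-integrable setT (EFin \o M) -> p <= x ->
  let A y := \int[leb]_(t in `]p, y[) M t in
  \int[leb]_(t in `]p, x[) (M t * (A t ^+ n / n`!%:R)) = A x ^+ n.+1 / n.+1`!%:R.
Proof.
move=> iM px A.
have AE y : A y = 0 + \int[leb]_(t in `]p, y]) M t.
  by rewrite add0r /A Rintegral_itv_bndo_bndc //; exact: integrableS iM.
have acA : ac_on p (x + 1) A by apply: (integral_ac_on iM) => y _; exact: AE.
have dA : {ae leb, forall y, p < y < x + 1 -> is_derive y 1 A (M y)}.
  by apply: (integral_ae_derive (c := 0) iM) => y _; exact: AE.
have Ap : A p = 0 by rewrite /A set_itvoo0 Rintegral_set0.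
pose F y := A y ^+ n.+1 * n.+1`!%:R^-1.
suff : F x - F p = \int[leb]_(t in `]p, x[) (M t * (A t ^+ n / n`!%:R)).
  by rewrite /F Ap expr0n /= mul0r subr0 => ->.
apply: (@ac_on_ftc R p (x + 1)).
- by apply: ac_onM; [exact: ac_onX|exact: ac_on_cst].
- apply: ae_imply dA _ => y H /H{}H.
  have -> : F = (A ^+ n.+1) * cst n.+1`!%:R^-1 by rewrite exprfctE.
  apply: is_derive_eq.
  rewrite /= factS natrM invfM scaler0 add0r /GRing.scale /=.
  by field; rewrite nat1r !pnatr_eq0 /= -lt0n fact_gt0.
- by rewrite px lerDl ler01.
Qed.

(* The n-th increment (not the n-th iterate) of the Picard iteration for
   f' = m11 f + m12 g, g' = m21 f + m22 g with data (a, b) at p. *)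
Fixpoint picard (R : realType) (p : R) (m11 m12 m21 m22 : R -> R) (a b : R)
    (n : nat) : (R -> R) * (R -> R) :=
  if n is n'.+1 then
    let fg := picard p m11 m12 m21 m22 a b n' in
    (fun x => \int[leb]_(t in `]p, x[) (m11 t * fg.1 t + m12 t * fg.2 t),
     fun x => \int[leb]_(t in `]p, x[) (m21 t * fg.1 t + m22 t * fg.2 t))
  else (fun=> a, fun=> b).

Lemma integrable_lin (R : realType) (m1 m2 f g : R -> R) (K : R) :
  leb.-integrable setT (EFin \o m1) -> leb.-integrable setT (EFin \o m2) ->
  measurable_fun setT f -> measurable_fun setT g ->
  (forall x, `|f x| <= K) -> (forall x, `|g x| <= K) ->
  leb.-integrable setT (EFin \o (fun x => m1 x * f x + m2 x * g x)).
Proof.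
move=> i1 i2 mf mg fK gK.
have I1 := integrableM_bounded measurableT i1 mf (fun x _ => fK x).
have I2 := integrableM_bounded measurableT i2 mg (fun x _ => gK x).
exact: (integrableD _ I1 I2).
Qed.

Lemma le_integral_lin (R : realType) (p x K : R) (m1 m2 M f g : R -> R) (B : R -> R) :
  leb.-integrable setT (EFin \o m1) -> leb.-integrable setT (EFin \o m2) ->
  leb.-integrable setT (EFin \o M) ->
  measurable_fun setT f -> measurable_fun setT g -> measurable_fun setT B ->
  (forall t, `|m1 t| + `|m2 t| <= M t) ->
  (forall t, `|f t| <= B t) -> (forall t, `|g t| <= B t) -> (forall t, B t <= K) ->
  `| \int[leb]_(t in `]p, x[) (m1 t * f t + m2 t * g t) | <=
  \int[leb]_(t in `]p, x[) (M t * B t).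
Proof.
move=> i1 i2 iM mf mg mB m12 fB gB BK.
have B0 t : 0 <= B t by apply: le_trans (fB t).
have I := integrable_lin i1 i2 mf mg (fun t => le_trans (fB t) (BK t))
   (fun t => le_trans (gB t) (BK t)).
have MI : leb.-integrable setT (EFin \o (fun t => M t * B t)).
  apply: (integrableM_bounded measurableT iM mB (K := K)) => t _.
  by rewrite ger0_norm.
apply: le_trans (le_normr_Rintegral _ _) _ => //; first exact: integrableS I.
apply: le_Rintegral => //.
- by apply: integrableS (integrable_norm I).
- exact: integrableS MI.
move=> t _; apply: le_trans (ler_normD _ _) _; rewrite !normrM.
apply: (@le_trans _ _ ((`|m1 t| + `|m2 t|) * B t)).
  by rewrite mulrDl; apply: lerD; exact: ler_wpM2l.
exact: ler_wpM2r.
Qed.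

Lemma cvg_integral_lin (R : realType) (p x K : R) (m1 m2 : R -> R)
    (f g : nat -> R -> R) (F G : R -> R) :
  leb.-integrable setT (EFin \o m1) -> leb.-integrable setT (EFin \o m2) ->
  (forall n, measurable_fun setT (f n)) -> (forall n, measurable_fun setT (g n)) ->
  (forall n t, `|f n t| <= K) -> (forall n t, `|g n t| <= K) ->
  (forall t, f n t @[n --> \oo] --> F t) -> (forall t, g n t @[n --> \oo] --> G t) ->
  \int[leb]_(t in `]p, x[) (m1 t * f n t + m2 t * g n t) @[n --> \oo] -->
  \int[leb]_(t in `]p, x[) (m1 t * F t + m2 t * G t).
Proof.
move=> i1 i2 mf mg fK gK fF gG.
have mF : measurable_fun setT F by apply: (measurable_fun_cvg (h := f)) => // t _; exact: fF.
have mG : measurable_fun setT G by apply: (measurable_fun_cvg (h := g)) => // t _; exact: gG.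
have FK t : `|F t| <= K.
  by apply: (cvgr_to_le (cvg_norm (fF t))); apply: nearW => n; exact: fK.
have GK t : `|G t| <= K.
  by apply: (cvgr_to_le (cvg_norm (gG t))); apply: nearW => n; exact: gK.
have iN := integrableD measurableT (integrable_norm i1) (integrable_norm i2).
have ib : leb.-integrable setT (EFin \o (fun t => K * (`|m1 t| + `|m2 t|))).
  exact: (integrableZl measurableT K iN).
have mD : measurable (`]p, x[%classic : set R) by exact: measurable_itv.
have := @dominated_convergence _ _ R leb `]p, x[%classic mD
  (fun n t => (m1 t * f n t + m2 t * g n t)%:E) (fun t => (m1 t * F t + m2 t * G t)%:E)
  (fun t => (K * (`|m1 t| + `|m2 t|))%:E) _ _ _ _ _.
have il n := integrable_lin i1 i2 (mf n) (mg n) (fK n) (gK n).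
have iL := integrable_lin i1 i2 mF mG FK GK.
case.
- by move=> n; apply: measurable_funS (measurable_int _ (il n)).
- by apply: measurable_funS (measurable_int _ iL).
- apply: aeW => t _; apply: cvg_EFin; first exact: nearW.
  by apply: cvgD; apply: cvgMr; [exact: fF|exact: gG].
- exact: integrableS ib.
- apply: aeW => t n _; rewrite lee_fin.
  apply: le_trans (ler_normD _ _) _; rewrite !normrM mulrDr.
  by apply: lerD; rewrite mulrC; apply: ler_wpM2r.
move=> _ _ H; rewrite /Rintegral; apply: fine_cvg.
rewrite fineK; first exact: H.
apply: integrable_fin_num => //; exact: integrableS iL.
Qed.

(** The coefficients are only integrable, so the increments are measured against the integral A of
    M, the sum of the absolute values of all coefficients, instead of x - p: the n-th one is at most
    K A^n / n!, and A is at most its total mass L. *)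
Lemma picard_bound (R : realType) (p a b : R) (m11 m12 m21 m22 : R -> R) :
  leb.-integrable setT (EFin \o m11) -> leb.-integrable setT (EFin \o m12) ->
  leb.-integrable setT (EFin \o m21) -> leb.-integrable setT (EFin \o m22) ->
  exists K L : R, [/\ 0 <= K, 0 <= L & forall n,
    let fg := picard p m11 m12 m21 m22 a b n in
    [/\ measurable_fun setT fg.1, measurable_fun setT fg.2,
        forall x, `|fg.1 x| <= K * exp_coeff L n &
        forall x, `|fg.2 x| <= K * exp_coeff L n]].
Proof.
move=> i11 i12 i21 i22.
pose M t := `|m11 t| + `|m12 t| + (`|m21 t| + `|m22 t|).
have iM : leb.-integrable setT (EFin \o M).
  exact: (integrableD measurableT
    (integrableD measurableT (integrable_norm i11) (integrable_norm i12))
    (integrableD measurableT (integrable_norm i21) (integrable_norm i22))).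
pose A x := \int[leb]_(t in `]p, x[) M t.
have M0 t : 0 <= M t by rewrite !addr_ge0.
pose L := \int[leb]_t M t.
have L0 : 0 <= L by apply: Rintegral_ge0.
pose K := `|a| + `|b|.
have K0 : 0 <= K by rewrite addr_ge0.
have A0 x : 0 <= A x by apply: Rintegral_ge0.
have AL x : A x <= L.
  rewrite /A /L Rintegral_mkcond; apply: le_Rintegral => //.
    by rewrite -restrict_EFin -integrable_mkcond //; exact: integrableS iM.
  by move=> t _; rewrite patchE; case: ifP.
pose B n x := K * (A x ^+ n / n`!%:R).
have BL n x : B n x <= K * exp_coeff L n.
  rewrite ler_wpM2l // ler_wpM2r ?invr_ge0 //.
  by rewrite lerXn2r // nnegrE.
have mA : measurable_fun setT A by exact: measurable_integral.
have mB n : measurable_fun setT (B n).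
  apply: measurable_funM => //; apply: measurable_funM => //.
  exact: measurable_funX.
have step (n : nat) (m1 m2 f g : R -> R) : leb.-integrable setT (EFin \o m1) ->
    leb.-integrable setT (EFin \o m2) -> (forall t, `|m1 t| + `|m2 t| <= M t) ->
    measurable_fun setT f -> measurable_fun setT g ->
    (forall x, `|f x| <= B n x) -> (forall x, `|g x| <= B n x) ->
    forall x, `| \int[leb]_(t in `]p, x[) (m1 t * f t + m2 t * g t)| <= B n.+1 x.
  move=> i1 i2 m12M mf mg fB gB x.
  (* To the left of p the interval of integration is empty and the increment is 0. *)
  have [px|xp] := leP p x; last first.
    rewrite set_itv_ge ?bnd_simp -?leNgt ?(ltW xp) // Rintegral_set0 normr0.
    by rewrite mulr_ge0 // mulr_ge0 ?invr_ge0 // exprn_ge0.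
  apply: le_trans (le_integral_lin _ _ i1 i2 iM mf mg (mB n) m12M fB gB (BL n)) _.
  rewrite le_eqVlt; apply/orP; left; apply/eqP.
  rewrite /B -(integral_pow n iM px) -RintegralZl //; last first.
    have : leb.-integrable setT (EFin \o (fun t => M t * (A t ^+ n / n`!%:R))).
      apply: (integrableM_bounded measurableT iM (K := exp_coeff L n)) => [|t _].
        by apply: measurable_funM => //; exact: measurable_funX.
      rewrite ger0_norm ?mulr_ge0 ?exprn_ge0 ?invr_ge0 //.
      by rewrite ler_wpM2r ?invr_ge0 // lerXn2r // nnegrE.
    by move=> ?; apply: integrableS; last by eassumption.
  by apply: eq_Rintegral => t _; rewrite mulrCA.
exists K, L; split => // n.
suff : let fg := picard p m11 m12 m21 m22 a b n in
    [/\ measurable_fun setT fg.1, measurable_fun setT fg.2,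
        forall x, `|fg.1 x| <= B n x & forall x, `|fg.2 x| <= B n x].
  move=> /= [? ? f1 f2]; split => // x; [exact: le_trans (f1 x) _|exact: le_trans (f2 x) _].
elim: n => [|n [mf mg fB gB]] /=.
  split => // x; rewrite /B expr0 fact0 divr1 mulr1 /K ?lerDl ?lerDr //.
have il1 := integrable_lin i11 i12 mf mg (fun x => le_trans (fB x) (BL n x))
  (fun x => le_trans (gB x) (BL n x)).
have il2 := integrable_lin i21 i22 mf mg (fun x => le_trans (fB x) (BL n x))
  (fun x => le_trans (gB x) (BL n x)).
split; [exact: measurable_integral|exact: measurable_integral| |].
- by apply: step => // t; rewrite /M lerDl addr_ge0.
- by apply: step => // t; rewrite /M lerDr addr_ge0.
Qed.

(** Solutions in the sense of Caratheodory, on the closed interval so that initial values make sense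
    at p. *)
Definition lin_solution (R : realType) (p q : R) (m11 m12 m21 m22 f g : R -> R) : Prop :=
  [/\ ac_on p q f, ac_on p q g,
      {ae leb, forall x, p < x < q -> is_derive x 1 f (m11 x * f x + m12 x * g x)} &
      {ae leb, forall x, p < x < q -> is_derive x 1 g (m21 x * f x + m22 x * g x)}].

(** The convergence of the Picard series is part of the conclusion because the series, and not only
    its sum, is matched later with the terms of the harmonic exponential. *)
Lemma picard_solution (R : realType) (p q a b : R) (m11 m12 m21 m22 : R -> R) :
  leb.-integrable setT (EFin \o m11) -> leb.-integrable setT (EFin \o m12) ->
  leb.-integrable setT (EFin \o m21) -> leb.-integrable setT (EFin \o m22) ->
  exists f g : R -> R, [/\ lin_solution p q m11 m12 m21 m22 f g, f p = a, g p = b &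
    forall x, series (fun n => (picard p m11 m12 m21 m22 a b n).1 x) @ \oo --> f x /\
              series (fun n => (picard p m11 m12 m21 m22 a b n).2 x) @ \oo --> g x].
Proof.
move=> i11 i12 i21 i22.
have [K [L [K0 L0 H]]] := picard_bound p a b i11 i12 i21 i22.
pose P n := picard p m11 m12 m21 m22 a b n.
pose C := K * limn (series (exp_coeff L)).
have cexp : cvgn (series (fun n => K * exp_coeff L n)).
  by apply: is_cvg_seriesZ; exact: is_cvg_series_exp_coeff.
have bnd (u : nat -> R) : (forall n, `|u n| <= K * exp_coeff L n) ->
    cvgn (series u) /\ forall n, `|series u n| <= C.
  move=> uK; split.
    apply: normed_cvg; apply: (series_le_cvg _ _ _ cexp) => n /=.
    - exact: normr_ge0.
    - by apply: mulr_ge0 => //; exact: exp_coeff_ge0.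
    - exact: uK.
  move=> n; rewrite /series /=; apply: le_trans (ler_norm_sum _ _ _) _.
  apply: (@le_trans _ _ (K * series (exp_coeff L) n)).
    by rewrite /series /= mulr_sumr; apply: ler_sum.
  rewrite /C ler_wpM2l //; apply: nondecreasing_cvgn_le; last exact: is_cvg_series_exp_coeff.
  by apply: nondecreasing_series => k _ _; exact: exp_coeff_ge0.
pose Sf n x := series (fun k => (P k).1 x) n.
pose Sg n x := series (fun k => (P k).2 x) n.
have [bf bg] : (forall x, cvgn (series (fun k => (P k).1 x)) /\ forall n, `|Sf n x| <= C) /\
    (forall x, cvgn (series (fun k => (P k).2 x)) /\ forall n, `|Sg n x| <= C).
  by split=> x; apply: bnd => n; have [_ _ H1 H2] := H n.
pose f x := limn (series (fun k => (P k).1 x)).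
pose g x := limn (series (fun k => (P k).2 x)).
have cf x : Sf n x @[n --> \oo] --> f x by exact: (bf x).1.
have cg x : Sg n x @[n --> \oo] --> g x by exact: (bg x).1.
have mSf n : measurable_fun setT (Sf n).
  by apply: measurable_sum => k; have [] := H k.
have mSg n : measurable_fun setT (Sg n).
  by apply: measurable_sum => k; have [] := H k.
have fC x : `|f x| <= C.
  by apply: (cvgr_to_le (cvg_norm (cf x))); apply: nearW => n; exact: (bf x).2.
have gC x : `|g x| <= C.
  by apply: (cvgr_to_le (cvg_norm (cg x))); apply: nearW => n; exact: (bg x).2.
have mf : measurable_fun setT f by apply: (measurable_fun_cvg (h := Sf)) => // t _; exact: cf.
have mg : measurable_fun setT g by apply: (measurable_fun_cvg (h := Sg)) => // t _; exact: cg.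
(* The partial sum of index n + 1 is the initial value plus the integral formed with the partial
   sums of index n. All of these are bounded by C, so dominated convergence gives the integral
   equation. *)
have rec (m1 m2 : R -> R) (c : R) (S : nat -> R -> R) (s : R -> R) :
    leb.-integrable setT (EFin \o m1) -> leb.-integrable setT (EFin \o m2) ->
    (forall n x, S n.+1 x = c + \sum_(0 <= k < n)
       \int[leb]_(t in `]p, x[) (m1 t * (P k).1 t + m2 t * (P k).2 t)) ->
    (forall x, S n x @[n --> \oo] --> s x) ->
    forall x, s x = c + \int[leb]_(t in `]p, x[) (m1 t * f t + m2 t * g t).
  move=> i1 i2 SE cS x.
  have iP k : leb.-integrable setT (EFin \o (fun t => m1 t * (P k).1 t + m2 t * (P k).2 t)).
    have [? ? ? ?] := H k.
    exact: (integrable_lin i1 i2).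
  have E n : S n.+1 x = c + \int[leb]_(t in `]p, x[) (m1 t * Sf n t + m2 t * Sg n t).
    rewrite SE; congr (_ + _); elim: n => [|n IH].
      rewrite big_nil (@eq_Rintegral _ _ _ _ _ (fun=> 0)) ?Rintegral_cst ?mul0r // => t _.
      by rewrite /Sf /Sg /series /= !big_nil !mulr0 addr0.
    rewrite big_nat_recr //= IH -RintegralD //; last 2 first.
      apply: (@integrableS _ _ _ _ setT) => //.
      exact: (integrable_lin i1 i2 (mSf n) (mSg n) (fun t => (bf t).2 n) (fun t => (bg t).2 n)).
      exact: integrableS (iP n).
    apply: eq_Rintegral => t _.
    by rewrite /Sf /Sg /series /= !big_nat_recr //=; ring.
  have c1 : S n.+1 x @[n --> \oo] --> s x by rewrite (cvg_shiftS (fun n => S n x)).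
  have c2 : S n.+1 x @[n --> \oo] --> c + \int[leb]_(t in `]p, x[) (m1 t * f t + m2 t * g t).
    under eq_fun do rewrite E; apply: cvgD; first exact: cvg_cst.
    by apply: (cvg_integral_lin (K := C)) => // n t; [exact: (bf t).2|exact: (bg t).2].
  exact: (cvg_unique _ c1 c2).
have fE := rec m11 m12 a Sf f i11 i12 _ cf.
have gE := rec m21 m22 b Sg g i21 i22 _ cg.
have {}fE : forall x, f x = a + \int[leb]_(t in `]p, x[) (m11 t * f t + m12 t * g t).
  by apply: fE => n x; rewrite /Sf /series /= big_nat_recl.
have {}gE : forall x, g x = b + \int[leb]_(t in `]p, x[) (m21 t * f t + m22 t * g t).
  by apply: gE => n x; rewrite /Sg /series /= big_nat_recl.
have if1 := integrable_lin i11 i12 mf mg fC gC.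
have ig1 := integrable_lin i21 i22 mf mg fC gC.
have fE' x : p <= x <= q -> f x = a + \int[leb]_(t in `]p, x]) (m11 t * f t + m12 t * g t).
  by move=> _; rewrite fE Rintegral_itv_bndo_bndc //; exact: integrableS if1.
have gE' x : p <= x <= q -> g x = b + \int[leb]_(t in `]p, x]) (m21 t * f t + m22 t * g t).
  by move=> _; rewrite gE Rintegral_itv_bndo_bndc //; exact: integrableS ig1.
exists f, g; split.
- split.
  + exact: integral_ac_on if1 fE'.
  + exact: integral_ac_on ig1 gE'.
  + exact: integral_ae_derive if1 fE'.
  + exact: integral_ae_derive ig1 gE'.
- by rewrite fE set_itvoo0 Rintegral_set0 addr0.
- by rewrite gE set_itvoo0 Rintegral_set0 addr0.
- by move=> x; split; [exact: cf|exact: cg].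
Qed.

Lemma wronskian_cst (R : realType) (p q : R) (m11 m12 m21 m22 f1 g1 f2 g2 : R -> R) :
  (forall x, m22 x = - m11 x) ->
  lin_solution p q m11 m12 m21 m22 f1 g1 -> lin_solution p q m11 m12 m21 m22 f2 g2 ->
  forall x, p <= x <= q -> f1 x * g2 x - g1 x * f2 x = f1 p * g2 p - g1 p * f2 p.
Proof.
move=> m0 [af1 ag1 df1 dg1] [af2 ag2 df2 dg2].
apply: (@ac_on_derive0 _ p q (fun x => f1 x * g2 x - g1 x * f2 x)).
  by apply: ac_onB; exact: ac_onM.
have d1 := ae_imply2 df1 dg1 (fun x H1 H2 => conj H1 H2).
have d2 := ae_imply2 df2 dg2 (fun x H1 H2 => conj H1 H2).
apply: (ae_imply2 d1 d2) => x [Df1 Dg1] [Df2 Dg2] xpq.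
have {}Df1 := Df1 xpq; have {}Dg1 := Dg1 xpq; have {}Df2 := Df2 xpq; have {}Dg2 := Dg2 xpq.
apply: is_derive_eq; rewrite /GRing.scale /= m0; ring.
Qed.

(** Cramer's rule: the basis has Wronskian 1, and the coefficients of (f, g) in it are Wronskians up
    to sign, hence constant and readable at p. Uniqueness for given initial values is contained in
    this. *)
Lemma lin_solution_repr (R : realType) (p q : R) (m11 m12 m21 m22 f1 g1 f2 g2 f g : R -> R) :
  (forall x, m22 x = - m11 x) ->
  lin_solution p q m11 m12 m21 m22 f1 g1 -> lin_solution p q m11 m12 m21 m22 f2 g2 ->
  lin_solution p q m11 m12 m21 m22 f g ->
  f1 p = 1 -> g1 p = 0 -> f2 p = 0 -> g2 p = 1 ->
  forall x, p <= x <= q ->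
    f x = f p * f1 x + g p * f2 x /\ g x = f p * g1 x + g p * g2 x.
Proof.
move=> m0 s1 s2 s f1p g1p f2p g2p x xpq.
have := wronskian_cst m0 s1 s2 xpq.
have := wronskian_cst m0 s s1 xpq.
have := wronskian_cst m0 s s2 xpq.
rewrite f1p g1p f2p g2p !mulr1 !mulr0 !sub0r !subr0 => W2 W1 W.
split.
  rewrite -[f x]mulr1 -W -W2 -[g p]opprK -W1; ring.
rewrite -[g x]mulr1 -W -W2 -[g p]opprK -W1; ring.
Qed.

(** * Test functions and weak derivatives *)

(** Naming a derivative at each stage lets stability under products, inverses and affine
    substitution go by induction on n, without formulas for iterated derivatives. *)
Fixpoint smooth (R : realType) (n : nat) (f : R -> R) : Prop :=
  if n is n'.+1 then
    exists2 g : R -> R, (forall x : R, is_derive x 1 f (g x)) & smooth n' g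
  else True.

Lemma smooth_derivable (R : realType) (f : R -> R) : (forall n, smooth n f) ->
  forall k x, derivable (derive1n k f) x 1.
Proof.
suff H k : forall f : R -> R, smooth k.+1 f -> forall x, derivable (derive1n k f) x 1.
  by move=> sf k x; exact: H.
elim: k => [|k IH] {}f [g dg sg] x; first by have [] := dg x.
rewrite derive1Sn; apply: IH.
suff -> : derive1 f = g by [].
by apply/funext => y; rewrite derive1E; case: (dg y).
Qed.

Lemma smoothW (R : realType) n (f : R -> R) : smooth n.+1 f -> smooth n f.
Proof.
elim: n f => // n IH f [g dg sg]; exists g => //; exact: IH.
Qed.

Lemma smooth_cst (R : realType) n (c : R) : smooth n (fun=> c).
Proof. by elim: n c => // n IH c; exists (fun=> 0) => // x; exact: is_derive_cst. Qed.

Lemma smoothD (R : realType) n (f g : R -> R) :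
  smooth n f -> smooth n g -> smooth n (fun x => f x + g x).
Proof.
elim: n f g => // n IH f g [f' df sf] [g' dg sg].
exists (fun x => f' x + g' x); last exact: IH.
by move=> x; have := df x; have := dg x => ? ?; exact: is_deriveD.
Qed.

Lemma smoothM (R : realType) n (f g : R -> R) :
  smooth n f -> smooth n g -> smooth n (fun x => f x * g x).
Proof.
elim: n f g => // n IH f g sF sG.
have := smoothW sF; have := smoothW sG; move: sF sG => [f' df sf] [g' dg sg] ? ?.
exists (fun x => f x * g' x + g x * f' x); last by apply: smoothD; exact: IH.
by move=> x; have := df x; have := dg x => ? ?; exact: is_deriveM.
Qed.

Lemma smooth_inv (R : realType) n (f : R -> R) :
  (forall x, f x != 0) -> smooth n f -> smooth n (fun x => (f x)^-1).
Proof.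
move=> f0; elim: n => // n IH sF.
have si := IH (smoothW sF); case: sF => f' df sf.
exists (fun x => (- 1 * ((f x)^-1 * (f x)^-1)) * f' x).
  move=> x; have := df x => ?.
  apply: (is_derive_eq (is_deriveV (f0 x) (df x))).
  by rewrite /GRing.scale /= mulN1r -exprVn expr2.
by apply: smoothM => //; apply: smoothM; [exact: smooth_cst|exact: smoothM].
Qed.

Lemma smooth_affine (R : realType) n (f : R -> R) (c d : R) :
  smooth n f -> smooth n (fun x => f (c * x + d)).
Proof.
elim: n f => // n IH f [g dg sg].
exists (fun x => g (c * x + d) * c); last by apply: smoothM; [exact: IH|exact: smooth_cst].
move=> x.
have H : is_derive x 1 (fun y => c * y + d) c.
  by apply: is_derive_eq; rewrite /GRing.scale /= !(mulr0, mulr1, addr0).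
have := @is_derive1_comp _ f (fun y => c * y + d) x (g (c * x + d)) c (dg _) H.
exact.
Qed.

(** * A smooth step function *)

Definition flat (R : realType) (m : nat) (t : R) : R :=
  if 0 < t then t^-1 ^+ m * expR (- t^-1) else 0.

Lemma expR_ge_pow (R : realType) (s : R) n : 0 <= s -> s ^+ n / n`!%:R <= expR s.
Proof.
move=> s0; apply: (@le_trans _ _ (series (exp_coeff s) n.+1)).
  rewrite /series /= big_nat_recr //= lerDr; apply: sumr_ge0 => i _.
  exact: exp_coeff_ge0.
apply: nondecreasing_cvgn_le; last exact: is_cvg_series_exp_coeff.
by apply: nondecreasing_series => k _ _; exact: exp_coeff_ge0.
Qed.

Lemma flat_le0 (R : realType) m (t : R) : t <= 0 -> flat m t = 0.
Proof. by move=> t0; rewrite /flat ltNge t0. Qed.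

(** The term of degree m + 2 of the exponential series at 1 / t beats the factor t^-m by t^2. This
    gives continuity at 0. *)
Lemma flat_le (R : realType) m (t : R) : 0 < t ->
  0 <= flat m t <= m.+2`!%:R * t ^+ 2.
Proof.
move=> t0; have ti : 0 < t^-1 by rewrite invr_gt0.
rewrite /flat t0 mulr_ge0 ?expR_ge0 ?exprn_ge0 ?(ltW ti) //=.
have H : t^-1 ^+ m.+2 <= expR t^-1 * m.+2`!%:R.
  by rewrite -ler_pdivrMr ?ltr0n ?fact_gt0 //; exact: expR_ge_pow (ltW ti).
rewrite expRN ler_pdivrMr ?expR_gt0 //.
rewrite mulrAC -ler_pdivrMr ?exprn_gt0 // -exprVn -exprD addn2 mulrC.
by rewrite mulrC; rewrite mulrC in H.
Qed.

(** The index m absorbs the powers of 1 / t that differentiation produces, so the linear span of the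
    family is closed under derivation and smoothness becomes an induction. *)
Lemma flat_derive (R : realType) m (t : R) :
  is_derive t 1 (@flat R m) (flat m.+2 t - m%:R * flat m.+1 t).
Proof.
have [t0|t0|->] := ltgtP t 0.
- rewrite /flat ltNge (ltW t0) /= mulr0 subr0.
  apply: (@near_eq_is_derive _ _ _ (fun=> 0)).
  by near=> y; rewrite ltNge ltW //; near: y; exact: lt_nbhsl.
- have N : \forall y \near t, y^-1 ^+ m * expR (- y^-1) = flat m y.
    near=> y; rewrite /flat; case: ifPn => // /negP; elim.
    by near: y; exact: lt_nbhsr.
  apply: (near_eq_is_derive N); rewrite /flat t0.
  have tn0 : t != 0 by rewrite gt_eqF.
  have t2 : t^-1 * t^-1 = t ^- 2 by rewrite -expr2 exprVn.
  have H1 : is_derive t 1 (fun y : R => y^-1) (- t ^- 2).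
    by apply: (is_derive_eq (is_deriveV tn0 (is_derive_id _ _))); rewrite /GRing.scale /= mulr1.
  have H2 : is_derive t 1 (fun y : R => y^-1 ^+ m) (- (m%:R * t^-1 ^+ m.+1)).
    clear N; case: m => [|m']; first by rewrite mul0r oppr0; exact: is_derive_cst.
    have -> : (fun y : R => y^-1 ^+ m'.+1) = (fun y : R => y^-1) ^+ m'.+1.
      by rewrite exprfctE.
    by apply: is_derive_eq; rewrite /GRing.scale /= -t2 !exprS; ring.
  have H3 : is_derive t 1 (fun y : R => expR (- y^-1)) (t ^- 2 * expR (- t^-1)).
    have H4 : is_derive t 1 (fun y : R => - y^-1) (t ^- 2).
      by apply: is_derive_eq; rewrite opprK.
    have := @is_derive1_comp _ (@expR R) (fun y => - y^-1) t _ _ (is_derive_expR _) H4.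
    by rewrite mulrC; exact.
  have := @is_deriveM _ _ (fun y : R => y^-1 ^+ m) (fun y : R => expR (- y^-1)) t 1 _ _ H2 H3.
  move=> /is_derive_eq; apply.
  by rewrite /GRing.scale /= -t2 !exprS; ring.
(* At 0 the difference quotient of [flat m] is [flat m.+1], which tends to 0. *)
- apply/is_derive1_caratheodory; exists (flat m.+1); split.
  + move=> z; rewrite /flat ltxx !subr0; case: ltP => z0; last by rewrite mul0r.
    have zz : z^-1 * z = 1 by rewrite mulVf // gt_eqF.
    by rewrite exprS -[LHS]mul1r -zz; ring.
  + have f00 : flat m.+1 (0 : R) = 0 by rewrite /flat ltxx.
    suff : flat m.+1 z @[z --> (0 : R)] --> (flat m.+1 0 : R) by [].
    rewrite f00; apply/cvgrPdist_lt => e e0.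
    have C0 : 0 < m.+3`!%:R :> R by rewrite ltr0n fact_gt0.
    near=> z; rewrite sub0r normrN.
    have [z0|z0] := ltP 0 z; last by rewrite flat_le0 ?normr0.
    have /andP[f0 fle] := flat_le m.+1 z0.
    rewrite ger0_norm //; apply: le_lt_trans fle _.
    have z1 : z < 1 by near: z; exact: lt_nbhsl.
    have ze : z < e / m.+3`!%:R by near: z; apply: lt_nbhsl; rewrite divr_gt0.
    rewrite ltr_pdivlMr // in ze.
    apply: le_lt_trans ze; rewrite mulrC ler_wpM2r ?(ltW C0) // expr2.
    by rewrite ler_piMl // ltW.
  + by rewrite /flat ltxx mulr0 subr0.
Unshelve. all: by end_near. Qed.

Lemma smooth_flat (R : realType) n m : smooth n (@flat R m).
Proof.
elim: n m => // n IH m; exists (fun t => flat m.+2 t - m%:R * flat m.+1 t).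
  exact: flat_derive.
have -> : (fun t : R => flat m.+2 t - m%:R * flat m.+1 t) =
  (fun t => flat m.+2 t + - m%:R * flat m.+1 t) by apply/funext => t; rewrite mulNr.
by apply: smoothD => //; apply: smoothM => //; exact: smooth_cst.
Qed.

(** A smooth transition from 0 on t <= 0 to 1 on t >= 1. The denominator never vanishes because t or
    1 - t is positive. *)
Definition step (R : realType) (t : R) : R := flat 0 t / (flat 0 t + flat 0 (1 - t)).

Lemma flat0_ge0 (R : realType) (t : R) : 0 <= flat 0 t.
Proof. by rewrite /flat; case: ifP => // _; rewrite expr0 mul1r expR_ge0. Qed.

Lemma flat0_gt0 (R : realType) (t : R) : 0 < t -> 0 < flat 0 t.
Proof. by rewrite /flat => ->; rewrite expr0 mul1r expR_gt0. Qed.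

Lemma step_den_gt0 (R : realType) (t : R) : 0 < flat 0 t + flat 0 (1 - t).
Proof.
have [t0|t0] := ltP 0 t; first by rewrite ltr_pwDl ?flat0_gt0 ?flat0_ge0.
by rewrite ltr_wpDl ?flat0_ge0 ?flat0_gt0 //; lra.
Qed.

Lemma smooth_step (R : realType) n : smooth n (@step R).
Proof.
apply: smoothM; first exact: smooth_flat.
apply: smooth_inv; first by move=> t; rewrite gt_eqF // step_den_gt0.
apply: smoothD; first exact: smooth_flat.
have -> : (fun t : R => flat 0 (1 - t)) = (fun t => flat 0 (-1 * t + 1)).
  by apply/funext => t; rewrite mulN1r addrC.
exact/smooth_affine/smooth_flat.
Qed.

Lemma step_le0 (R : realType) (t : R) : t <= 0 -> step t = 0.
Proof. by move=> t0; rewrite /step flat_le0 ?mul0r. Qed.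

Lemma step_ge1 (R : realType) (t : R) : 1 <= t -> step t = 1.
Proof.
move=> t1; have /(divff) := lt0r_neq0 (step_den_gt0 t).
by rewrite /step (flat_le0 _ (_ : 1 - t <= 0)) ?subr_le0 // addr0.
Qed.

(** The derivative d of the step is the kernel used for mollification. A second derivative makes it
    continuous, and it is bounded because it vanishes off [0, 1]. *)
Lemma step_deriveP (R : realType) : exists2 d : R -> R,
  (forall t : R, is_derive t 1 (@step R) (d t)) &
  [/\ continuous d, forall t, t < 0 \/ 1 < t -> d t = 0 &
     exists2 K : R, 0 < K & forall t, `|d t| <= K].
Proof.
have [d dd [d2 dd2 _]] := @smooth_step R 2.
have dc : continuous d.
  by move=> t; apply/differentiable_continuous/derivable1_diffP; case: (dd2 t).
exists d => //.
have d0 t : t < 0 \/ 1 < t -> d t = 0.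
  move=> t01; case: (dd t) => _ <-.
  have [c N] : exists c : R, \forall y \near t, c = step y.
    case: t01 => t0; [exists 0|exists 1]; near=> y.
      by rewrite step_le0 // ltW //; near: y; exact: lt_nbhsl.
    by rewrite step_ge1 // ltW //; near: y; exact: lt_nbhsr.
  by rewrite -(near_eq_derive _ N) derive_cst.
split => //.
have [c c01 Hc] := @EVT_max R d 0 1 ler01 (continuous_subspaceT dc).
have [c' c01' Hc'] := @EVT_min R d 0 1 ler01 (continuous_subspaceT dc).
exists (Num.max 1 (Num.max (d c) (- d c'))); first by rewrite lt_max ltr01.
move=> t; have [t01|t01] := boolP (t \in `[0, 1]).
  by rewrite ler_norml lerNl !le_max Hc ?lerN2 ?Hc' ?orbT.
rewrite d0 ?normr0 ?le_max ?ler01 //.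
by move: t01; rewrite in_itv /= negb_and -!ltNge => /orP[]; [left|right].
Unshelve. all: by end_near. Qed.

(** * Mollification and the lemma of du Bois-Reymond *)

Lemma Rintegral_support (R : realType) (D E : set R) (f : R -> R) :
  E `<=` D -> (forall x, D x -> ~ E x -> f x = 0) ->
  \int[leb]_(x in D) f x = \int[leb]_(x in E) f x.
Proof.
move=> ED f0; rewrite Rintegral_mkcond [RHS]Rintegral_mkcond.
congr (\int[leb]_(x in _) _); apply/funext => x; rewrite !patchE.
have [xE|xE] := boolP (x \in E); first by rewrite mem_set //; apply: ED; exact: set_mem.
case: ifP => // xD; apply: f0; first exact: set_mem.
by move=> Ex; move: xE; rewrite mem_set.
Qed.

Lemma ge0_le_Rintegral_subset (R : realType) (D E : set R) (f : R -> R) :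
  measurable D -> measurable E -> E `<=` D ->
  leb.-integrable D (EFin \o f) -> (forall x, 0 <= f x) ->
  \int[leb]_(x in E) f x <= \int[leb]_(x in D) f x.
Proof.
move=> mD mE ED iD f0.
rewrite Rintegral_mkcond [leRHS]Rintegral_mkcond; apply: le_Rintegral => //.
- rewrite -restrict_EFin -integrable_mkcond //; exact: integrableS iD.
- by rewrite -restrict_EFin -integrable_mkcond.
move=> x _; rewrite !patchE.
have [xE|xE] := boolP (x \in E); last by case: ifP.
by rewrite mem_set //; apply: ED; exact: set_mem.
Qed.

Lemma lebesgue_pt_avg (R : realType) (h : R -> R) (x : R) :
  leb.-integrable setT (EFin \o h) -> lebesgue_pt h x ->
  forall e : R, 0 < e -> exists2 d : R, 0 < d & forall r, 0 < r < d ->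
    \int[leb]_(y in ball x r) `|h y - h x| <= e * r.
Proof.
move=> ih hx e e0.
(* The ball has measure 2 r, so a mean deviation below e / 2 is an integral below e r. *)
have e2 : 0 < e / 2 by rewrite divr_gt0.
have ib r : leb.-integrable (ball x r) (EFin \o (fun y => `|h y - h x|)).
  have mb : measurable (ball x r : set R) by exact: measurable_ball.
  have i1 : leb.-integrable (ball x r) (EFin \o h) by exact: integrableS ih.
  have i2 : leb.-integrable (ball x r) (EFin \o (fun=> h x)).
    apply: measurable_bounded_integrable => //.
      have [r0|r0] := leP r 0; first by rewrite (ball0 _ _).2 // measure0.
      by rewrite [X in (X < _)%E](lebesgue_measure_ball x (ltW r0)) ltry.
    by exists `|h x|; split; rewrite ?num_real // => M xM y _ /=; exact: ltW.
  have i3 : leb.-integrable (ball x r) (EFin \o (fun y => h y - h x)).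
    exact: (integrableB _ i1 i2).
  exact: (integrable_norm i3).
have dE r : 0 < r -> fine (davg h x r) = (r *+ 2)^-1 * \int[leb]_(y in ball x r) `|h y - h x|.
  move=> r0; rewrite /davg /iavg lebesgue_measure_ball ?ltW // inver mulrn_eq0 /= gt_eqF //.
  rewrite /Rintegral;
  rewrite fineM //; by apply: integrable_fin_num; [exact: measurable_ball|exact: ib].
have /fine_cvgP[_ cd] := hx.
have := cvgr_lt _ cd _ e2.
move=> -[d /= d0 H]; exists d => // r /andP[r0 rd].
have := H r; rewrite /= sub0r normrN gtr0_norm // => /(_ rd r0).
rewrite dE // mulrC ltr_pdivrMr ?pmulrn_lgt0 //.
by move=> /ltW /le_trans; apply; rewrite -mulr_natr; lra.
Qed.

Lemma Rintegral_step_derive (R : realType) (d : R -> R) (s e : R) : 0 < e ->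
  (forall t : R, is_derive t 1 (@step R) (d t)) -> continuous d ->
  \int[leb]_(x in `[s, s + e]) (e^-1 * d (e^-1 * x + - (e^-1 * s))) = 1.
Proof.
move=> e0 dd cd.
pose F x := step (e^-1 * x + - (e^-1 * s)).
have dF (x : R) : is_derive x 1 F (e^-1 * d (e^-1 * x + - (e^-1 * s))).
  have H : is_derive x 1 (fun y => e^-1 * y + - (e^-1 * s)) e^-1.
    by apply: is_derive_eq; rewrite /GRing.scale /= !(mulr0, mulr1, addr0, subr0, oppr0).
  have := @is_derive1_comp _ (@step R) (fun y => e^-1 * y + - (e^-1 * s)) x _ _ (dd _) H.
  by rewrite [X in is_derive _ _ _ X -> _]mulrC; exact.
have cF : continuous F.
  by move=> x; apply/differentiable_continuous/derivable1_diffP; case: (dF x).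
have cd' : continuous (fun x => e^-1 * d (e^-1 * x + - (e^-1 * s))).
  move=> x; apply: cvgMr; apply: (@continuous_comp _ _ _ (fun y => e^-1 * y + - (e^-1 * s)) d).
    by apply: cvgD; [apply: cvgMr; exact: cvg_id|exact: cvg_cst].
  exact: cd.
have := @continuous_FTC2 R (fun x => e^-1 * d (e^-1 * x + - (e^-1 * s))) F s (s + e).
move=> /(_ _ _ _ _) E; rewrite /Rintegral E /=.
- rewrite /F mulrDr mulVf ?gt_eqF // [X in step X](_ : _ = 1); last by ring.
  by rewrite subrr step_ge1 // step_le0 // subr0.
- by rewrite ltrDl.
- exact: continuous_subspaceT.
- split; first by move=> x _; case: (dF x).
    exact: cvg_at_right_filter (cF _).
  exact: cvg_at_left_filter (cF _).
- by move=> x _; rewrite derive1E; case: (dF x).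
Qed.

(** The rescaled kernel has mass 1, so the left side is the integral of (h - h s) against it; it has
    height at most K / e and support [s, s + e]. The radius 2 e puts the endpoint s + e inside the
    open ball. *)
Lemma kernel_average (R : realType) (h d : R -> R) (K a b s e : R) :
  leb.-integrable setT (EFin \o h) -> 0 < e -> a < s -> s + e < b ->
  (forall t : R, is_derive t 1 (@step R) (d t)) -> continuous d ->
  (forall t, t < 0 \/ 1 < t -> d t = 0) -> (forall t, `|d t| <= K) ->
  `| \int[leb]_(x in `]a, b[) (h x * (e^-1 * d (e^-1 * x + - (e^-1 * s)))) - h s| <=
  K / e * \int[leb]_(y in ball s (2 * e)) `|h y - h s|.
Proof.
move=> ih e0 as_ seb dd cd d0 dK.
pose w x := e^-1 * d (e^-1 * x + - (e^-1 * s)).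
have K0 : 0 <= K by apply: le_trans (dK 0).
have wK x : `|w x| <= K / e.
  by rewrite normrM gtr0_norm ?invr_gt0 // mulrC ler_wpM2r // invr_ge0 ltW.
have cw : continuous w.
  move=> x; apply: cvgMr; apply: (@continuous_comp _ _ _ (fun y => e^-1 * y + - (e^-1 * s)) d).
    by apply: cvgD; [apply: cvgMr; exact: cvg_id|exact: cvg_cst].
  exact: cd.
have mw : measurable_fun setT w by exact: continuous_measurable_fun.
have w0 x : x \notin `[s, s + e] -> w x = 0.
  have xE : e^-1 * x + - (e^-1 * s) = (x - s) / e by rewrite mulrC [e^-1 * s]mulrC -mulrBl.
  rewrite in_itv /= negb_and -!ltNge /w xE => /orP[xs|xs]; rewrite d0 ?mulr0 //.
    by left; rewrite pmulr_llt0 ?invr_gt0 // subr_lt0.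
  by right; rewrite ltr_pdivlMr // mul1r ltrBrDl.
have mE : measurable (`[s, s + e]%classic : set R) by exact: measurable_itv.
have iE1 : leb.-integrable `[s, s + e]%classic (EFin \o (fun=> h s)).
  apply: measurable_bounded_integrable => //.
    by rewrite [X in (X < _)%E](lebesgue_measure_itv `[s, s + e]) /= lte_fin ltrDl e0 ltry.
  by exists `|h s|; split; rewrite ?num_real // => M xM y _ /=; exact: ltW.
have ihE : leb.-integrable `[s, s + e]%classic (EFin \o h) by exact: integrableS ih.
have iw : leb.-integrable `[s, s + e]%classic (EFin \o (fun x => h x * w x)).
  by apply: (integrableM_bounded mE ihE (K := K / e)) => //; exact: measurable_funTS.
have iw1 : leb.-integrable `[s, s + e]%classic (EFin \o (fun x => h s * w x)).
  by apply: (integrableM_bounded mE iE1 (K := K / e)) => //; exact: measurable_funTS.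
have iwc : leb.-integrable `[s, s + e]%classic (EFin \o w).
  apply: measurable_bounded_integrable => //.
  - by rewrite [X in (X < _)%E](lebesgue_measure_itv `[s, s + e]) /= lte_fin ltrDl e0 ltry.
  - exact: measurable_funTS.
  - by exists (K / e); split; rewrite ?num_real // => M xM y _ /=; exact: le_trans (wK y) (ltW _).
rewrite (@Rintegral_support _ _ `[s, s + e]%classic); first last.
- by move=> x _ /= /negP /w0 wx; rewrite -/(w x) wx mulr0.
- by move=> x /=; rewrite !in_itv /= => /andP[? ?]; apply/andP; split; lra.
have E1 : h s = \int[leb]_(x in `[s, s + e]) (h s * w x).
  by rewrite RintegralZl // (Rintegral_step_derive s e0 dd cd) mulr1.
rewrite [X in _ - X]E1 -RintegralB //.
apply: le_trans (le_normr_Rintegral _ _) _ => //; first exact: (integrableB _ iw iw1).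
have ihs : leb.-integrable `[s, s + e]%classic (EFin \o (fun y => `|h y - h s|)).
  have i3 : leb.-integrable `[s, s + e]%classic (EFin \o (fun y => h y - h s)) by exact: (integrableB _ ihE iE1).
  exact: (integrable_norm i3).
have ihb : leb.-integrable (ball s (2 * e)) (EFin \o (fun y => `|h y - h s|)).
  have mb : measurable (ball s (2 * e) : set R) by exact: measurable_ball.
  have i1 : leb.-integrable (ball s (2 * e)) (EFin \o h) by exact: integrableS ih.
  have i2 : leb.-integrable (ball s (2 * e)) (EFin \o (fun=> h s)).
    apply: measurable_bounded_integrable => //.
      by rewrite [X in (X < _)%E](lebesgue_measure_ball s _) ?ltry // mulr_ge0 // ltW.
    by exists `|h s|; split; rewrite ?num_real // => M xM y _ /=; exact: ltW.
  have i3 : leb.-integrable (ball s (2 * e)) (EFin \o (fun y => h y - h s)).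
    exact: (integrableB _ i1 i2).
  exact: (integrable_norm i3).
apply: (@le_trans _ _ (\int[leb]_(x in `[s, s + e]) (K / e * `|h x - h s|))).
  apply: le_Rintegral => //.
  - have i3 : leb.-integrable `[s, s + e]%classic (EFin \o (fun y => h y * w y - h s * w y)) by exact: (integrableB _ iw iw1).
    exact: (integrable_norm i3).
  - exact: (integrableZl _ (K / e) ihs).
  by move=> x _ /=; rewrite -mulrBl normrM mulrC ler_wpM2r //; exact: wK.
rewrite RintegralZl // ler_wpM2l ?divr_ge0 // ?(ltW e0) //.
apply: ge0_le_Rintegral_subset => //; first exact: measurable_ball.
move=> x /=; rewrite in_itv /= /ball /= => /andP[? ?].
by rewrite distrC ger0_norm ?subr_ge0 //; lra.
Qed.

(** Neither step has compact support, but both equal 1 to the right of their transitions, and these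
    values cancel in the difference. *)
Lemma test_function_step (R : realType) (a b s s' e : R) : 0 < e ->
  a < s -> s + e < b -> a < s' -> s' + e < b ->
  test_function a b (fun x => step (e^-1 * x + - (e^-1 * s)) -
                              step (e^-1 * x + - (e^-1 * s'))).
Proof.
move=> e0 as_ sb as' s'b; split.
  apply: smooth_derivable => n.
  have -> : (fun x => step (e^-1 * x + - (e^-1 * s)) - step (e^-1 * x + - (e^-1 * s'))) =
    (fun x => step (e^-1 * x + - (e^-1 * s)) + -1 * step (e^-1 * x + - (e^-1 * s'))).
    by apply/funext => x; rewrite mulN1r.
  apply: smoothD; first exact/smooth_affine/smooth_step.
  by apply: smoothM; [exact: smooth_cst|exact/smooth_affine/smooth_step].
exists (Num.min s s'), (Num.max s s' + e); split.
- by rewrite lt_min as_ as'.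
- by rewrite /Order.max; case: ifP.
move=> x.
have xE t : e^-1 * x + - (e^-1 * t) = (x - t) / e by rewrite mulrC [e^-1 * t]mulrC -mulrBl.
rewrite in_itv /= negb_and -!ltNge !xE => /orP[].
  rewrite lt_min => /andP[xs xs'].
  by rewrite !step_le0 ?subrr // pmulr_lle0 ?invr_gt0 // subr_le0 ltW.
rewrite -ltrBrDr gt_max => /andP[xs xs'].
by rewrite !step_ge1 ?subrr // ler_pdivlMr // mul1r lerBrDl -lerBrDr ltW.
Qed.

Lemma step_kernel_integrable (R : realType) (h d : R -> R) (K s e : R) :
  leb.-integrable setT (EFin \o h) -> 0 < e -> continuous d -> (forall t, `|d t| <= K) ->
  leb.-integrable setT (EFin \o (fun x => h x * (e^-1 * d (e^-1 * x + - (e^-1 * s))))).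
Proof.
move=> ih e0 cd dK; apply: (integrableM_bounded measurableT ih (K := K / e)) => [|x _].
  apply: continuous_measurable_fun => x; apply: cvgMr.
  apply: (@continuous_comp _ _ _ (fun y => e^-1 * y + - (e^-1 * s)) d).
    by apply: cvgD; [apply: cvgMr; exact: cvg_id|exact: cvg_cst].
  exact: cd.
by rewrite normrM gtr0_norm ?invr_gt0 // mulrC ler_wpM2r // invr_ge0 ltW.
Qed.

Lemma ae_exists (R : realType) (a b : R) (P : R -> Prop) : a < b ->
  {ae leb, forall x, P x} -> exists2 x, a < x < b & P x.
Proof.
move=> ab [N [mN N0 PN]]; apply: contrapT => nex.
have abN : `]a, b[%classic `<=` N.
  move=> x; rewrite /= in_itv /= => xab; apply: PN => /= Px.
  by apply: nex; exists x.
have : (lebesgue_measure `]a, b[%classic <= lebesgue_measure N)%E.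
  by apply: le_measure => //; rewrite inE.
rewrite [X in (_ <= X)%E]N0 [X in (X <= _)%E](lebesgue_measure_itv `]a, b[) /= lte_fin ab.
by rewrite -EFinB lee_fin subr_le0 leNgt ab.
Qed.

(* The test function is the difference of two mollified steps at s and s'. As
   their width tends to 0, its derivative averages h around s and s', so that
   h s = h s' whenever both are Lebesgue points. *)
Lemma du_bois_reymond (R : realType) (a b : R) (h : R -> R) : a < b ->
  leb.-integrable setT (EFin \o h) ->
  (forall phi, test_function a b phi ->
     \int[leb]_(x in `]a, b[) (h x * derive1 phi x) = 0) ->
  exists c : R, {ae leb, forall x, a < x < b -> h x = c}.
Proof.
move=> ab ih H.
have leb_pt := lebesgue_differentiation (open_integrable_locally openT ih).
have [d dd [cd d0 [K K0 dK]]] := step_deriveP R.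
have key s s' : a < s < b -> a < s' < b -> lebesgue_pt h s -> lebesgue_pt h s' -> h s = h s'.
  move=> /andP[as_ sb] /andP[as' s'b] ls ls'; apply/eqP; rewrite -subr_eq0 -normr_le0.
  apply/ler_addgt0Pr => eta eta0; rewrite add0r.
  (* With radius 2 e, the bound of [kernel_average] becomes K / e times eta / (4 K) times 2 e, that
     is eta / 2 for each of the two points. *)
  have eta1 : 0 < eta / (4 * K) by rewrite divr_gt0 // mulr_gt0.
  have [d1 d10 H1] := lebesgue_pt_avg ih ls eta1.
  have [d2 d20 H2] := lebesgue_pt_avg ih ls' eta1.
  (* Small enough for both Lebesgue-point estimates at radius 2 e and for both transitions to end
     before b. *)
  pose e := Num.min (Num.min d1 d2 / 4) (Num.min (b - s) (b - s') / 2).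
  have e0 : 0 < e.
    by rewrite /e !lt_min !divr_gt0 // lt_min ?subr_gt0 ?sb ?d10.
  have e1 : 2 * e < d1.
    apply: (@le_lt_trans _ _ (d1 / 2)); last lra.
    have : e <= d1 / 4 by rewrite /e ge_min ler_pM2r // ge_min lexx.
    by lra.
  have e2 : 2 * e < d2.
    apply: (@le_lt_trans _ _ (d2 / 2)); last lra.
    have : e <= d2 / 4 by rewrite /e ge_min ler_pM2r // ge_min lexx orbT.
    by lra.
  have e3 : s + e < b.
    have : e <= (b - s) / 2 by rewrite /e ge_min ler_pM2r // [X in _ || X]ge_min lexx orbT.
    by lra.
  have e4 : s' + e < b.
    have : e <= (b - s') / 2 by rewrite /e ge_min ler_pM2r // [X in _ || X]ge_min lexx !orbT.
    by lra.
  have k1 := kernel_average ih e0 as_ e3 dd cd d0 dK.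
  have k2 := kernel_average ih e0 as' e4 dd cd d0 dK.
  have {}H1 := H1 (2 * e); rewrite mulr_gt0 // e1 in H1.
  have {}H2 := H2 (2 * e); rewrite mulr_gt0 // e2 in H2.
  have sm x : K / e * x <= K / e * (eta / (4 * K) * (2 * e)) -> K / e * x <= eta / 2.
    move=> /le_trans; apply; rewrite le_eqVlt; apply/orP; left; apply/eqP.
    by field; rewrite !gt_eqF.
  have Ke : 0 <= K / e by rewrite divr_ge0 ?ltW.
  have k1' := le_trans k1 (sm _ (ler_wpM2l Ke (H1 isT))).
  have k2' := le_trans k2 (sm _ (ler_wpM2l Ke (H2 isT))).
  have := H _ (test_function_step e0 as_ e3 as' e4).
  have dphi x : derive1 (fun x => step (e^-1 * x + - (e^-1 * s)) -
                   step (e^-1 * x + - (e^-1 * s'))) x =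
      e^-1 * d (e^-1 * x + - (e^-1 * s)) - e^-1 * d (e^-1 * x + - (e^-1 * s')).
    have D (t : R) : is_derive x 1 (fun y => step (e^-1 * y + - (e^-1 * t)))
        (e^-1 * d (e^-1 * x + - (e^-1 * t))).
      have A : is_derive x 1 (fun y => e^-1 * y + - (e^-1 * t)) e^-1.
        by apply: is_derive_eq; rewrite /GRing.scale /= !(mulr0, mulr1, addr0, subr0, oppr0).
      have := @is_derive1_comp _ (@step R) (fun y => e^-1 * y + - (e^-1 * t)) x _ _ (dd _) A.
      by rewrite [X in is_derive _ _ _ X -> _]mulrC; exact.
    by rewrite derive1E; have := is_deriveB (D s) (D s') => -[_ ->].
  have i1 := step_kernel_integrable s ih e0 cd dK.
  have i2 := step_kernel_integrable s' ih e0 cd dK.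
  under eq_Rintegral do rewrite dphi mulrBr.
  rewrite RintegralB //; [|exact: integrableS i1|exact: integrableS i2].
  move=> /eqP; rewrite subr_eq0 => /eqP E; move: k1'; rewrite E => k1'.
  set I := \int[_]_(_ in _) _ in k1' k2'.
  have -> : h s - h s' = (I - h s') - (I - h s) by ring.
  by apply: le_trans (ler_normB _ _) _; rewrite [leRHS]splitr addrC lerD.
have [s sab ls] := ae_exists ab leb_pt.
exists (h s); apply: ae_imply leb_pt _ => x lx xab; exact: key.
Qed.

(** Since f is the integral of k, continuity of k at x upgrades the derivative from almost every
    point to x itself. Between jumps this makes u continuously differentiable. *)
Lemma ac_on_derive_continuous (R : realType) (p q x : R) (f k : R -> R) :
  ac_on p q f -> p < x < q ->
  {ae leb, forall x, p < x < q -> is_derive x 1 f (k x)} ->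
  (forall y, p < y < q -> {for y, continuous k}) -> is_derive x 1 f (k x).
Proof.
move=> acf /andP[px xq] df ck.
(* Continuity of k is given only inside ]p, q[, so integrability is obtained on a compact
   neighbourhood of x. *)
pose a := (p + x) / 2; pose b := (x + q) / 2.
have pa : p < a by rewrite /a; lra.
have ax : a < x by rewrite /a; lra.
have xb : x < b by rewrite /b; lra.
have bq : b < q by rewrite /b; lra.
have cab : {within `[a, b], continuous k}.
  apply: continuous_in_subspaceT => y; rewrite inE /= in_itv /= => /andP[? ?].
  by apply: ck; apply/andP; split; lra.
have iab : leb.-integrable `[a, b] (EFin \o k).
  by apply: continuous_compact_integrable => //; exact: segment_compact.
have acf' : ac_on a b f by apply: ac_on_sub acf; apply: ltW.
have fE y : a <= y <= b -> f y = f a + \int[leb]_(t in `[a, y]) k t.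
  move=> /andP[ay yb].
  have i1 : leb.-integrable `]a, y[ (EFin \o k).
    apply: integrableS iab => // t; rewrite /= !in_itv /= => /andP[? ?].
    by apply/andP; split; lra.
  have i2 : leb.-integrable `]a, y] (EFin \o k).
    apply: integrableS iab => // t; rewrite /= !in_itv /= => /andP[? ?].
    by apply/andP; split; lra.
  rewrite -Rintegral_itv_obnd_cbnd // -Rintegral_itv_bndo_bndc //.
  suff <- : f y - f a = \int[leb]_(t in `]a, y[) k t by ring.
  apply: (ac_on_ftc acf'); last by rewrite ay.
  by apply: (ae_imply df) => t + /andP[? ?]; apply; apply/andP; split; lra.
have cx : {for x, continuous k} by apply: ck; rewrite px.
have [D E] := @continuous_FTC1_closed R k a x b xb iab ax cx.
have N : \forall y \near x, f a + \int[leb]_(t in `[a, y]) k t = f y.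
  near=> y; rewrite (fE y) //; apply/andP; split; apply/ltW; near: y.
    exact: lt_nbhsr.
  exact: lt_nbhsl.
apply: (near_eq_is_derive N).
have H : is_derive x 1 (fun y => \int[leb]_(t in `[a, y]) k t) (k x).
  by split; [exact: D|rewrite -derive1E; exact: E].
have := is_deriveD (is_derive_cst (f a) x 1) H.
by rewrite add0r; exact.
Unshelve. all: by end_near. Qed.

Lemma expR_lipschitz (R : realType) (a b B : R) : `|a| <= B -> `|b| <= B ->
  `|expR a - expR b| <= expR B * `|a - b|.
Proof.
wlog ab : a b / b <= a => [hw|aB bB].
  have [|/ltW] := leP b a; first exact: hw.
  by move=> ab aB bB; rewrite distrC [ `|a - b|]distrC; exact: hw.
rewrite !ger0_norm ?subr_ge0 ?ler_expR //.
have := expR_ge1Dx (b - a); have e0 := expR_gt0 a.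
have -> : expR b = expR a * expR (b - a) by rewrite -expRD; congr expR; ring.
have aB' : expR a <= expR B by rewrite ler_expR; exact: le_trans (ler_norm _) aB.
by nra.
Qed.

Lemma ac_on_expR (R : realType) (p q : R) (f : R -> R) :
  ac_on p q f -> ac_on p q (fun x => expR (f x)).
Proof.
have [pq|qp] := leP p q; last first.
  move=> _ e e0; exists 1 => // -[|I l] /=; first by rewrite !big_nil.
  by move=> /andP[/and3P[? ? ?] _]; lra.
move=> acf; have [B B0 fB] := ac_on_bounded pq acf.
by apply: (ac_on_lipschitz (C := expR B) acf) => s t ps pt; apply: expR_lipschitz; exact: fB.
Qed.

Lemma ln_lipschitz (R : realType) (a b m : R) : 0 < m -> m <= a -> m <= b ->
  `|ln a - ln b| <= m^-1 * `|a - b|.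
Proof.
move=> m0; wlog ab : a b / b <= a => [hw|ma mb].
  have [|/ltW] := leP b a; first exact: hw.
  by move=> ab aB bB; rewrite distrC [ `|a - b|]distrC; exact: hw.
have b0 : 0 < b by lra.
have a0 : 0 < a by lra.
rewrite !ger0_norm ?subr_ge0 ?ler_ln ?posrE //.
rewrite -ln_div ?posrE //.
apply: (@le_trans _ _ (a / b - 1)).
  have := @le_ln1Dx R (a / b - 1); rewrite [1 + _]addrC subrK; apply.
  by rewrite ltrBrDl subrr divr_gt0.
have -> : a / b - 1 = b^-1 * (a - b) by field; rewrite gt_eqF.
by rewrite ler_wpM2r ?subr_ge0 // lef_pV2 // ?posrE.
Qed.

Lemma ac_on_ln (R : realType) (p q m : R) (f : R -> R) : 0 < m ->
  (forall x, p <= x <= q -> m <= f x) -> ac_on p q f -> ac_on p q (fun x => ln (f x)).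
Proof.
move=> m0 mf acf; apply: (ac_on_lipschitz (C := m^-1) acf) => s t ps pt.
by apply: ln_lipschitz => //; exact: mf.
Qed.

(** * Integration by parts and weak primitives *)

Lemma test_function_ac (R : realType) (a b : R) (phi : R -> R) :
  test_function a b phi -> ac_on a b phi.
Proof.
move=> [dphi _].
have [ab|ba] := leP a b; last first.
  move=> e e0; exists 1 => // -[|I l] /=; first by rewrite !big_nil.
  by move=> /andP[/and3P[? ? ?] _]; lra.
have d1 (x : R) : is_derive x 1 phi (derive1 phi x).
  by rewrite derive1E; apply/derivableP; exact: (dphi 0%N x).
have c1 : continuous (derive1 phi).
  by move=> x; apply/differentiable_continuous/derivable1_diffP; exact: (dphi 1%N x).
have [c _ Hc] := EVT_max ab (continuous_subspaceT c1).
have [c' _ Hc'] := EVT_min ab (continuous_subspaceT c1).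
pose K := Num.max (derive1 phi c) (- derive1 phi c').
have dK x : x \in `[a, b] -> `|derive1 phi x| <= K.
  by move=> xab; rewrite ler_norml lerNl /K !le_max Hc ?lerN2 ?Hc' ?orbT.
apply: (ac_on_lipschitz (C := K) (@ac_on_id R a b)) => s t.
wlog st : s t / s <= t => [hw|/andP[as_ sb] /andP[at_ tb]].
  have [|/ltW] := leP s t; first exact: hw.
  by move=> ts ps pt; rewrite distrC [ `|t - s|]distrC; exact: hw.
have [x xst ->] : exists2 x, x \in `[s, t] & phi t - phi s = derive1 phi x * (t - s).
  apply: (@MVT_segment _ phi (derive1 phi) s t st).
  apply: continuous_subspaceT => x; apply/differentiable_continuous/derivable1_diffP.
  exact: (dphi 0%N x).
rewrite normrM ler_wpM2r //; apply: dK; move: xst; rewrite !in_itv /= => /andP[? ?].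
by apply/andP; split; lra.
Qed.

Lemma test_function_continuous (R : realType) (a b : R) (phi : R -> R) :
  test_function a b phi -> continuous phi /\ continuous (derive1 phi).
Proof.
move=> [dphi _]; split => x; apply/differentiable_continuous/derivable1_diffP.
  exact: (dphi 0%N x).
exact: (dphi 1%N x).
Qed.

Lemma test_function_bounded (R : realType) (a b : R) (phi : R -> R) : a <= b ->
  test_function a b phi -> exists K : R, forall x, a <= x <= b ->
    `|phi x| <= K /\ `|derive1 phi x| <= K.
Proof.
move=> ab /test_function_continuous[c0 c1].
have bnd (f : R -> R) : continuous f -> exists K : R, forall x, a <= x <= b -> `|f x| <= K.
  move=> cf.
  have [c _ Hc] := EVT_max ab (continuous_subspaceT cf).
  have [c' _ Hc'] := EVT_min ab (continuous_subspaceT cf).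
  exists (Num.max (f c) (- f c')) => x xab.
  by rewrite ler_norml lerNl !le_max Hc ?lerN2 ?Hc' ?orbT.
have [K1 H1] := bnd _ c0; have [K2 H2] := bnd _ c1.
exists (Num.max K1 K2) => x xab; split; first by rewrite le_max H1.
by rewrite le_max H2 // orbT.
Qed.

Lemma integrable_test (R : realType) (a b : R) (phi k : R -> R) : a <= b ->
  test_function a b phi -> leb.-integrable `]a, b[ (EFin \o k) ->
  leb.-integrable `]a, b[ (EFin \o (fun x => k x * phi x)) /\
  leb.-integrable `]a, b[ (EFin \o (fun x => k x * derive1 phi x)).
Proof.
move=> ab tphi ik; have [K HK] := test_function_bounded ab tphi.
have [c0 c1] := test_function_continuous tphi.
have sub x : `]a, b[%classic x -> a <= x <= b.
  by rewrite /= in_itv /= => /andP[/ltW -> /ltW ->].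
have mD : measurable (`]a, b[%classic : set R) by exact: measurable_itv.
split; apply: (integrableM_bounded mD ik (K := K)).
- by apply: measurable_funTS; exact: continuous_measurable_fun.
- by move=> x /sub /HK[].
- by apply: measurable_funTS; exact: continuous_measurable_fun.
- by move=> x /sub /HK[].
Qed.

Lemma weak_ibp (R : realType) (a b : R) (F k phi : R -> R) : a < b ->
  ac_on a b F -> {ae leb, forall x, a < x < b -> is_derive x 1 F (k x)} ->
  leb.-integrable `]a, b[ (EFin \o k) -> test_function a b phi ->
  \int[leb]_(x in `]a, b[) (F x * derive1 phi x) =
  - \int[leb]_(x in `]a, b[) (k x * phi x).
Proof.
move=> ab acF dF ik tphi.
have d1 (x : R) : is_derive x 1 phi (derive1 phi x).
  by rewrite derive1E; apply/derivableP; exact: (tphi.1 0%N x).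
have [c [d [ac db phi0]]] := tphi.2.
have phia : phi a = 0 by apply: phi0; rewrite in_itv /= leNgt ac.
have phib : phi b = 0 by apply: phi0; rewrite in_itv /= [b <= d]leNgt db andbF.
have iF : leb.-integrable `]a, b[ (EFin \o F).
  have : leb.-integrable `[a, b] (EFin \o F).
    by apply: continuous_compact_integrable; [exact: segment_compact|exact: ac_on_continuous].
  by apply: integrableS => //; exact: subset_itv_oo_cc.
have [_ i1] := integrable_test (ltW ab) tphi iF.
have [i2 _] := integrable_test (ltW ab) tphi ik.
have acP := ac_onM acF (test_function_ac tphi).
have := ac_on_ftc acP (k := fun x => F x * derive1 phi x + k x * phi x).
move=> /(_ _ b); rewrite phia phib !mulr0 subrr.
move=> H; have {}H : 0 = \int[leb]_(t in `]a, b[) (F t * derive1 phi t + k t * phi t).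
  apply: H; last by rewrite (ltW ab) lexx.
  apply: (ae_imply dF) => x H xab; have {}H := H xab; have D := d1 x.
  by apply: is_derive_eq; rewrite /GRing.scale /= [phi x * _]mulrC.
by apply/eqP; rewrite -addr_eq0 -RintegralD // -H.
Qed.

Lemma integrable_patch (R : realType) (D : set R) (k : R -> R) : measurable D ->
  leb.-integrable D (EFin \o k) -> leb.-integrable setT (EFin \o (k \_ D)).
Proof. by move=> mD ik; rewrite -restrict_EFin -integrable_mkcond. Qed.

(** A primitive P of k has the same weak derivative as h, so h - P is constant almost everywhere; F
    is P plus that constant. *)
Lemma weak_primitive (R : realType) (a b : R) (h k : R -> R) : a < b ->
  leb.-integrable `]a, b[ (EFin \o h) -> leb.-integrable `]a, b[ (EFin \o k) ->
  (forall phi, test_function a b phi ->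
    \int[leb]_(x in `]a, b[) (h x * derive1 phi x) =
    - \int[leb]_(x in `]a, b[) (k x * phi x)) ->
  exists F : R -> R, [/\ ac_on a b F,
    {ae leb, forall x, a < x < b -> is_derive x 1 F (k x)} &
    {ae leb, forall x, a < x < b -> h x = F x}].
Proof.
move=> ab ih ik hk.
have mD : measurable (`]a, b[%classic : set R) by exact: measurable_itv.
have kE x : a < x < b -> (k \_ `]a, b[) x = k x.
  by move=> xab; rewrite patchE mem_set.
have ik' := integrable_patch mD ik.
pose P x := \int[leb]_(t in `]a, x]) (k \_ `]a, b[) t.
have PE x : a <= x <= b -> P x = 0 + \int[leb]_(t in `]a, x]) (k \_ `]a, b[) t.
  by rewrite add0r.
have acP : ac_on a b P by exact: integral_ac_on ik' PE.
have dP : {ae leb, forall x, a < x < b -> is_derive x 1 P (k x)}.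
  apply: (ae_imply (integral_ae_derive ik' PE)) => x H xab.
  by rewrite -kE //; exact: H.
have iP : leb.-integrable `]a, b[ (EFin \o P).
  have : leb.-integrable `[a, b] (EFin \o P).
    by apply: continuous_compact_integrable; [exact: segment_compact|exact: ac_on_continuous].
  by apply: integrableS => //; exact: subset_itv_oo_cc.
have ihP : leb.-integrable `]a, b[ (EFin \o (fun x => h x - P x)).
  exact: (integrableB _ ih iP).
have [phi tphi|c Hc] := du_bois_reymond ab (integrable_patch mD ihP).
  have -> : \int[leb]_(x in `]a, b[)
     (((fun x => h x - P x) \_ `]a, b[) x * derive1 phi x) =
     \int[leb]_(x in `]a, b[) (h x * derive1 phi x - P x * derive1 phi x).
    by apply: eq_Rintegral => x xab; rewrite patchE xab mulrBl.
  have [_ i1] := integrable_test (ltW ab) tphi ih.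
  have [_ i2] := integrable_test (ltW ab) tphi iP.
  by rewrite RintegralB // hk // (weak_ibp ab acP dP ik tphi) subrr.
exists (fun x => c + P x); split.
- by apply: ac_onD => //; exact: ac_on_cst.
- apply: (ae_imply dP) => x H xab; have := is_deriveD (is_derive_cst c x 1) (H xab).
  by rewrite add0r; exact.
- apply: (ae_imply Hc) => x H xab; have := H xab.
  by rewrite patchE mem_set //= => <-; rewrite subrK.
Qed.

Lemma ae_eq_continuous (R : realType) (a b : R) (f g : R -> R) :
  (forall x, a < x < b -> {for x, continuous f}) ->
  (forall x, a < x < b -> {for x, continuous g}) ->
  {ae leb, forall x, a < x < b -> f x = g x} -> forall x, a < x < b -> f x = g x.
Proof.
move=> cf cg fg x xab; apply/eqP; rewrite -subr_eq0; apply/negPn/negP => ne.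
have cfg : {for x, continuous (fun y => f y - g y)}.
  by apply: cvgB; [exact: cf|exact: cg].
have N : \forall y \near x, f y - g y != 0 by exact: (cvgr_neq0 _ cfg ne).
move: (N) => /nbhs_ballP[d /= d0 Hd].
have /andP[ax xb] := xab.
pose l := Num.max a (x - d); pose r := Num.min b (x + d).
have lr : l < r by rewrite /l /r lt_min !gt_max; lra.
have [y /andP[ly yr] fgy] := ae_exists lr fg.
move: ly yr; rewrite /l /r gt_max lt_min => /andP[ay dy] /andP[yb yd].
have : f y - g y != 0 by apply: Hd; rewrite /ball /= ltr_distlC; apply/andP; split; lra.
by rewrite fgy ?ay // subrr eqxx.
Qed.

(** The bound |f| <= 1 + f^2 suffices because the interval is bounded. *)
Lemma square_integrable_integrable (R : realType) (a b : R) (f : R -> R) :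
  measurable_fun `]a, b[ f ->
  (\int[leb]_(x in `]a, b[) (f x ^+ 2)%:E < +oo)%E ->
  leb.-integrable `]a, b[ (EFin \o f).
Proof.
move=> mf f2.
have mD : measurable (`]a, b[%classic : set R) by exact: measurable_itv.
have i2 : leb.-integrable `]a, b[ (EFin \o (fun x => f x ^+ 2)).
  apply/integrableP; split; first by apply/measurable_EFinP; exact: measurable_funX.
  by under eq_integral => x _ do rewrite /= ger0_norm ?sqr_ge0 //.
have i1 : leb.-integrable `]a, b[ (EFin \o (fun=> 1 : R)).
  apply: measurable_bounded_integrable => //.
    by rewrite [X in (X < _)%E](lebesgue_measure_itv `]a, b[) /=; case: ifP; rewrite ?ltry.
  by exists 1; split; rewrite ?num_real // => M xM y _ /=; rewrite normr1; exact: ltW.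
have i3 : leb.-integrable `]a, b[ (EFin \o (fun x => 1 + f x ^+ 2)).
  exact: (integrableD _ i1 i2).
apply: le_integrable i3 => //; first exact/measurable_EFinP.
move=> x _ /=; rewrite lee_fin [leRHS]ger0_norm ?addr_ge0 ?sqr_ge0 //.
by rewrite ler_norml; have := sqr_ge0 (f x + 1); have := sqr_ge0 (f x - 1);
  rewrite !expr2; nra.
Qed.

(** * The harmonic exponential and the propagation matrix *)

Lemma Re_mulc (R : realType) (z w : R[i]) : Re (z * w) = Re z * Re w - Im z * Im w.
Proof. by case: z => a b; case: w. Qed.

Lemma Im_mulc (R : realType) (z w : R[i]) : Im (z * w) = Re z * Im w + Im z * Re w.
Proof. by case: z => a b; case: w. Qed.

Lemma complexP (R : realType) (z w : R[i]) : Re z = Re w -> Im z = Im w -> z = w.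
Proof. by case: z => a b; case: w => c d /= -> ->. Qed.

Lemma kappa_cons (R : realType) (p s : R) (l : seq R) :
  kappa p (s :: l) = (s - p) - kappa p l.
Proof.
(* [kappa] consumes two entries at a time, hence the induction on a bound for the size. *)
have H n : forall l : seq R, (size l <= n)%N -> forall s, kappa p (s :: l) = (s - p) - kappa p l.
  elim: n => [|n IH] [|s' l'] //= ln t; rewrite ?subr0 //.
  have := IH l' ln s'.
  rewrite /= => ->; ring.
exact: (H (size l)).
Qed.

Lemma cexp_imaginary (R : realType) (t : R) :
  cexp (0 +i* t) = cos t +i* sin t.
Proof. by rewrite /cexp /= expR0 !mul1r. Qed.

Definition harmonic_factor (R : realType) (alpha : R -> R) (p sigma : R) (l : seq R) : R[i] :=
  cexp (2 * 'i%C * sigma%:C * (kappa p l)%:C) * (\prod_(s <- l) alpha s)%:C.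

Arguments harmonic_factor : simpl never.

Lemma harmonic_factorE (R : realType) (alpha : R -> R) (p sigma : R) (l : seq R) :
  harmonic_factor alpha p sigma l =
  (cos (2 * sigma * kappa p l) * \prod_(s <- l) alpha s) +i*
  (sin (2 * sigma * kappa p l) * \prod_(s <- l) alpha s).
Proof.
rewrite /harmonic_factor.
have -> : 2 * 'i%C * sigma%:C * (kappa p l)%:C = 0 +i* (2 * sigma * kappa p l) :> R[i].
  by apply: complexP; rewrite !(Re_mulc, Im_mulc) /=; ring.
by rewrite cexp_imaginary; apply: complexP; rewrite !(Re_mulc, Im_mulc) /=; ring.
Qed.

Lemma harmonic_factor_cons (R : realType) (alpha : R -> R) (p sigma s : R) (l : seq R) :
  harmonic_factor alpha p sigma (s :: l) =
  ((alpha s * cos (2 * sigma * (s - p))) +i* (alpha s * sin (2 * sigma * (s - p)))) *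
  (harmonic_factor alpha p sigma l)^*%C.
Proof.
rewrite !harmonic_factorE kappa_cons big_cons.
rewrite [2 * sigma * (_ - _)]mulrBr cosB sinB.
by apply: complexP; rewrite !(Re_mulc, Im_mulc) /=; ring.
Qed.

Lemma cintegral_scale (R : realType) (p r : R) (c : R[i]) (f : R -> R[i]) (h1 h2 : R -> R) :
  leb.-integrable setT (EFin \o h1) -> leb.-integrable setT (EFin \o h2) ->
  {ae leb, forall x, p < x < r -> f x = c * (h1 x +i* h2 x)} ->
  cintegral `]p, r[ f =
  c * ((\int[leb]_(t in `]p, r[) h1 t) +i* (\int[leb]_(t in `]p, r[) h2 t)).
Proof.
move=> i1 i2 fE.
have I1 : leb.-integrable `]p, r[ (EFin \o h1) by exact: integrableS i1.
have I2 : leb.-integrable `]p, r[ (EFin \o h2) by exact: integrableS i2.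
have Z k h : leb.-integrable `]p, r[ (EFin \o h) ->
    leb.-integrable `]p, r[ (EFin \o (fun x : R => k * h x)).
  by move=> ih; exact: (integrableZl _ k ih).
rewrite /cintegral; apply: complexP; rewrite ?Re_mulc ?Im_mulc /=.
  rewrite (@ae_eq_Rintegral _ _ _ (fun x => Re c * h1 x - Im c * h2 x)).
    by rewrite RintegralB ?RintegralZl //; exact: Z.
  apply: (ae_imply fE) => x H; rewrite /= in_itv /= => /H ->.
  by rewrite Re_mulc.
rewrite (@ae_eq_Rintegral _ _ _ (fun x => Re c * h2 x + Im c * h1 x)).
  by rewrite RintegralD ?RintegralZl //; exact: Z.
apply: (ae_imply fE) => x H; rewrite /= in_itv /= => /H ->.
by rewrite Im_mulc.
Qed.

(* Real and imaginary parts of the terms T_n of the harmonic exponential at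
   real sigma: T_0 = 1 and
   T_(n+1)(r) = \int_(p < s < r) alpha(s) e^(2 i sigma (s - p)) conj(T_n(s)),
   the conjugate coming from kappa p (s :: l) = (s - p) - kappa p l. *)
Definition harmonic_picard (R : realType) (alpha : R -> R) (p sigma : R) (n : nat) :=
  let C x := cos (2 * sigma * (x - p)) in
  let S x := sin (2 * sigma * (x - p)) in
  picard p (fun x => alpha x * C x) (fun x => alpha x * S x)
           (fun x => alpha x * S x) (fun x => - (alpha x * C x)) 1 0 n.

Lemma integrable_trig (R : realType) (alpha : R -> R) (p sigma : R) :
  leb.-integrable setT (EFin \o alpha) ->
  leb.-integrable setT (EFin \o (fun x => alpha x * cos (2 * sigma * (x - p)))) /\
  leb.-integrable setT (EFin \o (fun x => alpha x * sin (2 * sigma * (x - p)))).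
Proof.
move=> ia.
have caff : continuous (fun x : R => 2 * sigma * (x - p)).
  by move=> x; apply: cvgMr; apply: cvgB; [exact: cvg_id|exact: cvg_cst].
split; apply: (integrableM_bounded measurableT ia (K := 1)).
- apply: continuous_measurable_fun => x.
  by apply: (continuous_comp (caff x)); exact: continuous_cos.
- by move=> x _; rewrite ler_norml cos_le1 cos_geN1.
- apply: continuous_measurable_fun => x.
  by apply: (continuous_comp (caff x)); exact: continuous_sin.
- by move=> x _; rewrite ler_norml sin_le1 sin_geN1.
Qed.

Lemma integrable_opp (R : realType) (f : R -> R) :
  leb.-integrable setT (EFin \o f) -> leb.-integrable setT (EFin \o (fun x => - f x)).
Proof.
by move=> fi; have := integrableZl measurableT (-1) fi; apply: eq_integrable => // x _ /=;
  rewrite -EFinM mulN1r.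
Qed.

(** The outermost variable is integrated last, so its factor is carried inwards by the constant c.
    Each variable conjugates the factor of the remaining ones, so the statement and its conjugate
    need each other in the induction. [alpha0] stands for the reflectivity, [alpha] for its
    integrable representative. *)
Lemma simplex_harmonic (R : realType) (alpha0 alpha : R -> R) (p q sigma : R) (j : nat) :
  leb.-integrable setT (EFin \o alpha) ->
  {ae leb, forall x, p < x < q -> alpha0 x = alpha x} ->
  forall r, r <= q -> forall c : R[i],
  let T := ((harmonic_picard alpha p sigma j).1 r) +i* ((harmonic_picard alpha p sigma j).2 r) in
  simplex_integral j p r (fun l => c * harmonic_factor alpha0 p sigma l) = c * T /\
  simplex_integral j p r (fun l => c * (harmonic_factor alpha0 p sigma l)^*%C) = c * T^*%C.
Proof.
move=> ia a0a.
have [iC iS] := integrable_trig p sigma ia.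
have [K [L [K0 L0 H]]] := picard_bound p 1 0 iC iS iS (integrable_opp iC).
elim: j => [|j IH] r rq c.
  have E : harmonic_factor alpha0 p sigma [::] = 1.
    by rewrite harmonic_factorE big_nil /= mulr0 cos0 sin0 mulr1 mul0r.
  split; [transitivity (c * harmonic_factor alpha0 p sigma [::])|
    transitivity (c * (harmonic_factor alpha0 p sigma [::])^*%C)]; by [|rewrite E].
pose f := (harmonic_picard alpha p sigma j).1; pose g := (harmonic_picard alpha p sigma j).2.
have [mf mg fK gK] := H j.
have i1 := integrable_lin iC iS mf mg fK gK.
have i2 := integrable_lin iS (integrable_opp iC) mf mg fK gK.
pose C x := cos (2 * sigma * (x - p)); pose S x := sin (2 * sigma * (x - p)).
pose k x : R[i] := (alpha0 x * C x) +i* (alpha0 x * S x).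
split.
- rewrite [LHS]/=.
  have E s : p < s < r ->
     simplex_integral j p s (fun l => c * harmonic_factor alpha0 p sigma (s :: l)) =
     c * k s * (f s +i* g s)^*%C.
    move=> /andP[_ sr].
    have sq : s <= q by apply: le_trans rq; exact: ltW.
    have [_ <-] := IH s sq (c * k s).
    congr (simplex_integral _ _ _ _); apply/funext => l.
    by rewrite harmonic_factor_cons mulrA.
  rewrite (cintegral_scale (c := c) i1 i2) //.
  apply: (ae_imply a0a) => x ax xpr; rewrite E //.
  have aE : alpha0 x = alpha x.
    by apply: ax; case/andP: xpr => -> xr; exact: lt_le_trans xr rq.
  rewrite -mulrA; congr (_ * _); rewrite /k aE.
  by apply: complexP; rewrite ?Re_mulc ?Im_mulc /= /C /S /f /g; ring.
- rewrite [LHS]/=.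
  have E s : p < s < r ->
     simplex_integral j p s (fun l => c * (harmonic_factor alpha0 p sigma (s :: l))^*%C) =
     c * (k s)^*%C * (f s +i* g s).
    move=> /andP[_ sr].
    have sq : s <= q by apply: le_trans rq; exact: ltW.
    have [<- _] := IH s sq (c * (k s)^*%C).
    congr (simplex_integral _ _ _ _); apply/funext => l.
    rewrite harmonic_factor_cons -/(C s) -/(S s) -/(k s) -mulrA; congr (_ * _).
    move: (k s) (harmonic_factor alpha0 p sigma l) => [k1 k2] [t1 t2].
    by apply: complexP; rewrite /= ?Re_mulc ?Im_mulc /=; ring.
  rewrite (cintegral_scale (c := c) i1 (integrable_opp i2)); last first.
    apply: (ae_imply a0a) => x ax xpr; rewrite E //.
    have aE : alpha0 x = alpha x.
      by apply: ax; case/andP: xpr => -> xr; exact: lt_le_trans xr rq.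
    rewrite -mulrA; congr (_ * _); rewrite /k aE.
    by apply: complexP; rewrite ?Re_mulc ?Im_mulc /= /C /S /f /g; ring.
  congr (_ * _); apply: complexP => //=.
  set h := (h in - \int[_]_(t in _) h t).
  have ih : leb.-integrable `]p, r[ (EFin \o h) by exact: integrableS i2.
  have mD : measurable (`]p, r[%classic : set R) by exact: measurable_itv.
  have := @RintegralZl _ _ R leb _ h (-1) mD ih.
  by rewrite mulN1r => <-; apply: eq_Rintegral => t _; rewrite mulN1r.
Qed.

Lemma harmonic_exp_solution (R : realType) (alpha0 alpha : R -> R) (p q sigma : R) :
  leb.-integrable setT (EFin \o alpha) ->
  {ae leb, forall x, p < x < q -> alpha0 x = alpha x} ->
  exists e1 e2 : R -> R,
    [/\ lin_solution p q (fun x => alpha x * cos (2 * sigma * (x - p)))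
          (fun x => alpha x * sin (2 * sigma * (x - p)))
          (fun x => alpha x * sin (2 * sigma * (x - p)))
          (fun x => - (alpha x * cos (2 * sigma * (x - p)))) e1 e2,
        e1 p = 1, e2 p = 0 &
        forall r, r <= q -> harmonic_exp alpha0 p r sigma%:C = (e1 r) +i* (e2 r)].
Proof.
move=> ia a0a.
have [iC iS] := integrable_trig p sigma ia.
have [e1 [e2 [sol e1p e2p cvg_e]]] := picard_solution p q 1 0 iC iS iS (integrable_opp iC).
exists e1, e2; split => // r rq.
have T j : harmonic_term alpha0 p r sigma%:C j =
    ((harmonic_picard alpha p sigma j).1 r) +i* ((harmonic_picard alpha p sigma j).2 r).
  have [H _] := simplex_harmonic sigma j ia a0a rq 1.
  rewrite mul1r in H; rewrite -H; congr (simplex_integral _ _ _ _).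
  by apply/funext => l; rewrite mul1r.
(* [harmonic_exp] writes the term of index 0 separately as 1 and sums from index 1, whereas the
   Picard series starts at 0. *)
have lim_shift (u : nat -> R) (l : R) : series u @ \oo --> l ->
    u 0%N + limn (series (fun j => u j.+1)) = l.
  move=> ul; have : series (fun j => u j.+1) n @[n --> \oo] --> l - u 0%N.
    have E n : series (fun j => u j.+1) n = series u n.+1 - u 0%N.
      by rewrite /series /= [in RHS]big_nat_recl //=; ring.
    under eq_fun do rewrite E; apply: cvgB; last exact: cvg_cst.
    by rewrite (cvg_shiftS (series u)).
  by move=> /cvg_lim -> //; rewrite addrC subrK.
have [c1 c2] := cvg_e r.
rewrite /harmonic_exp /cseries_sum.
under [X in limn (series X) +i* _]eq_fun do rewrite T.
under [X in _ +i* limn (series X)]eq_fun do rewrite T.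
rewrite /=; apply: complexP => /=.
  exact: (lim_shift (fun j => (harmonic_picard alpha p sigma j).1 r)).
exact: (lim_shift (fun j => (harmonic_picard alpha p sigma j).2 r)).
Qed.

(** * The amplitude in a rotating frame *)

Lemma is_derive_phase (R : realType) (p sigma x : R) :
  is_derive x 1 (fun x => cos (sigma * (x - p))) (- (sigma * sin (sigma * (x - p)))) /\
  is_derive x 1 (fun x => sin (sigma * (x - p))) (sigma * cos (sigma * (x - p))).
Proof.
have A : is_derive x 1 (fun x => sigma * (x - p)) sigma.
  by apply: is_derive_eq; rewrite /GRing.scale /= !(mulr0, mulr1, addr0, subr0, oppr0).
split.
  have := @is_derive1_comp _ (@cos R) (fun y => sigma * (y - p)) x _ _ (is_derive_cos _) A.
  by rewrite mulNr [X in is_derive _ _ _ (- X) -> _]mulrC; exact.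
have := @is_derive1_comp _ (@sin R) (fun y => sigma * (y - p)) x _ _ (is_derive_sin _) A.
by rewrite [X in is_derive _ _ _ X -> _]mulrC; exact.
Qed.

Lemma ac_on_phase (R : realType) (p q sigma a : R) :
  ac_on p q (fun x => cos (sigma * (x - a))) /\ ac_on p q (fun x => sin (sigma * (x - a))).
Proof.
have lip (f f' : R -> R) : (forall x : R, is_derive x 1 f (f' x)) ->
    (forall x, `|f' x| <= `|sigma|) -> ac_on p q f.
  move=> df bf; apply: (ac_on_lipschitz (C := `|sigma|) (@ac_on_id R p q)) => s t _ _.
  wlog st : s t / s <= t => [hw|].
    have [|/ltW] := leP s t; first exact: hw.
    by move=> ts; rewrite distrC [ `|t - s|]distrC; exact: hw.
  have cf : {within `[s, t], continuous f}.
    apply: continuous_subspaceT => x; apply/differentiable_continuous/derivable1_diffP.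
    by case: (df x).
  have [x _ ->] := @MVT_segment _ f f' s t st (fun x _ => df x) cf.
  by rewrite normrM ler_wpM2r.
split.
  apply: (lip _ (fun x => - (sigma * sin (sigma * (x - a))))) => x.
    exact: (is_derive_phase a sigma x).1.
  by rewrite normrN normrM ler_piMr // ler_norml sin_le1 sin_geN1.
apply: (lip _ (fun x => sigma * cos (sigma * (x - a)))) => x.
  exact: (is_derive_phase a sigma x).2.
by rewrite normrM ler_piMr // ler_norml cos_le1 cos_geN1.
Qed.

Lemma is_derive_expR_comp (R : realType) (f : R -> R) (x df : R) :
  is_derive x 1 f df -> is_derive x 1 (fun y => expR (f y)) (df * expR (f x)).
Proof.
move=> H; have := @is_derive1_comp _ (@expR R) f x _ _ (is_derive_expR _) H.
by rewrite mulrC; exact.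
Qed.

(* Here L = log zeta and V = zeta u', so that (P1, P2) is sqrt(zeta) times
   (u, u' / sigma). This vector rotates with angular speed sigma when alpha = 0;
   undoing the rotation leaves the system of [harmonic_picard] for - alpha. *)
Lemma phase_solution (R : realType) (p q sigma : R) (L u V alpha : R -> R) :
  sigma != 0 ->
  ac_on p q L -> ac_on p q u -> ac_on p q V ->
  {ae leb, forall x, p < x < q -> is_derive x 1 L (- 2 * alpha x)} ->
  {ae leb, forall x, p < x < q -> is_derive x 1 u (V x * expR (- L x))} ->
  {ae leb, forall x, p < x < q -> is_derive x 1 V (- sigma ^+ 2 * expR (L x) * u x)} ->
  let P1 x := expR (L x / 2) * u x in
  let P2 x := expR (- (L x / 2)) * (V x / sigma) in
  lin_solution p q (fun x => - alpha x * cos (2 * sigma * (x - p)))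
    (fun x => - alpha x * sin (2 * sigma * (x - p)))
    (fun x => - alpha x * sin (2 * sigma * (x - p)))
    (fun x => - (- alpha x * cos (2 * sigma * (x - p))))
    (fun x => cos (sigma * (x - p)) * P1 x - sin (sigma * (x - p)) * P2 x)
    (fun x => sin (sigma * (x - p)) * P1 x + cos (sigma * (x - p)) * P2 x).
Proof.
move=> s0 acL acu acV dL du dV P1 P2.
have acP1 : ac_on p q P1.
  by apply: ac_onM => //; apply: ac_on_expR; apply: ac_onM => //; exact: ac_on_cst.
have acP2 : ac_on p q P2.
  apply: ac_onM; last by apply: ac_onM => //; exact: ac_on_cst.
  by apply: ac_on_expR; apply: ac_onN; apply: ac_onM => //; exact: ac_on_cst.
have [accos acsin] := ac_on_phase p q sigma p.
have dP1 : {ae leb, forall x, p < x < q ->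
    is_derive x 1 P1 (- alpha x * P1 x + sigma * P2 x)}.
  apply: (ae_imply2 dL du) => x HL Hu xpq; have {}HL := HL xpq; have {}Hu := Hu xpq.
  have HL2 : is_derive x 1 (fun y => L y / 2) (- alpha x).
    by apply: is_derive_eq; rewrite /GRing.scale /=; field.
  have := @is_deriveM _ _ _ _ _ _ _ _ (is_derive_expR_comp HL2) Hu.
  move=> /is_derive_eq; apply; rewrite /GRing.scale /= /P1 /P2.
  have -> : expR (- L x) = expR (- (L x / 2)) * expR (- (L x / 2)).
    by rewrite -expRD; congr expR; field.
  have e1 : expR (L x / 2) * expR (- (L x / 2)) = 1 by rewrite -expRD subrr expR0.
  transitivity ((expR (L x / 2) * expR (- (L x / 2))) * (V x * expR (- (L x / 2))) +
    u x * (- alpha x * expR (L x / 2))); first by ring.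
  by rewrite e1; field.
have dP2 : {ae leb, forall x, p < x < q ->
    is_derive x 1 P2 (alpha x * P2 x - sigma * P1 x)}.
  apply: (ae_imply2 dL dV) => x HL HV xpq; have {}HL := HL xpq; have {}HV := HV xpq.
  have HL2 : is_derive x 1 (fun y => - (L y / 2)) (alpha x).
    by apply: is_derive_eq; rewrite /GRing.scale /=; field.
  have HV2 : is_derive x 1 (fun y => V y / sigma) (- sigma * expR (L x) * u x).
    by apply: is_derive_eq; rewrite /GRing.scale /=; field; rewrite ?s0.
  have := @is_deriveM _ _ _ _ _ _ _ _ (is_derive_expR_comp HL2) HV2.
  move=> /is_derive_eq; apply; rewrite /GRing.scale /= /P1 /P2.
  have -> : expR (L x) = expR (L x / 2) * expR (L x / 2).
    by rewrite -expRD; congr expR; field.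
  have e1 : expR (- (L x / 2)) * expR (L x / 2) = 1 by rewrite -expRD addNr expR0.
  transitivity ((expR (- (L x / 2)) * expR (L x / 2)) * (- sigma * expR (L x / 2) * u x) +
    V x / sigma * (alpha x * expR (- (L x / 2)))); first by ring.
  by rewrite e1; ring.
have trig (x : R) : cos (2 * sigma * (x - p)) =
     cos (sigma * (x - p)) ^+ 2 - sin (sigma * (x - p)) ^+ 2 /\
    sin (2 * sigma * (x - p)) = 2 * sin (sigma * (x - p)) * cos (sigma * (x - p)).
  have -> : 2 * sigma * (x - p) = sigma * (x - p) + sigma * (x - p) by ring.
  by rewrite cosD sinD; split; ring.
split.
- by apply: ac_onB; exact: ac_onM.
- by apply: ac_onD; exact: ac_onM.
- apply: (ae_imply2 dP1 dP2) => x H1 H2 xpq; have {}H1 := H1 xpq; have {}H2 := H2 xpq.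
  have [Hc Hs] := is_derive_phase p sigma x; have [-> ->] := trig x.
  have := is_deriveB (is_deriveM Hc H1) (is_deriveM Hs H2).
  move=> /is_derive_eq; apply; rewrite /GRing.scale /=.
  have := cos2Dsin2 (sigma * (x - p)).
  set c := cos _; set s := sin _ => cs1.
  (* The terms with sigma cancel on the left. The double-angle coefficients on the right produce the
     extra factor c^2 + s^2. *)
  transitivity (- alpha x * (c ^+ 2 + s ^+ 2) * (c * P1 x + s * P2 x)); last by ring.
  by rewrite cs1; ring.
- apply: (ae_imply2 dP1 dP2) => x H1 H2 xpq; have {}H1 := H1 xpq; have {}H2 := H2 xpq.
  have [Hc Hs] := is_derive_phase p sigma x; have [-> ->] := trig x.
  have := is_deriveD (is_deriveM Hs H1) (is_deriveM Hc H2).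
  move=> /is_derive_eq; apply; rewrite /GRing.scale /=.
  have := cos2Dsin2 (sigma * (x - p)).
  set c := cos _; set s := sin _ => cs1.
  transitivity (- alpha x * (c ^+ 2 + s ^+ 2) * (s * P1 x - c * P2 x)); last by ring.
  by rewrite cs1; ring.
Qed.

Lemma mulmx_mx22_cv2 (T : nzRingType) (a b c d x y : T) :
  mx22 a b c d *m cv2 x y = cv2 (a * x + b * y) (c * x + d * y).
Proof.
apply/matrixP => i j; rewrite !mxE big_ord_recl big_ord1 !mxE /=.
by case: ifP.
Qed.

(* The vector [amplitude] when p1 + i q1 = sqrt(zeta) u and
   p2 + i q2 = sqrt(zeta) u' / sigma. *)
Definition amp (R : realType) (p1 p2 q1 q2 : R) : 'cV[R[i]]_2 :=
  cv2 (((p1 - q2) / 2) +i* ((q1 + p2) / 2)) (((p1 + q2) / 2) +i* ((q1 - p2) / 2)).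

(** In the rotating frame each of the real solutions u1, u2 is a real combination of the harmonic
    exponential of - alpha, which starts at 1, and i times that of alpha, which starts at i, with
    the values of P1 and P2 at p as coefficients. Rotating back and forming the amplitude of u1 + i
    u2 yields the propagation matrix. *)
Lemma piece_transfer (R : realType) (p q sigma : R) (zeta L u1 V1 u2 V2 alpha : R -> R) :
  sigma != 0 -> leb.-integrable setT (EFin \o alpha) ->
  {ae leb, forall x, p < x < q -> reflectivity zeta x = alpha x} ->
  ac_on p q L -> ac_on p q u1 -> ac_on p q V1 -> ac_on p q u2 -> ac_on p q V2 ->
  {ae leb, forall x, p < x < q -> is_derive x 1 L (- 2 * alpha x)} ->
  {ae leb, forall x, p < x < q -> is_derive x 1 u1 (V1 x * expR (- L x))} ->
  {ae leb, forall x, p < x < q -> is_derive x 1 V1 (- sigma ^+ 2 * expR (L x) * u1 x)} ->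
  {ae leb, forall x, p < x < q -> is_derive x 1 u2 (V2 x * expR (- L x))} ->
  {ae leb, forall x, p < x < q -> is_derive x 1 V2 (- sigma ^+ 2 * expR (L x) * u2 x)} ->
  let P1 u x := expR (L x / 2) * u x in
  let P2 V x := expR (- (L x / 2)) * (V x / sigma) in
  forall x, p <= x <= q ->
    amp (P1 u1 x) (P2 V1 x) (P1 u2 x) (P2 V2 x) =
    propagation_matrix zeta p x sigma%:C *m amp (P1 u1 p) (P2 V1 p) (P1 u2 p) (P2 V2 p).
Proof.
move=> s0 ia refl acL acu1 acV1 acu2 acV2 dL du1 dV1 du2 dV2 P1 P2 x xpq.
have [e1 [e2 [solE e1p e2p EE]]] := harmonic_exp_solution sigma ia refl.
have refl' : {ae leb, forall x, p < x < q -> - reflectivity zeta x = - alpha x}.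
  by apply: (ae_imply refl) => y H /H ->.
have [f1 [f2 [solF f1p f2p FE]]] := harmonic_exp_solution sigma (integrable_opp ia) refl'.
(* (- e2, e1) is i times e1 + i e2. Multiplication by i anticommutes with conjugation, so the
   equation for alpha becomes the one for - alpha. *)
have solE' : lin_solution p q (fun x => - alpha x * cos (2 * sigma * (x - p)))
    (fun x => - alpha x * sin (2 * sigma * (x - p)))
    (fun x => - alpha x * sin (2 * sigma * (x - p)))
    (fun x => - (- alpha x * cos (2 * sigma * (x - p)))) (fun x => - e2 x) e1.
  case: solE => a1 a2 d1 d2; split => //; first exact: ac_onN.
    apply: (ae_imply d2) => y H /H{}H; have := is_deriveN H.
    by move=> /is_derive_eq; apply; ring.
  by apply: (ae_imply d1) => y H /H{}H; move: H => /is_derive_eq; apply; ring.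
have sol1 := phase_solution s0 acL acu1 acV1 dL du1 dV1.
have sol2 := phase_solution s0 acL acu2 acV2 dL du2 dV2.
have tr y : - (- alpha y * cos (2 * sigma * (y - p))) = - (- alpha y * cos (2 * sigma * (y - p))) by [].
have e2p' : - e2 p = 0 by rewrite e2p oppr0.
have [A1 A2] := lin_solution_repr tr solF solE' sol1 f1p f2p e2p' e1p xpq.
have [B1 B2] := lin_solution_repr tr solF solE' sol2 f1p f2p e2p' e1p xpq.
rewrite /= !subrr !mulr0 !cos0 !sin0 !mul1r !mul0r !subr0 !add0r in A1 A2 B1 B2.
rewrite -/(P1 u1 p) -/(P2 V1 p) -/(P1 u1 x) -/(P2 V1 x) in A1 A2.
rewrite -/(P1 u2 p) -/(P2 V2 p) -/(P1 u2 x) -/(P2 V2 x) in B1 B2.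
have /andP[px xq] := xpq.
have half : (2^-1 : R[i]) = (2^-1 : R)%:C by rewrite fmorphV rmorph_nat.
rewrite /propagation_matrix /harmonic_cosh /harmonic_sinh (EE _ xq) (FE _ xq) half.
have -> : - 'i%C * (x - p)%:C * sigma%:C = 0 +i* (- (sigma * (x - p))) :> R[i].
  by apply: complexP; rewrite ?Re_mulc ?Im_mulc /= ?Re_mulc ?Im_mulc /=; ring.
rewrite cexp_imaginary cosN sinN.
have := cos2Dsin2 (sigma * (x - p)).
set c := cos _ in A1 A2 B1 B2 *; set s := sin _ in A1 A2 B1 B2 * => cs1.
have R1 (a b y z : R) : c * a - s * b = y -> s * a + c * b = z ->
    a = c * y + s * z /\ b = c * z - s * y.
  move=> <- <-; split.
    by transitivity ((c ^+ 2 + s ^+ 2) * a); [rewrite cs1 mul1r|ring].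
  by transitivity ((c ^+ 2 + s ^+ 2) * b); [rewrite cs1 mul1r|ring].
have [-> ->] := R1 _ _ _ _ A1 A2.
have [-> ->] := R1 _ _ _ _ B1 B2.
rewrite /amp mulmx_mx22_cv2.
by congr cv2; apply: complexP; rewrite /= ?Re_mulc ?Im_mulc /= ?Re_mulc ?Im_mulc /=; field.
Qed.

(** * Piecewise absolutely continuous coefficients *)

(** Here g^2 is the jump ratio. As u and zeta u' are continuous, the left value of sqrt(zeta) u is g
    times its right value, and the left value of sqrt(zeta) u' = zeta u' / sqrt(zeta) is the right
    one divided by g. *)
Lemma amp_jump (R : realType) (g p1 p2 q1 q2 : R) : 0 < g ->
  map_mx (real_complex R)
    ((2 * g)^-1 *: mx22 (1 + g ^+ 2) (1 - g ^+ 2) (1 - g ^+ 2) (1 + g ^+ 2))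
  *m amp (g * p1) (p2 / g) (g * q1) (q2 / g) = amp p1 p2 q1 q2.
Proof.
move=> g0.
have -> : map_mx (real_complex R)
    ((2 * g)^-1 *: mx22 (1 + g ^+ 2) (1 - g ^+ 2) (1 - g ^+ 2) (1 + g ^+ 2)) =
  mx22 ((2 * g)^-1 * (1 + g ^+ 2))%:C ((2 * g)^-1 * (1 - g ^+ 2))%:C
       ((2 * g)^-1 * (1 - g ^+ 2))%:C ((2 * g)^-1 * (1 + g ^+ 2))%:C.
  by apply/matrixP => i j; rewrite !mxE; case: ifP; case: ifP.
rewrite /amp mulmx_mx22_cv2.
by congr cv2; apply: complexP; rewrite /= ?Re_mulc ?Im_mulc /=; field; rewrite gt_eqF.
Qed.

Lemma amplitude_amp (R : realType) (zeta : R -> R) (sigma x l a1 a2 v1 v2 : R)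
    (u : R -> R[i]) : sigma != 0 ->
  zeta x = expR l -> u x = a1 +i* a2 ->
  cderive1 u x = (v1 * expR (- l)) +i* (v2 * expR (- l)) ->
  amplitude zeta sigma u x =
  amp (expR (l / 2) * a1) (expR (- (l / 2)) * (v1 / sigma))
      (expR (l / 2) * a2) (expR (- (l / 2)) * (v2 / sigma)).
Proof.
move=> s0 zE uE dE.
have sq : expR l = expR (l / 2) ^+ 2 by rewrite expr2 -expRD; congr expR; field.
have ee : expR (l / 2) * expR (- l) = expR (- (l / 2)) by rewrite -expRD; congr expR; field.
have is0 : ('i%C * sigma%:C)^-1 = 0 +i* (- sigma^-1) :> R[i].
  apply: (@mulrI _ ('i%C * sigma%:C)).
    rewrite unitfE mulf_eq0 negb_or; apply/andP; split; apply/eqP => -[]; last exact/eqP.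
    by move/eqP; rewrite oner_eq0.
  rewrite mulfV; last first.
    rewrite mulf_eq0 negb_or; apply/andP; split; apply/eqP => -[]; last exact/eqP.
    by move/eqP; rewrite oner_eq0.
  by apply: complexP; rewrite /= ?Re_mulc ?Im_mulc /=; field; rewrite ?s0.
rewrite /amplitude zE sq sqrtr_sqr ger0_norm ?expR_ge0 // uE dE is0 mulmx_mx22_cv2.
have sc (z a b : R[i]) : z *: cv2 a b = cv2 (z * a) (z * b).
  by apply/matrixP => i j; rewrite !mxE; case: ifP.
rewrite sc /amp -ee; set r := expR (l / 2).
by congr cv2; apply: complexP; rewrite /= ?Re_mulc ?Im_mulc /= ?Re_mulc ?Im_mulc /=; field; rewrite ?s0.
Qed.

(** L is the logarithm of the extension of zeta to the closed piece, so its endpoint values carry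
    the one-sided limits; alpha is - 1/2 times the integrable density of L and agrees with
    [reflectivity] wherever L has that density as its derivative. *)
Lemma zeta_piece (R : realType) (p q m : R) (zeta : R -> R) : p < q -> 0 < m ->
  absolutely_continuous `]p, q[ zeta -> (forall x, p < x < q -> m <= zeta x) ->
  exists L alpha : R -> R, [/\ ac_on p q L,
    leb.-integrable setT (EFin \o alpha),
    {ae leb, forall x, p < x < q -> is_derive x 1 L (- 2 * alpha x)},
    {ae leb, forall x, p < x < q -> reflectivity zeta x = alpha x} &
    [/\ forall x, p < x < q -> zeta x = expR (L x),
        right_lim zeta p = expR (L p) & left_lim zeta q = expR (L q)]].
Proof.
move=> pq m0 acz mz; have [Z acZ ZE] := ac_on_extend pq acz.
have /(continuous_within_itvP _ pq)[cZ cZp cZq] := ac_on_continuous acZ.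
have nzp : \forall x \near p^'+, Z x = zeta x.
  near=> x; apply: ZE; apply/andP; split; near: x.
    exact: nbhs_right_gt.
  exact: nbhs_right_lt.
have nzq : \forall x \near q^'-, Z x = zeta x.
  near=> x; apply: ZE; apply/andP; split; near: x.
    exact: nbhs_left_gt.
  exact: nbhs_left_lt.
(* The lower bound reaches the endpoints by one-sided limits; it makes the logarithm Lipschitz on
   the range of Z. *)
have mZ x : p <= x <= q -> m <= Z x.
  move=> /andP[]; rewrite le_eqVlt => /orP[/eqP <- _|px].
    apply: (cvgr_to_ge cZp); near=> t; rewrite ZE ?mz //; apply/andP; split; near: t.
    - exact: nbhs_right_gt.
    - exact: nbhs_right_lt.
    - exact: nbhs_right_gt.
    - exact: nbhs_right_lt.
  rewrite le_eqVlt => /orP[/eqP ->|xq].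
    apply: (cvgr_to_ge cZq); near=> t; rewrite ZE ?mz //; apply/andP; split; near: t.
    - exact: nbhs_left_gt.
    - exact: nbhs_left_lt.
    - exact: nbhs_left_gt.
    - exact: nbhs_left_lt.
  by rewrite ZE ?px // mz // px.
have acL := ac_on_ln m0 mZ acZ.
have [h ih dh] := ac_on_ae_derive pq acL.
have posZ x : p <= x <= q -> Z x \in Num.pos by move=> /mZ H; rewrite posrE; lra.
exists (fun x => ln (Z x)), (fun x => - 2^-1 * h x); split => //.
- exact: (integrableZl _ (- 2^-1) ih).
- apply: (ae_imply dh) => x H /H; have -> : - 2 * (- 2^-1 * h x) = h x by field.
  by [].
- apply: (ae_imply dh) => x H xpq; have := H xpq; rewrite /reflectivity => -[_ <-].
  rewrite derive1E; congr (_ * _); apply: near_eq_derive.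
  have /andP[px xq] := xpq.
  near=> t; rewrite ZE //; apply/andP; split; near: t.
    exact: lt_nbhsr.
  exact: lt_nbhsl.
split.
- move=> x /andP[px xq]; rewrite -ZE ?px // lnK // posZ // !ltW //.
- rewrite lnK ?posZ ?lexx ?ltW //; apply: cvg_lim => //.
  by apply: cvg_trans cZp; apply: near_eq_cvg.
- rewrite lnK ?posZ ?lexx ?ltW //; apply: cvg_lim => //.
  by apply: cvg_trans cZq; apply: near_eq_cvg.
Unshelve. all: by end_near. Qed.

Definition piecewise_ac (R : realType) (n : nat) (y : nat -> R) (m M : R) (zeta : R -> R) :=
  [/\ 0 < m, forall k, (k <= n)%N -> y k < y k.+1,
      forall x, y 0%N < x < y n.+1 -> m <= zeta x <= M &
      forall k, (k <= n)%N -> absolutely_continuous `]y k, y k.+1[ zeta].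

Lemma piecewise_le (R : realType) n (y : nat -> R) :
  (forall k, (k <= n)%N -> y k < y k.+1) ->
  forall k, (k <= n.+1)%N -> y 0%N <= y k /\ y k <= y n.+1.
Proof.
move=> hy k kn; split.
  elim: k kn => // k IH kn; apply: (le_trans (IH (ltnW kn))); exact/ltW/hy.
have -> : k = (n.+1 - (n.+1 - k))%N by rewrite subKn.
elim: (n.+1 - k)%N (leq_subr k n.+1) => [|j IH] jn; first by rewrite subn0.
apply: le_trans (IH (ltnW jn)).
have -> : (n.+1 - j = (n.+1 - j.+1).+1)%N by rewrite subSS subSn // -ltnS.
by apply/ltW/hy; rewrite subSS leq_subr.
Qed.

Lemma piecewise_lt (R : realType) n (y : nat -> R) :
  (forall k, (k <= n)%N -> y k < y k.+1) -> y 0%N < y n.+1.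
Proof.
move=> hy; apply: lt_le_trans (hy 0%N isT) _.
by have [] := piecewise_le hy (isT : (1 <= n.+1)%N).
Qed.

Lemma piecewise_sub (R : realType) n (y : nat -> R) k x :
  (forall k, (k <= n)%N -> y k < y k.+1) -> (k <= n)%N ->
  y k < x < y k.+1 -> y 0%N < x < y n.+1.
Proof.
move=> hy kn /andP[kx xk].
have [H1 _] := piecewise_le hy (leqW kn); have [_ H2] := piecewise_le hy (kn : (k.+1 <= n.+1)%N).
by rewrite (le_lt_trans H1 kx) (lt_le_trans xk H2).
Qed.

Lemma piecewise_continuous (R : realType) n (y : nat -> R) m M zeta k x :
  piecewise_ac n y m M zeta -> (k <= n)%N -> y k < x < y k.+1 ->
  {for x, continuous zeta}.
Proof.
move=> [m0 hy hm hac] kn xk.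
have [Z acZ ZE] := ac_on_extend (hy k kn) (hac k kn).
have cZ : {for x, continuous Z}.
  by apply: (within_continuous_continuous (hy k kn) (ac_on_continuous acZ)); rewrite in_itv.
have N : \forall t \near x, Z t = zeta t.
  have /andP[kx xk'] := xk.
  near=> t; rewrite ZE //; apply/andP; split; near: t.
    exact: lt_nbhsr.
  exact: lt_nbhsl.
suff: zeta t @[t --> x] --> zeta x by [].
by rewrite -(ZE x xk); apply: cvg_trans cZ; exact: near_eq_cvg.
Unshelve. all: by end_near. Qed.

Lemma piecewise_measurable (R : realType) n (y : nat -> R) m M zeta :
  piecewise_ac n y m M zeta -> measurable_fun `]y 0%N, y n.+1[ zeta.
Proof.
move=> pac; have [m0 hy hm hac] := pac.
suff H : forall k, (k <= n)%N -> measurable_fun `]y 0%N, y k.+1[ zeta by exact: H.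
have piece k : (k <= n)%N -> measurable_fun `]y k, y k.+1[ zeta.
  move=> kn; apply: open_continuous_measurable_fun; first exact: interval_open.
  by move=> x; rewrite inE /= in_itv /=; exact: piecewise_continuous pac kn.
elim=> [|k IH] kn; first exact: piece.
have -> : `]y 0%N, y k.+2[%classic =
    (`]y 0%N, y k.+1[ `|` [set y k.+1]) `|` `]y k.+1, y k.+2[.
  have H0 : y 0%N < y k.+1.
    by have [H1 _] := piecewise_le hy (leqW (ltnW kn)); apply: le_lt_trans H1 (hy k (ltnW kn)).
  have H2 := hy k.+1 kn.
  apply/seteqP; split => x /=; rewrite !in_itv /=.
    by move=> /andP[-> xk] /=; case: (ltgtP x (y k.+1)) => [|xk'|->]; [left; left|right; rewrite ?xk'|left; right].
  by move=> [[/andP[? ?]|->]|/andP[? ?]]; apply/andP; split; lra.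
apply/measurable_funU; [|exact: measurable_itv|split].
- by apply: measurableU; [exact: measurable_itv|exact: measurable_set1].
- apply/measurable_funU; [exact: measurable_itv|exact: measurable_set1|split].
    exact: IH (ltnW kn).
  exact: measurable_fun_set1.
- exact: piece.
Qed.

Lemma bounded_integrable (R : realType) (a b K : R) (f : R -> R) :
  measurable_fun `]a, b[ f -> (forall x, a < x < b -> `|f x| <= K) ->
  leb.-integrable `]a, b[ (EFin \o f).
Proof.
move=> mf fK; have mD : measurable (`]a, b[%classic : set R) by exact: measurable_itv.
apply: measurable_bounded_integrable => //.
  rewrite [X in (X < _)%E](lebesgue_measure_itv `]a, b[%R); case: ifP => _; last exact: ltry.
  by rewrite -EFinB ltry.
exists K; split; first exact: num_real.
by move=> M KM x xab; apply: le_trans (ltW KM); apply: fK; move: xab; rewrite /= in_itv.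
Qed.

(* f stands for u and g for zeta u'. *)
Definition sl_solution (R : realType) (p q : R) (zeta : R -> R) (sigma : R) (f g : R -> R) :=
  [/\ ac_on p q f, ac_on p q g,
      {ae leb, forall x, p < x < q -> is_derive x 1 f (g x * (zeta x)^-1)} &
      {ae leb, forall x, p < x < q -> is_derive x 1 g (- sigma ^+ 2 * zeta x * f x)}].

Lemma ac_on_cvg_right (R : realType) (p q : R) (f : R -> R) : p < q -> ac_on p q f ->
  f t @[t --> p^'+] --> f p.
Proof. by move=> pq /ac_on_continuous /(continuous_within_itvP _ pq)[]. Qed.

Lemma ac_on_continuous_at (R : realType) (p q x : R) (f : R -> R) : ac_on p q f ->
  p < x < q -> {for x, continuous f}.
Proof.
move=> /ac_on_continuous cf /andP[px xq].
by apply: (within_continuous_continuous (lt_trans px xq) cf); rewrite in_itv /= px.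
Qed.

Lemma ac_on_measurable (R : realType) (p q : R) (f : R -> R) : ac_on p q f ->
  measurable_fun `]p, q[ f.
Proof.
move=> acf; apply: open_continuous_measurable_fun; first exact: interval_open.
by move=> x; rewrite inE /= in_itv /=; exact: ac_on_continuous_at acf.
Qed.

Lemma cintegral_realM (R : realType) (D : set R) (u : R -> R[i]) (r : R -> R) :
  cintegral D (fun x => u x * (r x)%:C) =
  (\int[leb]_(x in D) (Re (u x) * r x)) +i* (\int[leb]_(x in D) (Im (u x) * r x)).
Proof.
rewrite /cintegral; congr (_ +i* _); apply: eq_Rintegral => x _.
  by rewrite Re_mulc /= mulr0 subr0.
by rewrite Im_mulc /= mulr0 add0r.
Qed.

Lemma cintegral_real2M (R : realType) (D : set R) (u : R -> R[i]) (c r : R -> R) :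
  cintegral D (fun x => (c x)%:C * u x * (r x)%:C) =
  (\int[leb]_(x in D) (c x * Re (u x) * r x)) +i* (\int[leb]_(x in D) (c x * Im (u x) * r x)).
Proof.
rewrite cintegral_realM; congr (_ +i* _); apply: eq_Rintegral => x _.
  by rewrite Re_mulc /= mul0r subr0.
by rewrite Im_mulc /= mul0r addr0.
Qed.

Lemma square_integrable_bounded (R : realType) (a b K : R) (f g : R -> R) :
  measurable_fun `]a, b[ f -> measurable_fun `]a, b[ g ->
  (forall x, a < x < b -> `|f x| <= K /\ `|g x| <= K) ->
  square_integrable `]a, b[ (fun x => f x +i* g x).
Proof.
move=> mf mg fgK; split => //=.
have : leb.-integrable `]a, b[ (EFin \o (fun x => f x ^+ 2 + g x ^+ 2)).
  apply: (@bounded_integrable _ _ _ (K ^+ 2 + K ^+ 2)).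
    by apply: measurable_funD; exact: measurable_funX.
  move=> x /fgK[fK gK]; rewrite ger0_norm ?addr_ge0 ?sqr_ge0 //.
  by apply: lerD; rewrite -[X in X <= _]real_normK ?num_real // lerXn2r // nnegrE ?normr_ge0 // (le_trans (normr_ge0 _) fK).
move=> /integrableP[_]; congr (_ < _)%E.
by apply: eq_integral => x _ /=; rewrite ger0_norm // addr_ge0 ?sqr_ge0.
Qed.

(** * The equation as a system on the whole interval *)

Section piecewise.
Variables (R : realType) (n : nat) (y : nat -> R) (m M : R) (zeta : R -> R) (sigma : R).
Hypothesis pac : piecewise_ac n y m M zeta.
Local Notation x0 := (y 0%N).
Local Notation x1 := (y n.+1).

Let m0 : 0 < m. Proof. by case: pac. Qed.
Let hy k : (k <= n)%N -> y k < y k.+1. Proof. by case: pac => _ H _ _; exact: H. Qed.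
Let zmM x : x0 < x < x1 -> m <= zeta x <= M. Proof. by case: pac => _ _ H _; exact: H. Qed.
Let z0 x : x0 < x < x1 -> 0 < zeta x.
Proof. by move=> /zmM/andP[+ _]; exact: lt_le_trans. Qed.

Lemma piecewise_measurableV : measurable_fun `]x0, x1[ (fun x => (zeta x)^-1).
Proof.
(* Written this way, the inverse is a composition of measurable functions. *)
apply: (eq_measurable_fun (fun x => expR (- ln (zeta x)))).
  by move=> x; rewrite inE /= in_itv /= => xx; rewrite expRN lnK // posrE z0.
by apply: measurableT_comp => //; apply: measurableT_comp => //;
  apply: measurableT_comp => //; exact: piecewise_measurable pac.
Qed.

(** Extended by 0, since the Picard iteration takes coefficients that are integrable on the whole
    line. The diagonal is 0, so the system is trace-free, and the jumps of zeta do not matter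
    here. *)
Let m12 := (fun x => (zeta x)^-1) \_ `]x0, x1[.
Let m21 := (fun x => - sigma ^+ 2 * zeta x) \_ `]x0, x1[.

Let i0 : leb.-integrable setT (EFin \o (fun _ : R => 0 : R)).
Proof. exact: integrable0. Qed.

Lemma zetaV_bound x : x0 < x < x1 -> `|(zeta x)^-1| <= m^-1.
Proof.
move=> xx; have /andP[mz _] := zmM xx.
by rewrite ger0_norm ?invr_ge0 ?(ltW (z0 xx)) // lef_pV2 ?posrE ?z0.
Qed.

Lemma zeta_bound x : x0 < x < x1 -> `|zeta x| <= M.
Proof. by move=> xx; have /andP[_ ?] := zmM xx; rewrite gtr0_norm // z0. Qed.

Let i12 : leb.-integrable setT (EFin \o m12).
Proof.
apply: integrable_patch; first exact: measurable_itv.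
exact: bounded_integrable piecewise_measurableV zetaV_bound.
Qed.

Let i21 : leb.-integrable setT (EFin \o m21).
Proof.
apply: integrable_patch; first exact: measurable_itv.
have mz := piecewise_measurable pac.
apply: (@bounded_integrable _ _ _ (sigma ^+ 2 * M)).
  exact: measurable_funM.
by move=> x xx; rewrite normrM normrN [ `|sigma ^+ 2|]ger0_norm ?sqr_ge0 // ler_wpM2l ?sqr_ge0 ?zeta_bound.
Qed.

Let slE f g : sl_solution x0 x1 zeta sigma f g <->
  lin_solution x0 x1 (fun=> 0) m12 m21 (fun=> 0) f g.
Proof.
have E12 x : x0 < x < x1 -> m12 x = (zeta x)^-1.
  by move=> xx; rewrite /m12 patchE mem_set // /= in_itv.
have E21 x : x0 < x < x1 -> m21 x = - sigma ^+ 2 * zeta x.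
  by move=> xx; rewrite /m21 patchE mem_set // /= in_itv.
by split=> -[af ag df dg]; split => //;
  [apply: (ae_imply df)|apply: (ae_imply dg)|apply: (ae_imply df)|apply: (ae_imply dg)]
  => x H xx; move: (H xx); rewrite ?E12 ?E21 // => /is_derive_eq; apply; ring.
Qed.

Lemma sl_exists (a b : R) :
  exists f g, [/\ sl_solution x0 x1 zeta sigma f g, f x0 = a & g x0 = b].
Proof.
have [f [g [fg fa gb _]]] := picard_solution x0 x1 a b i0 i12 i21 i0.
by exists f, g; split => //; apply/slE.
Qed.

Lemma sl_unique f g f' g' : sl_solution x0 x1 zeta sigma f g ->
  sl_solution x0 x1 zeta sigma f' g' -> f x0 = f' x0 -> g x0 = g' x0 ->
  forall x, x0 <= x <= x1 -> f x = f' x.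
Proof.
move=> s s' ff gg x xx.
have [f1 [g1 [/slE s1 f1p g1p]]] := sl_exists 1 0.
have [f2 [g2 [/slE s2 f2p g2p]]] := sl_exists 0 1.
have o : forall t : R, (fun=> 0 : R) t = - (fun=> 0 : R) t by move=> t; rewrite oppr0.
have [-> _] := lin_solution_repr o s1 s2 ((slE f g).1 s) f1p g1p f2p g2p xx.
have [-> _] := lin_solution_repr o s1 s2 ((slE f' g').1 s') f1p g1p f2p g2p xx.
by rewrite ff gg.
Qed.

Let y0k k : (k <= n)%N -> x0 <= y k /\ y k.+1 <= x1.
Proof.
move=> kn; have [? _] := piecewise_le hy (leqW kn).
by have [_ ?] := piecewise_le hy (kn : (k.+1 <= n.+1)%N).
Qed.

Lemma sl_piece f g k : (k <= n)%N -> sl_solution x0 x1 zeta sigma f g ->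
  sl_solution (y k) (y k.+1) zeta sigma f g.
Proof.
move=> kn [af ag df dg]; have [k0 k1] := y0k kn.
split; [exact: ac_on_sub af|exact: ac_on_sub ag|apply: (ae_imply df)|apply: (ae_imply dg)];
  move=> x H /andP[? ?]; apply: H; lra.
Qed.

(** Away from the jumps g / zeta is continuous, so the derivative exists at every point of a piece;
    this is what [cderive1] in the amplitude reads off. *)
Lemma sl_derive f g k x : (k <= n)%N -> sl_solution x0 x1 zeta sigma f g ->
  y k < x < y k.+1 -> is_derive x 1 f (g x * (zeta x)^-1).
Proof.
move=> kn /(sl_piece kn)[af ag df _] xk.
apply: (ac_on_derive_continuous (k := fun t => g t * (zeta t)^-1) af xk df) => t tk.
apply: cvgM.
  by apply: (within_continuous_continuous (hy kn) (ac_on_continuous ag)); rewrite in_itv.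
apply: cvgV; last exact: piecewise_continuous pac kn tk.
by rewrite gt_eqF // z0 // (piecewise_sub hy kn tk).
Qed.

Let x01 : x0 < x1. Proof. exact: piecewise_lt. Qed.
Let mz : measurable_fun `]x0, x1[ zeta. Proof. exact: piecewise_measurable pac. Qed.
Let mzV : measurable_fun `]x0, x1[ (fun x => (zeta x)^-1).
Proof. exact: piecewise_measurableV. Qed.

Lemma sl_bounded f g : sl_solution x0 x1 zeta sigma f g ->
  exists K, forall x, x0 < x < x1 -> `|f x| <= K /\ `|g x * (zeta x)^-1| <= K.
Proof.
move=> [af ag _ _].
have [K1 K10 fK] := ac_on_bounded (ltW x01) af.
have [K2 K20 gK] := ac_on_bounded (ltW x01) ag.
exists (K1 + K2 * m^-1) => x xx; have xx' : x0 <= x <= x1 by lra.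
have v0 : 0 < m^-1 by rewrite invr_gt0.
split; first by apply: le_trans (fK x xx') _; rewrite lerDl mulr_ge0 // ltW.
apply: (@le_trans _ _ (K2 * m^-1)); last by rewrite lerDr ltW.
by rewrite normrM ler_pM ?gK // (zetaV_bound).
Qed.

Lemma sl_weak f g phi : sl_solution x0 x1 zeta sigma f g -> test_function x0 x1 phi ->
  (\int[leb]_(x in `]x0, x1[) (f x * derive1 phi x) =
    - \int[leb]_(x in `]x0, x1[) (g x * (zeta x)^-1 * phi x)) /\
  (\int[leb]_(x in `]x0, x1[) (zeta x * (g x * (zeta x)^-1) * derive1 phi x) =
    sigma ^+ 2 * \int[leb]_(x in `]x0, x1[) (zeta x * f x * phi x)).
Proof.
move=> sl tphi; have [af ag df dg] := sl; have [K fgK] := sl_bounded sl.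
have mf := ac_on_measurable af; have mg := ac_on_measurable ag.
have izf : leb.-integrable `]x0, x1[ (EFin \o (fun x => zeta x * f x)).
  apply: (@bounded_integrable _ _ _ (M * K)); first exact: measurable_funM.
  by move=> x xx; rewrite normrM ler_pM ?(zeta_bound) //; have [] := fgK x xx.
split.
  apply: weak_ibp => //; apply: (bounded_integrable (K := K)).
    exact: measurable_funM.
  by move=> x /fgK[].
transitivity (\int[leb]_(x in `]x0, x1[) (g x * derive1 phi x)).
  apply: eq_Rintegral => x; rewrite inE /= in_itv /= => xx.
  by congr (_ * _); rewrite mulrCA mulfV ?mulr1 // gt_eqF // z0.
rewrite (weak_ibp x01 ag dg _ tphi); last first.
  have -> : EFin \o (fun x => - sigma ^+ 2 * zeta x * f x) =
      EFin \o (fun x => - sigma ^+ 2 * (zeta x * f x)).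
    by apply/funext => x /=; rewrite mulrA.
  exact: (integrableZl _ _ izf).
have [iz _] := integrable_test (ltW x01) tphi izf.
suff -> : \int[leb]_(x in `]x0, x1[) (- sigma ^+ 2 * zeta x * f x * phi x) =
    - sigma ^+ 2 * \int[leb]_(x in `]x0, x1[) (zeta x * f x * phi x).
  by rewrite mulNr opprK.
by rewrite -RintegralZl //; apply: eq_Rintegral => x _; rewrite !mulrA.
Qed.

Lemma sl_is_solution f1 g1 f2 g2 :
  sl_solution x0 x1 zeta sigma f1 g1 -> sl_solution x0 x1 zeta sigma f2 g2 ->
  is_solution x0 x1 zeta sigma (fun x => f1 x +i* f2 x).
Proof.
move=> s1 s2; have [K1 K1E] := sl_bounded s1; have [K2 K2E] := sl_bounded s2.
have [af1 ag1 _ _] := s1; have [af2 ag2 _ _] := s2.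
have mf1 := ac_on_measurable af1; have mg1 := ac_on_measurable ag1.
have mf2 := ac_on_measurable af2; have mg2 := ac_on_measurable ag2.
have bnd (r K K' : R) : `|r| <= K -> `|r| <= Num.max K K' /\ `|r| <= Num.max K' K.
  by move=> rK; rewrite !le_max rK orbT.
split.
  by move=> x; rewrite in_itv /= => xx; split => /=; exact: ac_on_continuous_at xx.
exists (fun x => (g1 x * (zeta x)^-1) +i* (g2 x * (zeta x)^-1)); split.
- apply: (square_integrable_bounded (K := Num.max K1 K2)) => // x xx.
  by have [/(bnd _ _ K2)[? _] _] := K1E x xx; have [/(bnd _ _ K1)[_ ?] _] := K2E x xx.
- apply: (square_integrable_bounded (K := Num.max K1 K2)) => [||x xx].
  + exact: measurable_funM.
  + exact: measurable_funM.
  by have [_ /(bnd _ _ K2)[? _]] := K1E x xx; have [_ /(bnd _ _ K1)[_ ?]] := K2E x xx.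
- move=> phi tphi; rewrite !cintegral_realM /=.
  by rewrite (sl_weak s1 tphi).1 (sl_weak s2 tphi).1.
- move=> phi tphi; rewrite !cintegral_real2M /=.
  rewrite (sl_weak s1 tphi).2 (sl_weak s2 tphi).2.
  by apply: complexP; rewrite /= ?Re_mulc ?Im_mulc /=; ring.
Qed.

Lemma piecewise_zeta k : (k <= n)%N ->
  exists L alpha : R -> R, [/\ ac_on (y k) (y k.+1) L,
    leb.-integrable setT (EFin \o alpha),
    {ae leb, forall x, y k < x < y k.+1 -> is_derive x 1 L (- 2 * alpha x)},
    {ae leb, forall x, y k < x < y k.+1 -> reflectivity zeta x = alpha x} &
    [/\ forall x, y k < x < y k.+1 -> zeta x = expR (L x),
        right_lim zeta (y k) = expR (L (y k)) & left_lim zeta (y k.+1) = expR (L (y k.+1))]].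
Proof.
move=> kn; apply: (zeta_piece (m := m)) => //; first exact: hy.
  by case: pac => _ _ _; apply.
by move=> x /(piecewise_sub hy kn)/zmM/andP[].
Qed.

Lemma right_lim_gt0 : 0 < right_lim zeta x0.
Proof.
by have [L [alpha [_ _ _ _ [_ -> _]]]] := piecewise_zeta (leq0n n); exact: expR_gt0.
Qed.

Lemma sl_cderive1 f1 g1 f2 g2 k x : (k <= n)%N ->
  sl_solution x0 x1 zeta sigma f1 g1 -> sl_solution x0 x1 zeta sigma f2 g2 ->
  y k < x < y k.+1 ->
  cderive1 (fun x => f1 x +i* f2 x) x = (g1 x * (zeta x)^-1) +i* (g2 x * (zeta x)^-1).
Proof.
move=> kn s1 s2 xk; rewrite /cderive1 /= !derive1E.
have [_ ->] := sl_derive kn s1 xk.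
by have [_ ->] := sl_derive kn s2 xk.
Qed.

(** Translates between the prescribed value u'(x0+) and the initial value of zeta u' at x0. *)
Lemma sl_derive1_right f g : sl_solution x0 x1 zeta sigma f g ->
  derive1 f t @[t --> x0^'+] --> g x0 * (right_lim zeta x0)^-1.
Proof.
move=> sl; have [_ ag _ _] := sl.
have [L [alpha [acL _ _ _ [zE -> _]]]] := piecewise_zeta (leq0n n).
have y01 := hy (leq0n n).
have C : g t * (expR (L t))^-1 @[t --> x0^'+] --> g x0 * (expR (L x0))^-1.
  apply: cvgM; first exact: ac_on_cvg_right ag.
  apply: cvgV; first by rewrite gt_eqF // expR_gt0.
  exact: ac_on_cvg_right (ac_on_expR acL).
apply: cvg_trans C; apply: near_eq_cvg; near=> t.
have tk : y 0%N < t < y 1%N.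
  apply/andP; split; near: t; [exact: nbhs_right_gt|exact: nbhs_right_lt].
by have [_] := sl_derive (leq0n n) sl tk; rewrite derive1E zE // => ->.
Unshelve. all: by end_near. Qed.

(** [weak_primitive] is used twice: h agrees with an absolutely continuous F with derivative k, and
    zeta k with an absolutely continuous G with derivative - sigma^2 zeta h, almost everywhere.
    Substituting k = G / zeta gives the system, and continuity turns h = F into an identity at every
    point. *)
Lemma weak_sl (h k : R -> R) (a b : R) :
  (forall x, x0 < x < x1 -> {for x, continuous h}) ->
  leb.-integrable `]x0, x1[ (EFin \o h) -> leb.-integrable `]x0, x1[ (EFin \o k) ->
  (forall phi, test_function x0 x1 phi ->
    \int[leb]_(x in `]x0, x1[) (h x * derive1 phi x) =
    - \int[leb]_(x in `]x0, x1[) (k x * phi x)) ->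
  (forall phi, test_function x0 x1 phi ->
    - (\int[leb]_(x in `]x0, x1[) (zeta x * k x * derive1 phi x)) +
    sigma ^+ 2 * (\int[leb]_(x in `]x0, x1[) (zeta x * h x * phi x)) = 0) ->
  h t @[t --> x0^'+] --> a -> derive1 h t @[t --> x0^'+] --> b ->
  exists f g, [/\ sl_solution x0 x1 zeta sigma f g, f x0 = a,
    g x0 = right_lim zeta x0 * b & forall x, x0 < x < x1 -> h x = f x].
Proof.
move=> ch ih ik wh wk ha hb.
have zI l : leb.-integrable `]x0, x1[ (EFin \o l) ->
    leb.-integrable `]x0, x1[ (EFin \o (fun x => zeta x * l x)).
  move=> il.
  have -> : (fun x => zeta x * l x) = (fun x => l x * zeta x).
    by apply/funext => x; rewrite mulrC.
  apply: (integrableM_bounded (K := M)) => //.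
  by move=> x xx; apply: (zeta_bound); move: xx; rewrite /= in_itv.
have [F [acF dF hF]] := weak_primitive x01 ih ik wh.
have hFE : forall x, x0 < x < x1 -> h x = F x.
  by apply: ae_eq_continuous => // x; exact: ac_on_continuous_at.
have izh : leb.-integrable `]x0, x1[ (EFin \o (fun x => - sigma ^+ 2 * zeta x * h x)).
  have -> : (fun x => - sigma ^+ 2 * zeta x * h x) = (fun x => - sigma ^+ 2 * (zeta x * h x)).
    by apply/funext => x /=; rewrite mulrA.
  exact: (integrableZl _ _ (zI _ ih)).
have wk' phi : test_function x0 x1 phi ->
    \int[leb]_(x in `]x0, x1[) (zeta x * k x * derive1 phi x) =
    - \int[leb]_(x in `]x0, x1[) (- sigma ^+ 2 * zeta x * h x * phi x).
  move=> tphi; have [iz _] := integrable_test (ltW x01) tphi (zI _ ih).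
  suff -> : \int[leb]_(x in `]x0, x1[) (- sigma ^+ 2 * zeta x * h x * phi x) =
      - sigma ^+ 2 * \int[leb]_(x in `]x0, x1[) (zeta x * h x * phi x).
    by rewrite mulNr opprK; apply/eqP; rewrite eq_sym -subr_eq0 addrC wk.
  by rewrite -RintegralZl //; apply: eq_Rintegral => x _; rewrite !mulrA.
have [G [acG dG kG]] := weak_primitive x01 (zI _ ik) izh wk'.
have sl : sl_solution x0 x1 zeta sigma F G.
  split => //.
    apply: (ae_imply2 dF kG) => x d e xx; have := d xx; rewrite -(e xx).
    by rewrite mulrAC mulfV ?mul1r // gt_eqF // z0.
  by apply: (ae_imply dG) => x d xx; rewrite -hFE //; exact: d.
exists F, G; split => //.
- apply: (cvg_unique _ (ac_on_cvg_right x01 acF)) => //.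
  apply: cvg_trans ha; apply: near_eq_cvg; near=> t; rewrite hFE //.
  by apply/andP; split; near: t; [exact: nbhs_right_gt|exact: nbhs_right_lt].
- have r0 := right_lim_gt0.
  (* Both sides are the right limit of the derivative of h = F at x0. *)
  suff -> : b = G x0 * (right_lim zeta x0)^-1 by rewrite mulrCA mulfV ?mulr1 // gt_eqF.
  apply: (cvg_unique _ hb) => //.
  apply: cvg_trans (sl_derive1_right sl); apply: near_eq_cvg; near=> t.
  have /andP[t0 t1] : x0 < t < x1.
    by apply/andP; split; near: t; [exact: nbhs_right_gt|exact: nbhs_right_lt].
  rewrite !derive1E; apply: near_eq_derive; near=> s; rewrite hFE //.
  apply/andP; split; near: s; [exact: lt_nbhsr|exact: lt_nbhsl].
Unshelve. all: by end_near. Qed.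

Lemma is_solution_sl (w : R -> R[i]) (a b : R[i]) :
  is_solution x0 x1 zeta sigma w -> cvg_right w x0 a -> cvg_right (cderive1 w) x0 b ->
  exists f1 g1 f2 g2, [/\ sl_solution x0 x1 zeta sigma f1 g1 /\ sl_solution x0 x1 zeta sigma f2 g2,
    f1 x0 = Re a /\ f2 x0 = Im a,
    g1 x0 = right_lim zeta x0 * Re b /\ g2 x0 = right_lim zeta x0 * Im b &
    forall x, x0 < x < x1 -> w x = f1 x +i* f2 x].
Proof.
move=> [cw [v [sw sv wd we]]] [wa1 wa2] [wb1 wb2].
have sqi (u : R -> R[i]) : square_integrable `]x0, x1[ u ->
    leb.-integrable `]x0, x1[ (EFin \o (fun x => Re (u x))) /\
    leb.-integrable `]x0, x1[ (EFin \o (fun x => Im (u x))).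
  move=> [m1 m2 fin].
  have ms (f : R -> R) : measurable_fun `]x0, x1[ f ->
      measurable_fun `]x0, x1[ (fun x => (f x ^+ 2)%:E).
    by move=> mf; apply/measurable_EFinP; exact: measurable_funX.
  have le (f g : R -> R) : measurable_fun `]x0, x1[ f -> measurable_fun `]x0, x1[ g ->
      (\int[leb]_(x in `]x0, x1[) (f x ^+ 2)%:E <=
       \int[leb]_(x in `]x0, x1[) (f x ^+ 2 + g x ^+ 2)%:E)%E.
    move=> mf mg; apply: ge0_le_integral => //.
    - by move=> x _; rewrite lee_fin sqr_ge0.
    - exact: ms.
    - by apply/measurable_EFinP; apply: measurable_funD; exact: measurable_funX.
    - by move=> x _; rewrite lee_fin lerDl sqr_ge0.
  split; apply: square_integrable_integrable => //; apply: le_lt_trans fin.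
    exact: le.
  by under [X in (_ <= X)%E]eq_integral do rewrite addrC; exact: le.
have [iw1 iw2] := sqi _ sw; have [iv1 iv2] := sqi _ sv.
have wd' phi : test_function x0 x1 phi -> _ := fun t =>
  etrans (esym (cintegral_realM _ _ _)) (etrans (wd phi t) (congr1 -%R (cintegral_realM _ _ _))).
have [f1 [g1 [s1 f1a g1b E1]]] : exists f g, [/\ sl_solution x0 x1 zeta sigma f g, f x0 = Re a,
    g x0 = right_lim zeta x0 * Re b & forall x, x0 < x < x1 -> Re (w x) = f x].
  apply: (@weak_sl _ (fun x => Re (v x))) => //.
  - by move=> x xx; have [] := cw x; rewrite ?in_itv.
  - by move=> phi /wd' /(congr1 (@complex.Re R)).
  - by move=> phi /we; rewrite !cintegral_real2M => /(congr1 (@complex.Re R)); rewrite /= mul0r subr0.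
have [f2 [g2 [s2 f2a g2b E2]]] : exists f g, [/\ sl_solution x0 x1 zeta sigma f g, f x0 = Im a,
    g x0 = right_lim zeta x0 * Im b & forall x, x0 < x < x1 -> Im (w x) = f x].
  apply: (@weak_sl _ (fun x => Im (v x))) => //.
  - by move=> x xx; have [] := cw x; rewrite ?in_itv.
  - by move=> phi /wd' /(congr1 (@complex.Im R)).
  - by move=> phi /we; rewrite !cintegral_real2M => /(congr1 (@complex.Im R)); rewrite /= mul0r addr0.
exists f1, g1, f2, g2; split => // x xx.
by rewrite -E1 // -E2 //; case: (w x).
Qed.

(** * Propagation along the pieces and across the jumps *)

Section transfer.
Variables f1 g1 f2 g2 : R -> R.
Hypothesis sigma0 : sigma != 0.
Hypothesis s1 : sl_solution x0 x1 zeta sigma f1 g1.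
Hypothesis s2 : sl_solution x0 x1 zeta sigma f2 g2.

(* The amplitude at x, with z in place of zeta x: z is a one-sided limit of zeta
   at a jump point. *)
Definition sl_amp (z x : R) : 'cV[R[i]]_2 :=
  amp (expR (ln z / 2) * f1 x) (expR (- (ln z / 2)) * (g1 x / sigma))
      (expR (ln z / 2) * f2 x) (expR (- (ln z / 2)) * (g2 x / sigma)).

Lemma amplitude_sl k x : (k <= n)%N -> y k < x < y k.+1 ->
  amplitude zeta sigma (fun t => f1 t +i* f2 t) x = sl_amp (zeta x) x.
Proof.
move=> kn xk; have zx := z0 (piecewise_sub hy kn xk).
apply: amplitude_amp => //; first by rewrite lnK.
by rewrite (sl_cderive1 kn s1 s2 xk) expRN lnK.
Qed.

(** The one-sided limits of zeta at both ends are values of exp L, so [piece_transfer] on the closed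
    piece covers inner points and the right end alike. *)
Lemma sl_amp_piece k : (k <= n)%N ->
  let A := sl_amp (right_lim zeta (y k)) (y k) in
  (forall x, y k < x < y k.+1 ->
    sl_amp (zeta x) x = propagation_matrix zeta (y k) x sigma%:C *m A) /\
  sl_amp (left_lim zeta (y k.+1)) (y k.+1) =
    propagation_matrix zeta (y k) (y k.+1) sigma%:C *m A.
Proof.
move=> kn A; rewrite /A.
have [L [alpha [acL ia dL rE [zE rL lL]]]] := piecewise_zeta kn.
have [af1 ag1 df1 dg1] := sl_piece kn s1.
have [af2 ag2 df2 dg2] := sl_piece kn s2.
have E (f g : R -> R) : {ae leb, forall x, y k < x < y k.+1 -> is_derive x 1 f (g x * (zeta x)^-1)} ->
    {ae leb, forall x, y k < x < y k.+1 -> is_derive x 1 f (g x * expR (- L x))}.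
  by move=> d; apply: (ae_imply d) => x H xk; move: (H xk); rewrite zE // expRN.
have E' (f g : R -> R) : {ae leb, forall x, y k < x < y k.+1 -> is_derive x 1 g (- sigma ^+ 2 * zeta x * f x)} ->
    {ae leb, forall x, y k < x < y k.+1 -> is_derive x 1 g (- sigma ^+ 2 * expR (L x) * f x)}.
  by move=> d; apply: (ae_imply d) => x H xk; move: (H xk); rewrite zE.
have T := piece_transfer sigma0 ia rE acL af1 ag1 af2 ag2 dL (E _ _ df1) (E' _ _ dg1) (E _ _ df2) (E' _ _ dg2).
have yk := hy kn.
split=> [x xk|]; rewrite /sl_amp rL ?lL ?zE // !expRK; apply: T; last by rewrite lexx ltW.
by have /andP[/ltW -> /ltW ->] := xk.
Qed.

Lemma sl_amp_jump k : (k < n)%N ->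
  jump_matrix zeta (y k.+1) *m sl_amp (left_lim zeta (y k.+1)) (y k.+1) =
  sl_amp (right_lim zeta (y k.+1)) (y k.+1).
Proof.
move=> kn.
have [L [_ [_ _ _ _ [_ _ lL]]]] := piecewise_zeta (ltnW kn).
have [L' [_ [_ _ _ _ [_ rL _]]]] := piecewise_zeta kn.
rewrite /jump_matrix /jump_ratio /sl_amp lL rL !expRK.
(* g is the square root of the jump ratio. L and L' belong to the pieces to the left and to the
   right of the jump. *)
set l := L _; set r := L' _; pose g := expR (l / 2 - r / 2).
have g0 : 0 < g := expR_gt0 _.
have gE : expR l / expR r = g ^+ 2.
  by rewrite -expRN -expRD /g expr2 -expRD; congr expR; field.
rewrite gE sqrtr_sqr gtr0_norm //.
have P c : expR (l / 2) * c = g * (expR (r / 2) * c).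
  by rewrite mulrA -expRD; congr (expR _ * _); ring.
have Q c : expR (- (l / 2)) * c = expR (- (r / 2)) * c / g.
  by rewrite -expRN mulrAC -expRD; congr (expR _ * _); ring.
by rewrite !P !Q amp_jump.
Qed.

Lemma sl_amp_transfer k : (k <= n)%N ->
  sl_amp (right_lim zeta (y k)) (y k) =
  transfer_matrix zeta y sigma%:C k *m sl_amp (right_lim zeta x0) x0.
Proof.
elim: k => [|k IH] kn /=; first by rewrite mul1mx.
by rewrite -sl_amp_jump // (sl_amp_piece (ltnW kn)).2 (IH (ltnW kn)) !mulmxA.
Qed.

(** [clim_right] is total, so its value is known only once the limits exist: near x0 the components
    of the amplitude agree with absolutely continuous functions on the closed first piece, whose
    values at x0 are the limits. *)
Lemma amplitude_right_sl :
  amplitude_right zeta sigma (fun t => f1 t +i* f2 t) x0 = sl_amp (right_lim zeta x0) x0.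
Proof.
have [L [_ [acL _ _ _ [zE rL _]]]] := piecewise_zeta (leq0n n).
have y01 := hy (leq0n n).
have [af1 ag1 _ _] := sl_piece (leq0n n) s1.
have [af2 ag2 _ _] := sl_piece (leq0n n) s2.
have e1 : ac_on (y 0%N) (y 1%N) (fun t => expR (L t / 2)).
  by apply: ac_on_expR; apply: ac_onM => //; exact: ac_on_cst.
have e2 : ac_on (y 0%N) (y 1%N) (fun t => expR (- (L t / 2))).
  by apply: ac_on_expR; apply: ac_onN; apply: ac_onM => //; exact: ac_on_cst.
have P (f : R -> R) : ac_on (y 0%N) (y 1%N) f -> ac_on (y 0%N) (y 1%N) (fun t => expR (L t / 2) * f t).
  exact: ac_onM.
have Q (f : R -> R) : ac_on (y 0%N) (y 1%N) f -> ac_on (y 0%N) (y 1%N) (fun t => expR (- (L t / 2)) * (f t / sigma)).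
  by move=> ac; apply: ac_onM => //; apply: ac_onM => //; exact: ac_on_cst.
have N : \forall t \near x0^'+, amplitude zeta sigma (fun t => f1 t +i* f2 t) t = sl_amp (expR (L t)) t.
  near=> t; have tk : y 0%N < t < y 1%N.
    by apply/andP; split; near: t; [exact: nbhs_right_gt|exact: nbhs_right_lt].
  by rewrite (amplitude_sl (leq0n n) tk) zE.
rewrite /amplitude_right /clim_right rL; apply/matrixP => i j; rewrite [j]ord1 !mxE /=.
have lim_eq (F : R -> R) (G : R -> R) : (\forall t \near x0^'+, F t = G t) -> ac_on (y 0%N) (y 1%N) G ->
    lim (F t @[t --> x0^'+]) = G x0.
  move=> FG acG; apply: cvg_lim => //; apply: cvg_trans (ac_on_cvg_right y01 acG).
  by apply: near_eq_cvg; apply: filterS FG => t ->.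
have half (f g : R -> R) : ac_on (y 0%N) (y 1%N) f -> ac_on (y 0%N) (y 1%N) g ->
    ac_on (y 0%N) (y 1%N) (fun t => (f t + g t) / 2) /\ ac_on (y 0%N) (y 1%N) (fun t => (f t - g t) / 2).
  by move=> acf acg; split; apply: ac_onM; [exact: ac_onD|exact: ac_on_cst|exact: ac_onB|exact: ac_on_cst].
have [h1 h2] := half _ _ (P _ af1) (Q _ ag2).
have [h3 h4] := half _ _ (P _ af2) (Q _ ag1).
case: ifP => ie; rewrite !expRK; congr (_ +i* _).
- by apply: (lim_eq _ _ _ h2); apply: filterS N => t ->; rewrite /sl_amp /amp mxE ie expRK.
- by apply: (lim_eq _ _ _ h3); apply: filterS N => t ->; rewrite /sl_amp /amp mxE ie expRK.
- by apply: (lim_eq _ _ _ h1); apply: filterS N => t ->; rewrite /sl_amp /amp mxE ie expRK.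
- by apply: (lim_eq _ _ _ h4); apply: filterS N => t ->; rewrite /sl_amp /amp mxE ie expRK.
Unshelve. all: by end_near. Qed.

Lemma amplitude_transfer k x : (k <= n)%N -> y k < x < y k.+1 ->
  amplitude zeta sigma (fun t => f1 t +i* f2 t) x =
  propagation_matrix zeta (y k) x sigma%:C *m transfer_matrix zeta y sigma%:C k
    *m amplitude_right zeta sigma (fun t => f1 t +i* f2 t) x0.
Proof.
move=> kn xk; rewrite (amplitude_sl kn xk) ((sl_amp_piece kn).1 x xk).
by rewrite (sl_amp_transfer kn) amplitude_right_sl mulmxA.
Qed.

End transfer.
End piecewise.

Theorem theorem2 (R : realType) (n : nat) (x0 x1 : R) (y : nat -> R)
    (zeta : R -> R) (sigma : R) (a b : R[i])
    (hx : x0 < x1)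
    (hy0 : y 0%N = x0) (hy1 : y n.+1 = x1)
    (hy : forall k : nat, (k <= n)%N -> y k < y k.+1)
    (zeta_gt0 : forall x : R, x \in `]x0, x1[ -> 0 < zeta x)
    (zeta_bounded : [bounded (zeta x : R^o) | x in `]x0, x1[])
    (zetaV_bounded : [bounded ((zeta x)^-1 : R^o) | x in `]x0, x1[])
    (zeta_ac : forall k : nat, (k <= n)%N ->
       absolutely_continuous `]y k, y k.+1[ zeta)
    (sigma_neq0 : sigma != 0) :
  exists u : R -> R[i],
    [/\ [/\ is_solution x0 x1 zeta sigma u,
            cvg_right u x0 a & cvg_right (cderive1 u) x0 b],
        (forall w : R -> R[i],
           [/\ is_solution x0 x1 zeta sigma w,
               cvg_right w x0 a & cvg_right (cderive1 w) x0 b] ->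
           forall x : R, x \in `]x0, x1[ -> w x = u x) &
        forall (j : nat) (x : R), (j <= n)%N -> y j < x < y j.+1 ->
          amplitude zeta sigma u x =
          propagation_matrix zeta (y j) x sigma%:C
            *m transfer_matrix zeta y sigma%:C j
            *m amplitude_right zeta sigma u x0].
Proof.
have [M M0 zM] : exists2 M, 0 < M & forall x, x0 < x < x1 -> `|zeta x| <= M.
  have [M [M0 H]] := ex_strict_bound_gt0 zeta_bounded.
  by exists M => // x xx; apply/ltW; apply: H; rewrite /= in_itv.
have [K K0 zK] : exists2 K, 0 < K & forall x, x0 < x < x1 -> `|(zeta x)^-1| <= K.
  have [K [K0 H]] := ex_strict_bound_gt0 zetaV_bounded.
  by exists K => // x xx; apply/ltW; apply: H; rewrite /= in_itv.
subst x0 x1.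
(* The bound K on 1 / zeta is the lower bound [K^-1] on zeta. *)
have pac : piecewise_ac n y K^-1 M zeta.
  split => // [|x xx]; first by rewrite invr_gt0.
  have zx : 0 < zeta x by apply: zeta_gt0; rewrite in_itv.
  have := zK _ xx; have := zM _ xx; rewrite !ger0_norm ?invr_ge0 ?(ltW zx) // => -> zk.
  by rewrite andbT -[zeta x]invrK lef_pV2 // posrE invr_gt0.
have r0 := right_lim_gt0 pac.
(* The second unknown is zeta u', so it starts at zeta(x0+) times the prescribed derivative. *)
have [f1 [g1 [s1 f1a g1b]]] := sl_exists sigma pac (Re a) (right_lim zeta (y 0%N) * Re b).
have [f2 [g2 [s2 f2a g2b]]] := sl_exists sigma pac (Im a) (right_lim zeta (y 0%N) * Im b).
have [af1 ag1 _ _] := s1; have [af2 ag2 _ _] := s2.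
exists (fun x => f1 x +i* f2 x); split.
- split; first exact: (sl_is_solution pac s1 s2).
    by rewrite /cvg_right -f1a -f2a; split; [exact: ac_on_cvg_right hx af1|exact: ac_on_cvg_right hx af2].
  have d (c : R) : c = right_lim zeta (y 0%N) * c * (right_lim zeta (y 0%N))^-1.
    by rewrite mulrAC mulfV ?mul1r // gt_eqF.
  split => /=; first by rewrite (d (Re b)) -g1b; exact: (sl_derive1_right pac s1).
  by rewrite (d (Im b)) -g2b; exact: (sl_derive1_right pac s2).
- move=> w [ws wa wb] x; rewrite in_itv /= => xx.
  have [h1 [k1 [h2 [k2 [[t1 t2] [h1a h2a] [k1b k2b] ->]]]]] := is_solution_sl pac ws wa wb => //.
  have xx' : y 0%N <= x <= y n.+1 by have /andP[/ltW -> /ltW ->] := xx.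
  rewrite (sl_unique pac t1 s1 _ _ xx') ?h1a ?k1b //.
  by rewrite (sl_unique pac t2 s2 _ _ xx') ?h2a ?k2b.
- by move=> j x jn xj; exact: (amplitude_transfer pac sigma_neq0 s1 s2 jn xj).
Qed.
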